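(* Let $\mathcal S\subseteq\mathbb R^d$ and let $(\mathcal L,\mathrm{Dom}(\mathcal L))$ be the generator in $L^2(\mu)$ of a reversible diffusion process on $\mathcal S$ with invariant probability measure $\mu$ and Dirichlet form $\mathcal E$, such that $C^\infty(\mathcal S)\cap L^2(\mu)\subseteq\mathrm{Dom}(\mathcal L)$. Suppose that $\mathcal L$ has purely discrete spectrum on $L^2(\mu)$ and satisfies, for some $m>0$, the Poincaré inequality $\|f-\mu(f)\|^2_{L^2(\mu)}\le\frac1m\mathcal E(f,f)$ for all $f\in\mathrm{Dom}(\mathcal E)$. Then for any $T\in(0,\infty)$ there exists a constant $C\in(0,\infty)$ such that for any $f\in L_0^2(\lambda\otimes\mu)$ there are functions $$h\in H^{1,2}_{\mathrm D}(\lambda\otimes\mu)\qquad\text{and}\qquad g\in H^{2,2}_{\mathrm D}(\lambda\otimes\mu)$$ such that $$\partial_th-2\mathcal Lg=f,$$ and $h$ and $g$ satisfy $$\|2\mathcal Lg\|_{L^2(\lambda\otimes\mu)}\le C\|f\|_{L^2(\lambda\otimes\mu)},$$ $$\sqrt{2\mathcal E_T(h)}\le C\|f\|_{L^2(\lambda\otimes\mu)},$$ $$\sqrt{2\mathcal E_T(\partial_tg)}\le C\big(1+T^{-1}m^{-1/2}\big)\|f\|_{L^2(\lambda\otimes\mu)}.$$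
   Context: $\lambda$ is Lebesgue measure on $[0,T]$, and $L_0^2(\lambda\otimes\mu)$ is the space of $f\in L^2(\lambda\otimes\mu)$ with $\int f\,d(\lambda\otimes\mu)=0$. The Dirichlet form $\mathcal E$ is the closed symmetric extension of $\mathcal E(f,g)=-\int_{\mathcal S}f\mathcal Lg\,d\mu$, with domain $\mathrm{Dom}(\mathcal E)$ the closure of $\mathrm{Dom}(\mathcal L)$ w.r.t. $\|f\|_{L^2(\mu)}+\mathcal E(f,f)^{1/2}$. For $g\in L^2(\lambda\otimes\mu)$ with $g(t,\cdot)\in\mathrm{Dom}(\mathcal E)$ for $\lambda$-a.e. $t\in[0,T]$, set $\mathcal E_T(g)=\int_0^T\mathcal E(g(t,\cdot),g(t,\cdot))\,dt$. $H^{1,2}_{\mathrm D}(\lambda\otimes\mu)$ is the closure of $$\{u\in C^\infty([0,T]\times\mathcal S)\cap L^2(\lambda\otimes\mu):u(0,\cdot)=u(T,\cdot)=0\}$$ with respect to the norm $\|u\|_{1,2}=\|u\|_{L^2(\lambda\otimes\mu)}+\mathcal E_T(u)^{1/2}+\|\partial_tu\|_{L^2(\lambda\otimes\mu)}$, and $H^{2,2}_{\mathrm D}(\lambda\otimes\mu)$ is the closure of the same set with respect to $$\|u\|_{2,2}=\|u\|_{L^2(\lambda\otimes\mu)}+\mathcal E_T(u)^{1/2}+\|\partial_tu\|_{L^2(\lambda\otimes\mu)}+\|\mathcal Lu\|_{L^2(\lambda\otimes\mu)}+\|\partial_{tt}u\|_{L^2(\lambda\otimes\mu)}+\mathcal E_T(\partial_tu)^{1/2}.$$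 Here $\mathcal L$ acts on the $x$ variable only.
   Formalization: The formal theorem additionally assumes that C^∞(S)∩L²(μ) is a core for L (dense in Dom(L) in the graph norm); without this the claim fails, and the conclusion itself implies it. *)

(* Defs.v *)
(* MathComp-Analysis. Elements of L^2 are represented by square-integrable
   functions (`Lfun _ 2%:E`), identified when they agree almost everywhere;
   unbounded operators are represented by their graphs. *)
From HB Require Import structures.
From mathcomp Require Import all_boot all_order all_algebra.
From mathcomp Require Import all_classical all_reals all_analysis.

Set Implicit Arguments.
Unset Strict Implicit.
Unset Printing Implicit Defensive.
Import Order.TTheory GRing.Theory Num.Theory.
Import numFieldNormedType.Exports.
Local Open Scope classical_set_scope.
Local Open Scope ring_scope.

(* The set S as a type with its subspace topology and Borel sigma-algebra. The
   point x0 only serves to satisfy the nonemptiness built into measurableType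
   (a set carrying a probability measure is nonempty anyway). *)
Definition state (R : realType) (d : nat) (S : set 'rV[R]_d) (x0 : S) : Type := S.

Section state_instances.
Context (R : realType) (d : nat) (S : set 'rV[R]_d) (x0 : S).

HB.instance Definition _ := Topological.copy (state x0) S.
HB.instance Definition _ := isPointed.Build (state x0) x0.
HB.instance Definition _ := @isMeasurable.Build
  (sigma_display (@open (state x0))) (state x0) <<s @open (state x0) >>
  (@sigma_algebra0 _ setT _) (@sigma_algebraC _ _)
  (@sigma_algebra_bigcup _ setT _).

End state_instances.

Section smooth.
Context (R : realType).

Fixpoint Ck (V : normedModType R) (k : nat) (U : set V) (F : V -> R) : Prop :=
  (forall x, U x -> {for x, continuous F}) /\
  match k with
  | 0%N => True
  | k'.+1 => forall v : V,
      (forall x, U x -> derivable F x v) /\ Ck k' U (fun x => 'D_v F x)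
  end.

(* f is C^oo on the subset j @` D of V: it is the restriction of a C^oo function
   defined on an open neighbourhood of that set. *)
Definition smooth_along (I : Type) (V : normedModType R) (j : I -> V)
    (D : set I) (f : I -> R) : Prop :=
  exists (U : set V) (F : V -> R),
    [/\ open U, j @` D `<=` U, forall k, Ck k U F
      & forall i, D i -> f i = F (j i)].

Context (d : nat) (S : set 'rV[R]_d) (x0 : S).

Definition smooth_space (f : state x0 -> R) : Prop :=
  smooth_along (fun x : state x0 => val x) setT f.

(* Functions on [0, T] x S are given as functions on R x S whose values outside
   [0, T] x S are irrelevant. *)
Definition smooth_spacetime (T : R) (u : measurableTypeR R * state x0 -> R)
    : Prop :=
  smooth_along (fun z : measurableTypeR R * state x0 => ((z.1 : R), val z.2))
    [set z | 0 <= (z.1 : R) <= T] u.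

End smooth.

Definition L2norm d (T : measurableType d) (R : realType)
    (mu : {measure set T -> \bar R}) (f : T -> R) : \bar R :=
  ('N[mu]_2%:E [EFin \o f])%E.

Section diffusion.
Context (R : realType) (dS : measure_display) (S : measurableType dS)
  (dO : measure_display) (Omega : measurableType dO)
  (P : R.-pker S ~> Omega) (X : R -> Omega -> S).

(* Paths are indexed by t >= 0; X t is irrelevant for t < 0. *)
Definition history (s : R) : set (set Omega) :=
  <<s [set A | exists r B,
         [/\ 0 <= r <= s, measurable B & A = X r @^-1` B]] >>.

Definition markov_process : Prop :=
  [/\ forall t : R, 0 <= t -> measurable_fun setT (X t),
      forall x, P x [set w | X 0 w = x] = 1%E
    & forall (s t : R) x A B, 0 <= s -> 0 <= t -> history s A -> measurable B ->
        P x (A `&` X (s + t) @^-1` B) =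
        (\int[P x]_(w in A) P (X s w) (X t @^-1` B))%E].

(* Taking A to be the whole space shows that mu is invariant. *)
Definition reversible (mu : probability S R) : Prop :=
  forall (t : R) A B, 0 <= t -> measurable A -> measurable B ->
    (\int[mu]_(x in A) P x (X t @^-1` B) =
     \int[mu]_(x in B) P x (X t @^-1` A))%E.

(* P_t f(x) = E_x[f(X_t)]; for f in L^2(mu) it is defined for mu-a.e. x. *)
Definition semigroup (t : R) (f : S -> R) : S -> R :=
  fun x => \int[P x]_w f (X t w).

(* `generator mu f g` : f is in Dom(L) and L f = g in L^2(mu). *)
Definition generator (mu : probability S R) (f g : S -> R) : Prop :=
  [/\ f \in Lfun mu 2%:E, g \in Lfun mu 2%:E
    & L2norm mu (fun x => t^-1 * (semigroup t f x - f x) - g x)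
        @[t --> 0^'+] --> 0%E].

End diffusion.

Definition continuous_paths (R : realType) (Omega : Type)
    (S : topologicalType) (X : R -> Omega -> S) : Prop :=
  forall w, {within `[0, +oo[, continuous (fun t => X t w)}.

Definition diffusion_process (R : realType) (d : nat) (S : set 'rV[R]_d)
    (x0 : S) (dO : measure_display) (Omega : measurableType dO)
    (P : R.-pker (state x0) ~> Omega) (X : R -> Omega -> state x0) : Prop :=
  markov_process P X /\ continuous_paths X.

Section operators.
Context (R : realType) (dS : measure_display) (S : measurableType dS)
  (mu : probability S R) (L : (S -> R) -> (S -> R) -> Prop).

Definition opdom : set (S -> R) := [set f | exists g, L f g].

(* z - L : Dom(L) -> L^2(mu) is onto, and one-to-one with bounded inverse. For a
   self-adjoint L the complex spectrum is real, so that real z suffice. *)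
Definition resolvent_set : set R :=
  [set z | (forall f, f \in Lfun mu 2%:E -> exists u v,
              L u v /\ (fun x => z * u x - v x) = f %[ae mu]) /\
           exists K : R, forall u v, L u v ->
             (L2norm mu u <= K%:E * L2norm mu (fun x => z * u x - v x)%R)%E].

Definition spectrum : set R := ~` resolvent_set.

Definition eigenfunction (z : R) (u : S -> R) : Prop :=
  exists v, L u v /\ v = (fun x => z * u x) %[ae mu].

Definition is_eigenvalue (z : R) : Prop :=
  exists u, eigenfunction z u /\ L2norm mu u <> 0%E.

Definition finite_multiplicity (z : R) : Prop :=
  exists (n : nat) (e : 'I_n -> S -> R), forall u, eigenfunction z u ->
    exists c : 'I_n -> R, u = (fun x => \sum_(i < n) c i * e i x) %[ae mu].

Definition purely_discrete_spectrum : Prop :=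
  forall z, spectrum z ->
    [/\ is_eigenvalue z, finite_multiplicity z
      & exists2 e : R, 0 < e &
          forall y, spectrum y -> `|y - z| < e -> y = z].

(* The functions of D lying in Dom(L) are dense in Dom(L) for the graph norm. *)
Definition operator_core (D : set (S -> R)) : Prop :=
  forall f g, L f g -> forall e : R, 0 < e ->
    exists v w, [/\ D v, L v w
      & (L2norm mu (fun x => f x - v x)%R + L2norm mu (fun x => g x - w x)%R
         < e%:E)%E].

(* - \int f Lg dmu *)
Definition preform (f Lg : S -> R) : R := - \int[mu]_x (f x * Lg x).

(* `closed_form f e` : f lies in Dom(E), the closure of Dom(L) for the norm
   |f| + E(f, f)^(1/2), and E(f, f) = e. *)
Definition closed_form (f : S -> R) (e : R) : Prop :=
  f \in Lfun mu 2%:E /\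
  exists fn Lfn : nat -> S -> R,
    [/\ forall n, L (fn n) (Lfn n),
        L2norm mu (fun x => fn n x - f x) @[n --> \oo] --> 0%E,
        forall e' : R, 0 < e' -> exists N, forall n k, (N <= n)%N -> (N <= k)%N ->
          preform (fun x => fn n x - fn k x) (fun x => Lfn n x - Lfn k x) < e'
      & preform (fn n) (Lfn n) @[n --> \oo] --> e].

Definition form_dom : set (S -> R) := [set f | exists e, closed_form f e].

(* E(f, f), with the value +oo outside Dom(E); on Dom(E) the infimum is taken
   over a singleton, as the form is closable. *)
Definition dirichlet_form (f : S -> R) : \bar R :=
  ereal_inf [set e%:E | e in closed_form f].

Definition poincare (m : R) : Prop :=
  forall f, form_dom f ->
    ((L2norm mu (fun x => f x - \int[mu]_y f y)%R) ^+ 2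
       <= m^-1%:E * dirichlet_form f)%E.

End operators.

Definition leb (R : realType) (T : R) :
    {measure set (measurableTypeR R) -> \bar R} :=
  mrestr lebesgue_measure (@measurable_itv R `[0, T]).

Section spacetime.
Context (R : realType) (d : nat) (S : set 'rV[R]_d) (x0 : S)
  (mu : probability (state x0) R)
  (L : (state x0 -> R) -> (state x0 -> R) -> Prop) (T : R).

Definition lebmu := (leb T \x mu)%E.

Implicit Types u v w : measurableTypeR R * state x0 -> R.

Definition L2T u : Prop := u \in Lfun lebmu 2%:E.
Definition normT u : \bar R := L2norm lebmu u.

Definition energyT u : \bar R :=
  (\int[leb T]_t dirichlet_form mu L (fun x => u (t, x)))%E.

Definition is_dt u v : Prop :=
  forall (t : R) x, 0 < t < T -> is_derive t 1 (fun s : R => u (s, x)) (v (t, x)).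

(* L acts on the space variable only. *)
Definition is_Lx u v : Prop :=
  {ae leb T, forall t, L (fun x => u (t, x)) (fun x => v (t, x))}.

Definition test_function u : Prop :=
  [/\ smooth_spacetime T u, L2T u & forall x, u (0, x) = 0 /\ u (T, x) = 0].

(* The norms take as arguments u together with the derivatives of u entering
   them: ut, Lu, utt stand for d_t u, L u, d_tt u. *)
Definition norm12 u ut : \bar R :=
  (normT u + energyT u `^ (2^-1) + normT ut)%E.

Definition norm22 u ut Lu utt : \bar R :=
  (normT u + energyT u `^ (2^-1) + normT ut + normT Lu + normT utt
   + energyT ut `^ (2^-1))%E.

(* `H12D h ht` : h lies in the closure H^{1,2}_D of the test functions, and ht
   is d_t h, i.e., the L^2-limit of d_t u along test functions u tending to h
   for the norm. *)
Definition H12D h ht : Prop :=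
  [/\ L2T h, L2T ht & forall e : R, 0 < e ->
    exists u ut,
      [/\ test_function u, L2T ut /\ is_dt u ut, (norm12 u ut < +oo)%E
        & (norm12 (fun z => h z - u z)%R (fun z => ht z - ut z)%R < e%:E)%E]].

(* `H22D g gt Lg gtt` : likewise for H^{2,2}_D, with d_t g, L g, d_tt g = gt, Lg,
   gtt. *)
Definition H22D g gt Lg gtt : Prop :=
  [/\ L2T g, L2T gt, L2T Lg, L2T gtt & forall e : R, 0 < e ->
    exists u ut Lu utt,
      [/\ test_function u,
          [/\ L2T ut, L2T Lu & L2T utt],
          [/\ is_dt u ut, is_Lx u Lu & is_dt ut utt],
          (norm22 u ut Lu utt < +oo)%E
        & (norm22 (fun z => g z - u z)%R (fun z => gt z - ut z)%R
             (fun z => Lg z - Lu z)%R (fun z => gtt z - utt z)%R < e%:E)%E]].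

End spacetime.

(* Main.v *)
(* The equation is solved up to a small error for a dense class of right-hand sides, and the error is
   removed by iteration.
   By the Poincare inequality, X = - (6 / m) L is >= 6 on mean-zero functions. Let F be a finite sum
   of products phi_i(t) c_i(x) with c_i of mean zero. With rho_j = (1 + 4^-j X)^-1 and
   psi(s) = s^2 (3 - 2 s), the operators beta_j = psi(rho_(j+1)) - psi(rho_j) are nonnegative and
   beta_j localizes X around 4^j. At level j, let U_j phi be the average of phi over 2^j cells of
   [0, T], smoothed by bumps that vanish at the ends of the cells, and V_j phi the primitive of
   phi - U_j phi; both vanish at 0 and T, and V_j = O(2^-j), d_t^k U_j = O(2^(j k)). Then
   h = \sum_j V_j beta_j F and g with - 2 L g = \sum_j U_j beta_j F satisfy
   d_t h - 2 L g = \sum_j beta_j F, which differs from F by psi(rho_0) F + (1 - psi(rho_J)) F,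
   of norm <= |F| / 8 + o(1) as J grows. The part of F independent of x is integrated in t alone.
   No spectral decomposition is needed for the bounds. Only resolvents are used, to write c_i = Q(Z) w_i
   with Z = X - 6 >= 0 and Q = \prod_j (1 + 4^-j X)^3; this turns all operators into polynomials in Z,
   and operator inequalities follow from the nonnegativity of coefficients. The Schur product theorem
   combines them with the inequalities between Gram matrices of the time factors. *)

(* The obstacle is a conflict between the boundary condition in time and the energy in space. A
   primitive in t of F minus its time average vanishes at 0 and T but has no regularity in x, while
   - L^-1 F / 2 is regular in x but need not vanish at 0 and T. At level j, where X is about 4^j,
   cells of length T 2^-j balance the two: X^(1/2) V_j and X^(-1/2) d_t U_j are bounded uniformly in
   j. The cubic psi is chosen because its derivative vanishes at 0 and at 1. With Y = 4^-(j+1) X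
   this makes beta_j of order Y^2 for small Y and Y^-2 for large Y, so that the sums over j stay
   bounded even with the weights 4^j / X and 4^-j X. For psi(s) = s the decay would be of order one,
   and these weighted sums would diverge. The 6 in X makes psi(rho_0) small: psi(1/7) = 19/343 <
   1/8. After all approximations the residual is at most a quarter of the right-hand side, so the
   iteration gives geometric series, and the ratio 1/4 is also what makes their energies
   converge. *)
Require Import Defs.
From HB Require Import structures.
From mathcomp Require Import all_boot all_order all_algebra.
From mathcomp Require Import all_classical all_reals all_analysis.
From mathcomp Require Import measurable_realfun.
From mathcomp Require Import zify lra ring.
Set Implicit Arguments.
Unset Strict Implicit.
Unset Printing Implicit Defensive.
Import Order.TTheory GRing.Theory Num.Theory.
Import numFieldNormedType.Exports HBNNSimple.
Local Open Scope classical_set_scope.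
Local Open Scope ring_scope.

(** * Square-integrable functions *)

Section L2_theory.
Context d (T : measurableType d) (R : realType) (m : {measure set T -> \bar R}).
Implicit Types f g h : T -> R.

Local Notation L2 f := (f \in Lfun m 2%:E).

Definition ip f g : R := \int[m]_x (f x * g x).
Definition nrm f : R := Num.sqrt (ip f f).

Lemma L2_measurable f : L2 f -> measurable_fun setT f.
Proof. by rewrite inE => /andP[]; rewrite inE. Qed.

Lemma L2norm_sqr f : (L2norm m f = (\int[m]_x ((f x) ^+ 2)%:E) `^ (2^-1))%E.
Proof.
rewrite /L2norm unlock; congr (_ `^ _)%E; apply: eq_integral => x _ /=.
by rewrite powR_mulrn ?normr_ge0// real_normK ?num_real.
Qed.

Lemma L2P f : L2 f <-> measurable_fun setT f /\ (\int[m]_x ((f x) ^+ 2)%:E < +oo)%E.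
Proof.
split=> [Lf|[mf lf]].
  split; first exact: L2_measurable.
  have /integrableP[_] := Lfun2_integrable_sqr Lf.
  by under eq_integral do rewrite /= ger0_norm ?sqr_ge0//.
rewrite inE; apply/andP; split; rewrite inE//= /finite_norm.
by have := L2norm_sqr f; rewrite /L2norm => ->; rewrite poweR_lty.
Qed.

Lemma ip_integrable f g : L2 f -> L2 g -> m.-integrable setT (fun x => (f x * g x)%:E).
Proof. by move=> Lf Lg; have /Lfun1_integrable := Lfun2_mul_Lfun1 Lf Lg. Qed.

Lemma ipE f g : L2 f -> L2 g -> ((ip f g)%:E = \int[m]_x (f x * g x)%:E)%E.
Proof.
by move=> Lf Lg; rewrite /ip /Rintegral fineK// integrable_fin_num//; exact: ip_integrable.
Qed.

Lemma ipC f g : ip f g = ip g f.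
Proof. by apply: eq_Rintegral => x _; rewrite mulrC. Qed.

Let p1 : (1 <= 2%:E :> \bar R)%E.
Proof. by rewrite lee_fin ler1n. Qed.

Lemma L2D f g : L2 f -> L2 g -> L2 (fun x => f x + g x).
Proof. by move=> Lf Lg; exact: (LfunP (Lfun_Sub p1 Lf + Lfun_Sub p1 Lg)). Qed.

Lemma L2Z a f : L2 f -> L2 (fun x => a * f x).
Proof. by move=> Lf; exact: (LfunP (a *: Lfun_Sub p1 Lf)). Qed.

Lemma L2N f : L2 f -> L2 (fun x => - f x).
Proof. by move=> Lf; exact: (LfunP (- Lfun_Sub p1 Lf)). Qed.

Lemma L2B f g : L2 f -> L2 g -> L2 (fun x => f x - g x).
Proof. by move=> Lf Lg; apply: L2D => //; exact: L2N. Qed.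

Lemma L2_0 : L2 (fun=> 0).
Proof. exact: (LfunP (0 : LfunType m p1)). Qed.

Lemma L2_sum n (F : 'I_n -> T -> R) : (forall i, L2 (F i)) ->
  L2 (fun x => \sum_(i < n) F i x).
Proof.
elim: n F => [|n IH] F LF.
  by under eq_fun do rewrite big_ord0; exact: L2_0.
by under eq_fun do rewrite big_ord_recl; apply: L2D => //; exact: IH.
Qed.

Lemma ipDl f g h : L2 f -> L2 g -> L2 h -> ip (fun x => f x + g x) h = ip f h + ip g h.
Proof.
move=> Lf Lg Lh; rewrite /ip -RintegralD//; try exact: ip_integrable.
by apply: eq_Rintegral => x _; rewrite mulrDl.
Qed.

Lemma ipZl a f h : L2 f -> L2 h -> ip (fun x => a * f x) h = a * ip f h.
Proof.
move=> Lf Lh; rewrite /ip -RintegralZl//; last exact: ip_integrable.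
by apply: eq_Rintegral => x _; rewrite mulrA.
Qed.

Lemma ipDr f g h : L2 f -> L2 g -> L2 h -> ip h (fun x => f x + g x) = ip h f + ip h g.
Proof. by move=> *; rewrite ipC ipDl// !(ipC _ h). Qed.

Lemma ipZr a f h : L2 f -> L2 h -> ip h (fun x => a * f x) = a * ip h f.
Proof. by move=> *; rewrite ipC ipZl// !(ipC _ h). Qed.

Lemma ipNl f h : L2 f -> L2 h -> ip (fun x => - f x) h = - ip f h.
Proof.
by move=> Lf Lh; rewrite -mulN1r -ipZl//; congr ip; apply/funext => x; rewrite mulN1r.
Qed.

Lemma ipBl f g h : L2 f -> L2 g -> L2 h -> ip (fun x => f x - g x) h = ip f h - ip g h.
Proof. by move=> Lf Lg Lh; rewrite ipDl ?ipNl//; exact: L2N. Qed.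

Lemma ipBr f g h : L2 f -> L2 g -> L2 h -> ip h (fun x => f x - g x) = ip h f - ip h g.
Proof. by move=> *; rewrite ipC ipBl// !(ipC _ h). Qed.

Lemma ip0l h : ip (fun=> 0) h = 0.
Proof. by rewrite /ip; under eq_Rintegral do rewrite mul0r; rewrite /Rintegral integral0. Qed.

Lemma ip_suml n (F : 'I_n -> T -> R) h : (forall i, L2 (F i)) -> L2 h ->
  ip (fun x => \sum_(i < n) F i x) h = \sum_(i < n) ip (F i) h.
Proof.
move=> + Lh; elim: n F => [|n IH] F LF.
  by under [X in ip X _]eq_fun do rewrite big_ord0; rewrite ip0l big_ord0.
under [X in ip X _]eq_fun do rewrite big_ord_recl.
by rewrite ipDl//; [rewrite big_ord_recl IH|exact: L2_sum].
Qed.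

Lemma ip_ge0 f : 0 <= ip f f.
Proof. by apply: Rintegral_ge0 => x _; rewrite -expr2 sqr_ge0. Qed.

Lemma nrm_ge0 f : 0 <= nrm f.
Proof. exact: sqrtr_ge0. Qed.

Lemma nrm_sqr f : nrm f ^+ 2 = ip f f.
Proof. by rewrite sqr_sqrtr// ip_ge0. Qed.

Lemma L2norm_nrm f : L2 f -> L2norm m f = (nrm f)%:E.
Proof.
move=> Lf; rewrite L2norm_sqr; under eq_integral do rewrite expr2.
by rewrite -ipE// poweR_EFin powR12_sqrt// ip_ge0.
Qed.

Lemma cauchy_schwarz f g : L2 f -> L2 g -> `|ip f g| <= nrm f * nrm g.
Proof.
move=> Lf Lg; have key (s : R) : 0 <= ip f f + 2 * s * ip f g + s ^+ 2 * ip g g.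
  have Ls := L2Z s Lg; have := ip_ge0 (fun x => f x + s * g x).
  rewrite ipDl ?ipDr ?ipZl ?ipZr ?(ipC g f)//; try exact: L2D.
  by move=> h; apply: le_trans h _; rewrite le_eqVlt; apply/orP; left; apply/eqP; ring.
rewrite -(@ler_pXn2r _ 2)// ?nnegrE ?mulr_ge0 ?nrm_ge0//.
rewrite exprMn !nrm_sqr real_normK ?num_real//.
have := ip_ge0 g; rewrite le_eqVlt => /orP[/eqP g0|g0].
  rewrite -g0 mulr0; have [->|fg0] := eqVneq (ip f g) 0; first by rewrite expr0n.
  (* Here the quadratic in s degenerates to an affine function, and this s gives it the value -1. *)
  have := key (- (ip f f + 1) / (2 * ip f g)); rewrite -g0 mulr0 addr0.
  have -> : 2 * (- (ip f f + 1) / (2 * ip f g)) * ip f g = - (ip f f + 1) by field.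
  by rewrite opprD addNKr ler0N1.
have := key (- ip f g / ip g g).
have -> : ip f f + 2 * (- ip f g / ip g g) * ip f g + (- ip f g / ip g g) ^+ 2 * ip g g
  = (ip f f * ip g g - ip f g ^+ 2) / ip g g by field; rewrite gt_eqF.
by rewrite pmulr_lge0 ?invr_gt0// subr_ge0.
Qed.

Lemma nrmD f g : L2 f -> L2 g -> nrm (fun x => f x + g x) <= nrm f + nrm g.
Proof.
move=> Lf Lg; rewrite -(@ler_pXn2r _ 2)// ?nnegrE ?addr_ge0 ?nrm_ge0//.
rewrite sqrrD !nrm_sqr ipDl ?ipDr ?(ipC g f)//; last exact: L2D.
have := cauchy_schwarz Lf Lg; have := ler_norm (ip f g); lra.
Qed.

Lemma nrmZ a f : L2 f -> nrm (fun x => a * f x) = `|a| * nrm f.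
Proof.
move=> Lf; rewrite /nrm ipZl ?ipZr//; last exact: L2Z.
by rewrite mulrA -expr2 sqrtrM ?sqr_ge0// sqrtr_sqr.
Qed.

Lemma nrmN f : nrm (fun x => - f x) = nrm f.
Proof. by rewrite /nrm /ip; congr Num.sqrt; apply: eq_Rintegral => x _; rewrite mulrNN. Qed.

Lemma nrmB f g : L2 f -> L2 g -> nrm (fun x => f x - g x) <= nrm f + nrm g.
Proof. by move=> Lf Lg; rewrite -(nrmN g); apply: nrmD => //; exact: L2N. Qed.

Lemma nrm0 : nrm (fun=> 0) = 0.
Proof. by rewrite /nrm ip0l sqrtr0. Qed.

Lemma nrmBC f g : nrm (fun x => f x - g x) = nrm (fun x => g x - f x).
Proof. by rewrite -nrmN; congr nrm; apply/funext => x; rewrite opprB. Qed.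

Lemma nrm_triangle f g h : L2 f -> L2 g -> L2 h ->
  nrm (fun x => f x - h x) <= nrm (fun x => f x - g x) + nrm (fun x => g x - h x).
Proof.
move=> Lf Lg Lh; apply: le_trans (nrmD _ _); [|exact: L2B|exact: L2B].
by rewrite le_eqVlt; apply/orP; left; apply/eqP; congr nrm; apply/funext => x; rewrite addrA subrK.
Qed.

Lemma nrm_eq0 f : L2 f -> nrm f = 0 <-> f = (fun=> 0) %[ae m].
Proof.
move=> Lf; split=> [f0|f0].
  have := @Lnorm_eq0_eq0 _ _ _ m (EFin \o f) 2%:E.
  have /measurable_EFinP mf := L2_measurable Lf.
  move=> /(_ mf); have := L2norm_nrm Lf; rewrite f0 /L2norm => -> /(_ _ erefl) h.
  have : (0%R < 2%:E :> \bar R)%E by rewrite lte_fin.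
  by move=> /h; apply: filterS => x /(_ I) [].
rewrite /nrm /ip /Rintegral (_ : (\int[m]_x _)%E = 0%E) ?sqrtr0//.
have mff : measurable_fun setT (fun x => (f x * f x)%:E).
  by apply/measurable_EFinP; apply: measurable_funM; exact: L2_measurable.
rewrite (ae_eq_integral (cst 0%E)) ?integral0//.
by apply: filterS f0 => x /= /(_ I) -> _; rewrite mul0r.
Qed.

Lemma ae_eq_nrm f g : L2 f -> L2 g ->
  nrm (fun x => f x - g x) = 0 <-> f = g %[ae m].
Proof.
move=> Lf Lg; rewrite nrm_eq0; last exact: L2B.
split; apply: filterS => x /= /(_ I) h _; last by rewrite h subrr.
by apply/eqP; rewrite -subr_eq0 h.
Qed.

Lemma ip_ae f g h : f = g %[ae m] -> L2 f -> L2 g -> L2 h -> ip f h = ip g h.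
Proof.
move=> fg Lf Lg Lh; apply: EFin_inj; rewrite !ipE//; apply: ae_eq_integral => //.
- exact: measurable_int (ip_integrable Lf Lh).
- exact: measurable_int (ip_integrable Lg Lh).
- by apply: filterS fg => x /= /(_ I) -> _.
Qed.

Lemma nrm_ae f g : f = g %[ae m] -> L2 f -> L2 g -> nrm f = nrm g.
Proof. by move=> fg Lf Lg; rewrite /nrm (ip_ae fg)// ipC (ip_ae fg)// ipC. Qed.

End L2_theory.

Lemma cvg_geometric_increments (R : realType) (v : nat -> R) (M : R) :
  (forall k, `|v k.+1 - v k| <= M / 2 ^+ k) -> cvgn v.
Proof.
move=> vM; have M0 : 0 <= M by have := vM 0%N; rewrite expr0 divr1; apply: le_trans.
pose w k := v k.+1 - v k.
have cw : cvgn (series w).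
  apply: normed_cvg; apply: (@series_le_cvg _ _ (geometric M 2^-1)).
  - by move=> n; exact: normr_ge0.
  - by move=> n; rewrite /geometric/= mulr_ge0// exprn_ge0.
  - by move=> n; rewrite /geometric/= exprVn; exact: vM.
  - by apply: is_cvg_geometric_series; rewrite ger0_norm//; lra.
have vE : v = (fun n => v 0%N + series w n).
  apply/funext => n; rewrite /series/= /w telescope_sumr//; ring.
by rewrite vE; apply: is_cvgD => //; exact: is_cvg_cst.
Qed.

(** * Almost everywhere bounds, completeness and induction in L^2 *)

Section L2_limits.
Context d (T : measurableType d) (R : realType) (m : {measure set T -> \bar R}).
Local Notation L2 f := (f \in Lfun m 2%:E).
Implicit Types f g : T -> R.

(** The sum of the functions 4^k a_k has integral at most the sum of the C / 4^k, so it is finite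
    almost everywhere and bounds each of its terms. The loss from 16 to 4 is the price for a
    pointwise bound. *)
Lemma ae_geometric_bound (a : nat -> T -> R) (C : R) :
  (forall k, measurable_fun setT (a k)) -> (forall k x, 0 <= a k x) ->
  (forall k, (\int[m]_x (a k x)%:E <= (C / 16 ^+ k)%:E)%E) ->
  {ae m, forall x, exists M : R, forall k, a k x <= M / 4 ^+ k}.
Proof.
move=> ma a0 aC.
have C0 : 0 <= C.
  have := aC 0%N; rewrite expr0 divr1 => /(le_trans _); rewrite -lee_fin; apply.
  by apply: integral_ge0 => x _; rewrite lee_fin.
pose b k x := ((4 ^+ k * a k x)%:E : \bar R).
have mb k : measurable_fun setT (b k).
  by apply/measurable_EFinP; apply: measurable_funM.
have b0 k x : (0 <= b k x)%E by rewrite lee_fin mulr_ge0// exprn_ge0.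
pose S x := (\sum_(0 <= k <oo) b k x)%E.
have mS : measurable_fun setT S by apply: ge0_emeasurable_sum => //.
have S0 x : (0 <= S x)%E by apply: nneseries_ge0 => n _ _.
have iS : m.-integrable setT S.
  apply/integrableP; split => //.
  under eq_integral do rewrite gee0_abs//.
  rewrite integral_nneseries//.
  have le1 : (\sum_(0 <= k <oo) (\int[m]_x b k x) <= \sum_(0 <= k <oo) (C / 4 ^+ k)%:E)%E.
    apply: lee_nneseries => [*|k _]; first by apply: integral_ge0.
    rewrite /b; under eq_integral do rewrite EFinM.
    rewrite ge0_integralZl ?lee_fin ?exprn_ge0//; last 2 first.
      by apply/measurable_EFinP.
      by move=> x _; rewrite lee_fin.
    apply: (@le_trans _ _ ((4 ^+ k)%:E * (C / 16 ^+ k)%:E)%E).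
      by apply: lee_wpmul2l => //; rewrite lee_fin exprn_ge0.
    rewrite -EFinM lee_fin le_eqVlt; apply/orP; left; apply/eqP.
    have -> : 16 = 4 * 4 :> R by rewrite -natrM.
    by rewrite exprMn; field; rewrite expf_neq0.
  apply: le_lt_trans le1 _.
  have -> : (\sum_(0 <= k <oo) (C / 4 ^+ k)%:E)%E = (limn (series (geometric C 4^-1)))%:E.
    rewrite -EFin_lim; last by apply: is_cvg_geometric_series; rewrite ger0_norm//; lra.
    congr (limn _); apply/funext => n; rewrite /= /series/= sumEFin; congr EFin.
    by apply: eq_bigr => i _; rewrite exprVn.
  exact: ltry.
have := integrable_ae measurableT iS; apply: filterS => x /(_ I) Sx.
exists (fine (S x)) => k; rewrite ler_pdivlMr ?exprn_gt0// mulrC -lee_fin fineK//.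
have := @nneseries_lim_ge R (b ^~ x) xpredT 0 k.+1 (fun n _ _ => b0 n x).
apply: le_trans; rewrite big_nat_recr//=; apply: leeDr.
by apply: sume_ge0 => i _.
Qed.

Lemma fatou_bound (a : nat -> T -> R) (b : T -> R) (C : R) :
  (forall k, measurable_fun setT (a k)) -> measurable_fun setT b ->
  (forall k x, 0 <= a k x) ->
  {ae m, forall x, a k x @[k --> \oo] --> b x} ->
  (\forall k \near \oo, (\int[m]_x (a k x)%:E <= C%:E)%E) ->
  (\int[m]_x (b x)%:E <= C%:E)%E.
Proof.
move=> ma mb a0 ab [N _ aC].
have mae k : measurable_fun setT (fun x => (a k x)%:E : \bar R) by exact/measurable_EFinP.
have := @fatou _ _ _ m setT measurableT (fun k x => (a k x)%:E) mae _.
move=> /(_ (fun k x _ => a0 k x)) h.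
have -> : (\int[m]_x (b x)%:E = \int[m]_x limn_einf (fun k => (a k x)%:E))%E.
  apply: ae_eq_integral => //.
  - exact/measurable_EFinP.
  - have -> : (fun x => limn_einf (fun k => (a k x)%:E)) =
        (fun x => - limn_esup (fun k => - (a k x)%:E))%E.
      apply/funext => x; rewrite -limn_einfN; congr limn_einf.
      by apply/funext => k; rewrite /comp oppeK.
    apply: measurableT_comp => //; apply: measurable_fun_limn_esup => k.
    exact: measurableT_comp.
  - apply: filterS ab => x /= abx _.
    by apply/esym; apply: (cvg_limn_einf_sup _).1; apply: cvg_EFin => //; near=> k.
apply: le_trans h _.
rewrite limn_einf_lim; apply: lime_le; first exact: is_cvg_einfs.
exists N => // k /= Nk; apply: le_trans (aC k Nk).
by apply: ereal_inf_lbound; exists k => /=.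
Unshelve. all: by end_near. Qed.

(** The squares of the increments satisfy [ae_geometric_bound], which gives pointwise convergence;
    Fatou's lemma then yields the explicit rate, on which the later series estimates rely. *)
Lemma L2_complete (u : nat -> T -> R) (K : R) :
  (forall n, L2 (u n)) ->
  (forall n, nrm m (fun x => u n.+1 x - u n x) <= K / 4 ^+ n) ->
  exists2 f, L2 f & forall n, nrm m (fun x => u n x - f x) <= 2 * K / 4 ^+ n.
Proof.
move=> Lu uK.
have K0 : 0 <= K by have := uK 0%N; rewrite expr0 divr1; apply: le_trans; exact: nrm_ge0.
have mu k : measurable_fun setT (u k) := L2_measurable (Lu k).
pose a k x := (u k.+1 x - u k x) ^+ 2.
have intE g : L2 g -> (\int[m]_x ((g x) ^+ 2)%:E = (nrm m g ^+ 2)%:E)%E.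
  by move=> Lg; rewrite nrm_sqr ipE//; apply: eq_integral => x _; rewrite expr2.
have LB k j : L2 (fun x => u k x - u j x) by exact: L2B.
have cu : {ae m, forall x, cvgn (u ^~ x)}.
  have := @ae_geometric_bound a (K ^+ 2) _ _ _.
  have ma k : measurable_fun setT (a k).
    by apply: measurable_funX; apply: measurable_funB.
  move=> /(_ ma); case=> [k x|k|]; first exact: sqr_ge0.
    rewrite /a intE// lee_fin.
    have -> : K ^+ 2 / 16 ^+ k = (K / 4 ^+ k) ^+ 2.
      by rewrite expr_div_n -exprM mulnC exprM; congr (_ / _ ^+ _); rewrite -natrX.
    by rewrite ler_pXn2r// nnegrE ?nrm_ge0// divr_ge0// exprn_ge0.
  move=> A [mA A0 sub]; exists A; split => //; apply: subset_trans sub => x /= ncv [M aM].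
  apply: ncv; apply: (@cvg_geometric_increments _ _ (Num.sqrt M)) => k.
  have M0 : 0 <= M by have := aM 0%N; rewrite expr0 divr1; apply: le_trans; exact: sqr_ge0.
  rewrite -(@ler_pXn2r _ 2)// ?nnegrE ?divr_ge0 ?sqrtr_ge0 ?exprn_ge0//.
  rewrite real_normK ?num_real// expr_div_n sqr_sqrtr//.
  have -> : (2 ^+ k) ^+ 2 = 4 ^+ k :> R.
    by rewrite -exprM mulnC exprM; congr (_ ^+ _); rewrite -natrX.
  exact: aM.
(* The upper limit is measurable whether or not the sequence converges, and it agrees with the limit
   almost everywhere. *)
pose f x := fine (limn_esup (fun k => (u k x)%:E)).
have mf : measurable_fun setT f.
  apply: (measurableT_comp (fine_measurable measurableT)).
  by apply: measurable_fun_limn_esup => k; exact/measurable_EFinP.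
have uf : {ae m, forall x, u k x @[k --> \oo] --> f x}.
  apply: filterS cu => x cx.
  have : (u k x)%:E @[k --> \oo] --> (limn (u ^~ x))%:E.
    by apply: cvg_EFin => //; near=> k.
  by move=> /cvg_limn_einf_sup [_ h]; rewrite /f h.
have ngeo n k : nrm m (fun x => u n x - u (n + k)%N x) <= 2 * K / 4 ^+ n.
  suff : nrm m (fun x => u n x - u (n + k)%N x) <= 2 * K / 4 ^+ n * (1 - 4 ^- k).
    move/le_trans; apply; apply: ler_piMr; first by rewrite divr_ge0 ?mulr_ge0 ?exprn_ge0.
    by rewrite gerBl invr_ge0 exprn_ge0.
  elim: k => [|k IH].
    rewrite addn0 expr0 invr1 subrr mulr0.
    by under [X in nrm m X]eq_fun do rewrite subrr; rewrite nrm0.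
  apply: (le_trans (nrm_triangle (g := u (n + k)%N) _ _ _)) => //.
  have := uK (n + k)%N; rewrite nrmBC addnS exprD.
  move: IH; rewrite exprS; set y := 4 ^+ n; set z := 4 ^+ k.
  have y0 : 0 < y by rewrite exprn_gt0.
  have z0 : 0 < z by rewrite exprn_gt0.
  move=> h1 h2; apply: le_trans (lerD h1 h2) _.
  rewrite -subr_ge0.
  have -> : 2 * K / y * (1 - (4 * z)^-1) - (2 * K / y * (1 - z^-1) + K / (y * z)) =
    K / (2 * y * z) by field; rewrite !gt_eqF.
  by rewrite divr_ge0// !mulr_ge0// ltW.
have bnd n : (\int[m]_x ((u n x - f x) ^+ 2)%:E <= ((2 * K / 4 ^+ n) ^+ 2)%:E)%E.
  apply: (@fatou_bound (fun k x => (u n x - u k x) ^+ 2)).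
  - by move=> k; apply: measurable_funX; apply: measurable_funB.
  - by apply: measurable_funX; apply: measurable_funB.
  - by move=> k x; exact: sqr_ge0.
  - apply: filterS uf => x ufx.
    by rewrite expr2; under eq_cvg do rewrite expr2; apply: cvgM; apply: cvgB => //; exact: cvg_cst.
  - exists n => // k /= nk; rewrite intE// lee_fin -(subnKC nk).
    by rewrite ler_pXn2r ?ngeo// nnegrE ?nrm_ge0// divr_ge0 ?mulr_ge0 ?exprn_ge0.
have LD n : L2 (fun x => u n x - f x).
  apply/L2P; split; first exact: measurable_funB.
  exact: le_lt_trans (bnd n) (ltry _).
exists f.
  have -> : f = (fun x => u 0%N x - (u 0%N x - f x)).
    by apply/funext => x; rewrite opprB addrCA subrr addr0.
  exact: L2B (Lu 0%N) (LD 0%N).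
move=> n; rewrite -(@ler_pXn2r _ 2)// ?nnegrE ?nrm_ge0 ?divr_ge0 ?mulr_ge0 ?exprn_ge0//.
by rewrite -lee_fin -intE.
Unshelve. all: by end_near. Qed.

Hypothesis m_fin : (m setT < +oo)%E.

Lemma L2_bounded f (M : R) : measurable_fun setT f -> (forall x, `|f x| <= M) -> L2 f.
Proof.
move=> mf fM; apply/L2P; split => //.
apply: (@le_lt_trans _ _ (\int[m]_x (cst (M ^+ 2)%:E x))%E).
  apply: ge0_le_integral => //.
  - by move=> x _; rewrite lee_fin sqr_ge0.
  - by apply/measurable_EFinP; exact: measurable_funX.
  - move=> x _; rewrite /= lee_fin -real_normK ?num_real// ler_pXn2r ?nnegrE//.
    exact: le_trans (fM x).
rewrite integral_cst//; apply: lte_mul_pinfty => //.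
by rewrite lee_fin sqr_ge0.
Qed.

Lemma L2_indic (A : set T) : measurable A -> L2 (\1_A : T -> R).
Proof.
move=> mA; apply: (@L2_bounded _ 1); first exact: measurable_indic.
by move=> x; rewrite indicE; case: (x \in A); rewrite ?normr1 ?normr0.
Qed.

Lemma L2_cst (c : R) : L2 (fun=> c).
Proof. by apply: (@L2_bounded _ `|c|) => //; exact: measurable_cst. Qed.

Lemma Rintegral_lin a f g : L2 f -> L2 g ->
  \int[m]_x (a * f x + g x) = a * \int[m]_x f x + \int[m]_x g x.
Proof.
move=> Lf Lg; have L1 := L2_cst 1.
have E h : \int[m]_x h x = ip m h (fun=> 1) by apply: eq_Rintegral => x _; rewrite mulr1.
by rewrite !E ipDl ?ipZl//; exact: L2Z.
Qed.

Lemma sqr_Rintegral_le f : m setT = 1%E -> L2 f ->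
  (((\int[m]_x f x) ^+ 2)%:E <= \int[m]_x ((f x) ^+ 2)%:E)%E.
Proof.
move=> m1 Lf; have := cauchy_schwarz Lf (L2_cst 1).
have -> : ip m f (fun=> 1) = \int[m]_x f x by apply: eq_Rintegral => x _; rewrite mulr1.
have -> : nrm m (fun=> 1) = 1.
  rewrite /nrm /ip; under eq_Rintegral do rewrite mulr1.
  by rewrite Rintegral_cst// m1 mul1r sqrtr1.
rewrite mulr1 => h.
have -> : (\int[m]_x (f x ^+ 2)%:E = (nrm m f ^+ 2)%:E)%E.
  by rewrite nrm_sqr ipE//; apply: eq_integral => x _; rewrite expr2.
by rewrite lee_fin -real_normK ?num_real// ler_pXn2r ?nnegrE ?nrm_ge0.
Qed.

(** The usual ladder: finite combinations of indicators, then nonnegative functions by dominated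
    convergence, then positive and negative parts. *)
Lemma L2_ind (Q : (T -> R) -> Prop) :
  (forall A : set T, measurable A -> Q (\1_A)) ->
  (forall a f g, L2 f -> L2 g -> Q f -> Q g -> Q (fun x => a * f x + g x)) ->
  (forall f, L2 f -> (forall e, 0 < e -> exists g,
      [/\ L2 g, Q g & nrm m (fun x => f x - g x) <= e]) -> Q f) ->
  forall f, L2 f -> Q f.
Proof.
move=> Qind Qlin Qcl.
have Q0 : Q (fun=> 0) by have := Qind set0 measurable0; rewrite indic0.
have Qsum (s : seq R) (F : R -> set T) : (forall y, measurable (F y)) ->
    L2 (fun x => \sum_(y <- s) y * \1_(F y) x) /\ Q (fun x => \sum_(y <- s) y * \1_(F y) x).
  move=> mF; elim: s => [|y s [IHL IH]].
    by under eq_fun do rewrite big_nil; split => //; exact: L2_0.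
  under eq_fun do rewrite big_cons; split.
    by apply: L2D => //; apply: L2Z; exact: L2_indic.
  by apply: Qlin => //; [exact: L2_indic|exact: Qind].
have Qnn f : L2 f -> (forall x, 0 <= f x) -> Q f.
  move=> Lf f0; apply: Qcl => // e e0.
  have mf := L2_measurable Lf.
  have mef : measurable_fun setT (EFin \o f) by exact/measurable_EFinP.
  pose g k : T -> R := nnsfun_approx measurableT mef k.
  have fg x : g k x @[k --> \oo] --> f x.
    have := @cvg_nnsfun_approx _ _ _ _ measurableT _ mef (fun x _ => f0 x) x I.
    by move=> /fine_cvg.
  have gle k x : 0 <= g k x <= f x.
    rewrite fun_ge0/=; have ndg := @nd_nnsfun_approx _ _ _ _ measurableT _ mef.
    have : {homo (fun k => g k x) : n p / (n <= p)%N >-> n <= p}.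
      by move=> n p np; have /lefP := ndg _ _ np; apply.
    move=> /nondecreasing_cvgn_le nd; have := fg x => /[dup] cf /cvg_lim <- //.
    by apply: nd; apply/cvg_ex; exists (f x).
  have Lg k : L2 (g k) /\ Q (g k).
    have -> : g k = (fun x => \sum_(y <- finmap.enum_fset (fset_set (range (g k))))
        y * \1_(g k @^-1` [set y]) x).
      apply/funext => x; rewrite {1}/g fimfunE fsbig_finite//=.
    by apply: Qsum => y; exact: measurable_funPTI.
  have : (\int[m]_x ((f x - g k x) ^+ 2)%:E)%E @[k --> \oo] --> (\int[m]_x (cst 0%E x))%E.
    apply: (@dominated_cvg _ _ _ m setT measurableT _ _ (fun x => ((f x) ^+ 2)%:E)).
    - move=> k; apply/measurable_EFinP; apply: measurable_funX.
      by apply: measurable_funB => //.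
    - move=> x _; apply: cvg_EFin; first by near=> k.
      rewrite /comp/=.
      have -> : 0 = (f x - f x) ^+ 2 by rewrite subrr expr0n.
      by rewrite expr2; under eq_cvg do rewrite expr2; apply: cvgM; apply: cvgB => //; exact: cvg_cst.
    - by [].
    - exact: Lfun2_integrable_sqr.
    - move=> k x _; rewrite gee0_abs ?lee_fin ?sqr_ge0//.
      have /andP[g0 gf] := gle k x.
      by rewrite ler_pXn2r ?nnegrE ?subr_ge0// gerBl.
  rewrite integral_cst//= mul0e => /fine_cvgP[_ /cvgrPdist_lt /(_ (e ^+ 2))].
  rewrite exprn_gt0// => /(_ isT) [N _ /(_ N (leqnn _))] /=.
  have LB : L2 (fun x => f x - g N x) by apply: L2B => //; exact: (Lg N).1.
  rewrite sub0r normrN.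
  have -> : fine (\int[m]_x ((f x - g N x) ^+ 2)%:E)%E = nrm m (fun x => f x - g N x) ^+ 2.
    rewrite nrm_sqr /ip /Rintegral; congr fine; by apply: eq_integral => x _.
  rewrite ger0_norm ?sqr_ge0// ltr_pXn2r ?nnegrE ?nrm_ge0 ?ltW// => lte.
  by exists (g N); split; [exact: (Lg N).1|exact: (Lg N).2|exact: ltW].
move=> f Lf; have mf := L2_measurable Lf.
have le2 (g : T -> R) : measurable_fun setT g -> (forall x, 0 <= g x <= `|f x|) -> L2 g.
  move=> mg gf; apply/L2P; split => //; have /L2P[_] := Lf; apply: le_lt_trans.
  apply: ge0_le_integral => //.
  - by move=> x _; rewrite lee_fin sqr_ge0.
  - by apply/measurable_EFinP; exact: measurable_funX.
  - by apply/measurable_EFinP; exact: measurable_funX.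
  - move=> x _; have /andP[g0 gfx] := gf x; rewrite lee_fin -[leRHS]real_normK ?num_real//.
    by rewrite ler_pXn2r ?nnegrE.
have Lp : L2 (f ^\+).
  apply: le2; first exact: measurable_funrpos.
  by move=> x; rewrite /funrpos le_max lexx orbT/= ge_max normr_ge0 ler_norm.
have Ln : L2 (f ^\-).
  apply: le2; first exact: measurable_funrneg.
  by move=> x; rewrite /funrneg le_max lexx orbT/= ge_max normr_ge0 -normrN ler_norm.
have -> : f = (fun x => -1 * f^\- x + f^\+ x).
  by rewrite -{1}(funrposBneg f); apply/funext => x /=; rewrite mulN1r addrC.
apply: Qlin => //; apply: Qnn => // x; rewrite /funrpos /funrneg le_max lexx orbT//.
Unshelve. all: by end_near. Qed.

End L2_limits.

(** * The generator of a reversible process *)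

Section reversible_semigroup.
Context (R : realType) (dS : measure_display) (S : measurableType dS)
  (dO : measure_display) (Omega : measurableType dO)
  (P : R.-pker S ~> Omega) (X : R -> Omega -> S) (mu : probability S R).
Hypothesis mX : forall t : R, 0 <= t -> measurable_fun setT (X t).
Hypothesis hrev : reversible P X mu.
Implicit Types f g u v : S -> R.
Local Notation L2 f := (f \in Lfun mu 2%:E).
Local Notation ip := (ip mu).
Local Notation nrm := (nrm mu).
Local Notation sg := (semigroup P X).

Let mu_fin : (mu setT < +oo)%E.
Proof. by rewrite probability_setT ltry. Qed.

Lemma measurable_kernel_integral t f : 0 <= t -> measurable_fun setT f ->
  (forall x, 0 <= f x) ->
  measurable_fun setT (fun x => (\int[P x]_w (f (X t w))%:E)%E).
Proof.
move=> t0 mf f0.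
apply: (@measurable_fun_integral_kernel _ _ _ _ _ P _ (fun w => (f (X t w))%:E)).
- by move=> U mU; exact: measurable_kernel.
- by move=> w; rewrite lee_fin.
- by apply/measurable_EFinP; apply: measurableT_comp => //; exact: mX.
Qed.

Lemma kernel_indic t (A : set S) x : 0 <= t -> measurable A ->
  (\int[P x]_w (\1_A (X t w))%:E = P x (X t @^-1` A))%E.
Proof.
move=> t0 mA.
have mXA : measurable (X t @^-1` A) by rewrite -[X in measurable X]setTI; exact: mX.
have -> : (fun w => (\1_A (X t w))%:E) = (fun w => (\1_(X t @^-1` A) w : R)%:E).
  by apply/funext => w; rewrite !indicE; congr (_%:R%:E).
by rewrite integral_indic// setIT.
Qed.

Lemma invariant_indic t (A : set S) : 0 <= t -> measurable A ->
  (\int[mu]_x (\int[P x]_w (\1_A (X t w))%:E) = mu A)%E.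
Proof.
move=> t0 mA; under eq_integral do rewrite kernel_indic//.
rewrite hrev//; under eq_integral do rewrite preimage_setT prob_kernel.
by rewrite integral_cst// mul1e.
Qed.

(** Reversibility against the whole space gives invariance on indicators; monotone approximation by
    simple functions extends it. *)
Lemma invariant_integral t f : 0 <= t -> measurable_fun setT f -> (forall x, 0 <= f x) ->
  (\int[mu]_x (\int[P x]_w (f (X t w))%:E) = \int[mu]_x (f x)%:E)%E.
Proof.
move=> t0 mf f0.
have mef : measurable_fun setT (EFin \o f) by exact/measurable_EFinP.
pose a k : S -> R := nnsfun_approx measurableT mef k.
have ma k : measurable_fun setT (a k) by [].
have a0 k x : 0 <= a k x by rewrite fun_ge0.
have nda x : {homo (fun k => a k x) : n p / (n <= p)%N >-> n <= p}.
  by move=> n p np; have /lefP := @nd_nnsfun_approx _ _ _ _ measurableT _ mef _ _ np; apply.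
have fa x : (a k x)%:E @[k --> \oo] --> (f x)%:E.
  exact: (@cvg_nnsfun_approx _ _ _ _ measurableT _ mef (fun x _ => f0 x) x I).
have limE x : (f x)%:E = limn (fun k => (a k x)%:E) by apply/esym/cvg_lim.
have maX k : measurable_fun setT (fun w => (a k (X t w))%:E : \bar R).
  by apply/measurable_EFinP; apply: measurableT_comp => //; exact: mX.
under eq_integral => x _.
  under eq_integral do rewrite limE.
  rewrite monotone_convergence//; last 2 first.
    by move=> k w _; rewrite lee_fin.
    by move=> w _ n p np; rewrite lee_fin nda.
  over.
under [in RHS]eq_integral do rewrite limE.
rewrite [LHS](monotone_convergence mu measurableT
  (g' := fun k x => \int[P x]_w (a k (X t w))%:E)%E)//; last 3 first.
  by move=> k; exact: measurable_kernel_integral.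
  by move=> k x _; apply: integral_ge0 => w _; rewrite lee_fin.
  move=> x _ n p np; apply: ge0_le_integral => //.
  - by move=> w _; rewrite lee_fin.
  - by move=> w _; rewrite lee_fin nda.
rewrite [in RHS]monotone_convergence//; last 3 first.
  by move=> k; exact/measurable_EFinP.
  by move=> k x _; rewrite lee_fin.
  by move=> x _ n p np; rewrite lee_fin nda.
congr (limn _); apply/funext => k.
pose F y := a k @^-1` [set y].
have mF y : measurable (F y) by exact: measurable_funPTI.
have aE x : (a k x)%:E = (\sum_(y <- finmap.enum_fset (fset_set (range (a k)))) (y * \1_(F y) x)%:E)%E.
  by rewrite {1}/a fimfunE fsbig_finite//= -sumEFin.
have y0 y x : (0 <= (y * \1_(F y) x)%:E)%E.
  rewrite lee_fin indicE; have [/set_mem|_] := boolP (x \in F y); last by rewrite mulr0.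
  by rewrite /F /= => <-; rewrite mulr1.
have mI y : measurable_fun setT (fun x : S => (y * \1_(F y) x)%:E : \bar R).
  by apply/measurable_EFinP; apply: measurable_funM => //; exact: measurable_indic.
have mIX y : measurable_fun setT (fun w : Omega => (y * \1_(F y) (X t w))%:E : \bar R).
  by apply: (measurableT_comp (mI y)); exact: mX.
have yF y x : y < 0 -> \1_(F y) x = 0 :> R.
  move=> yneg; rewrite indicE; have [/set_mem|//] := boolP (x \in F y).
  by rewrite /F/= => h; move: yneg; rewrite -h ltNge a0.
under eq_integral => x _.
  under eq_integral do rewrite aE.
  rewrite ge0_integral_sum//.
  over.
under [in RHS]eq_integral do rewrite aE.
rewrite [in RHS]ge0_integral_sum//.
rewrite ge0_integral_sum//; last 2 first.
- move=> y; apply: (@measurable_fun_integral_kernel _ _ _ _ _ P _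
    (fun w => (y * \1_(F y) (X t w))%:E)) => //.
  by move=> U mU; exact: measurable_kernel.
- by move=> y x _; apply: integral_ge0 => w _.
apply: eq_bigr => y _.
(* A negative value is never attained by a nonnegative approximant, so its level set is empty; only
   nonnegative factors are pulled out of the integrals. *)
have [yn|yp] := ltP y 0.
  under eq_integral => x _ do under eq_integral do rewrite yF// mulr0.
  under [in RHS]eq_integral do rewrite yF// mulr0.
  by under eq_integral do rewrite integral0; rewrite !integral0.
have mIFX : measurable_fun setT (fun w : Omega => (\1_(F y) (X t w))%:E : \bar R).
  by apply/measurable_EFinP; apply: measurableT_comp; [exact: measurable_indic|exact: mX].
under eq_integral => x _.
  under eq_integral do rewrite EFinM.
  rewrite ge0_integralZl//.
  over.
under [in RHS]eq_integral do rewrite EFinM.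
have mIF : measurable_fun setT (fun w : S => (\1_(F y) w)%:E : \bar R).
  by apply/measurable_EFinP; exact: measurable_indic.
rewrite [in RHS]ge0_integralZl//.
rewrite ge0_integralZl//; last 2 first.
- exact: (measurable_kernel_integral (f := \1_(F y))).
- by move=> x _; apply: integral_ge0 => w _; rewrite lee_fin.
by rewrite invariant_indic// integral_indic// setIT.
Qed.

(** By invariance the mu-integral of E_x[f(X_t)^2] is the integral of f^2, so the inner expectation
    is finite for almost every x. *)
Lemma L2_fiber t f : 0 <= t -> L2 f ->
  {ae mu, forall x, (fun w => f (X t w)) \in Lfun (P x) 2%:E}.
Proof.
move=> t0 Lf; have mf := L2_measurable Lf.
have mf2 : measurable_fun setT (fun x => f x ^+ 2) by exact: measurable_funX.
have f20 x : 0 <= f x ^+ 2 by exact: sqr_ge0.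
have : mu.-integrable setT (fun x => \int[P x]_w (f (X t w) ^+ 2)%:E)%E.
  apply/integrableP; split; first exact: measurable_kernel_integral mf2 f20.
  under eq_integral => x _.
    rewrite gee0_abs; last by apply: integral_ge0 => w _; rewrite lee_fin sqr_ge0.
    over.
  rewrite (invariant_integral t0 mf2 f20).
  by have /L2P[_] := Lf.
move=> /(integrable_ae measurableT); apply: filterS => x /(_ I) fin.
apply/L2P; split; first by apply: measurableT_comp => //; exact: mX.
by rewrite ltey_eq fin.
Qed.

Lemma semigroup_measurable t f : 0 <= t -> measurable_fun setT f ->
  measurable_fun setT (sg t f).
Proof.
move=> t0 mf; rewrite /semigroup /Rintegral.
apply: (measurableT_comp (fine_measurable measurableT)).
have -> : (fun x => \int[P x]_w (f (X t w))%:E)%E = (fun x =>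
    \int[P x]_w (f^\+ (X t w))%:E - \int[P x]_w (f^\- (X t w))%:E)%E.
  apply/funext => x; rewrite integralE; congr (_ - _)%E; apply: eq_integral => w _.
    by rewrite funeposE /funrpos EFin_max.
  by rewrite funenegE /funrneg EFin_max EFinN.
apply: emeasurable_funB; apply: measurable_kernel_integral => //.
- exact: measurable_funrpos.
- exact: measurable_funrneg.
Qed.

(** Jensen's inequality for the square under each P x, followed by invariance. *)
Lemma semigroup_contraction t f : 0 <= t -> L2 f -> L2 (sg t f) /\ nrm (sg t f) <= nrm f.
Proof.
move=> t0 Lf; have mf := L2_measurable Lf.
have mf2 : measurable_fun setT (fun x => f x ^+ 2) by exact: measurable_funX.
have f20 x : 0 <= f x ^+ 2 by exact: sqr_ge0.
have ms := semigroup_measurable t0 mf.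
have key : (\int[mu]_x ((sg t f x) ^+ 2)%:E <= \int[mu]_x ((f x) ^+ 2)%:E)%E.
  rewrite -(invariant_integral t0 mf2 f20).
  apply: ae_ge0_le_integral => //.
  - by move=> x _; rewrite lee_fin sqr_ge0.
  - by apply/measurable_EFinP; exact: measurable_funX.
  - by move=> x _; apply: integral_ge0 => w _; rewrite lee_fin.
  - exact: measurable_kernel_integral mf2 f20.
  - apply: filterS (L2_fiber t0 Lf) => x Lx _.
    have Px : (P x setT < +oo)%E by rewrite prob_kernel ltry.
    refine (sqr_Rintegral_le Px (prob_kernel x) Lx).
have Ls : L2 (sg t f).
  by apply/L2P; split => //; apply: le_lt_trans key _; have /L2P[] := Lf.
by split => //; rewrite -(@ler_pXn2r _ 2)// ?nnegrE ?nrm_ge0// !nrm_sqr -lee_fin !ipE.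
Qed.

Lemma L2_sg t f : 0 <= t -> L2 f -> L2 (sg t f).
Proof. by move=> t0 /(semigroup_contraction t0) []. Qed.

(** Linearity holds only almost everywhere: where f(X_t) is not integrable, the real-valued integral
    is a default value. *)
Lemma semigroup_linear t a f g : 0 <= t -> L2 f -> L2 g ->
  sg t (fun x => a * f x + g x) = (fun x => a * sg t f x + sg t g x) %[ae mu].
Proof.
move=> t0 Lf Lg; apply: filterS2 (L2_fiber t0 Lf) (L2_fiber t0 Lg) => x Lx Ly _.
have Px : (P x setT < +oo)%E by rewrite prob_kernel ltry.
refine (Rintegral_lin Px a Lx Ly).
Qed.

Lemma nrm_semigroupB t f g : 0 <= t -> L2 f -> L2 g ->
  nrm (fun x => sg t f x - sg t g x) <= nrm (fun x => f x - g x).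
Proof.
move=> t0 Lf Lg.
have fgE : (fun x => f x - g x) = (fun x => -1 * g x + f x).
  by apply/funext => x; rewrite mulN1r addrC.
have LB : L2 (fun x => f x - g x) by exact: L2B.
apply: le_trans (semigroup_contraction t0 LB).2; rewrite fgE.
rewrite (nrm_ae (semigroup_linear (-1) t0 Lg Lf)); last 2 first.
- by apply: L2_sg => //; rewrite -fgE.
- by apply: L2D; [apply: L2Z|]; exact: L2_sg.
rewrite le_eqVlt; apply/orP; left; apply/eqP; congr nrm.
by apply/funext => x; rewrite mulN1r addrC.
Qed.

(** Reversibility is the symmetry on pairs of indicators. [L2_ind] extends it in one argument at a
    time; closedness under L^2 limits comes from the contraction property. *)
Lemma semigroup_sym t f g : 0 <= t -> L2 f -> L2 g -> ip (sg t f) g = ip f (sg t g).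
Proof.
move=> t0 Lf Lg.
have lin (g0 : S -> R) : L2 g0 -> forall a f1 f2, L2 f1 -> L2 f2 ->
   ip (sg t f1) g0 = ip f1 (sg t g0) -> ip (sg t f2) g0 = ip f2 (sg t g0) ->
   ip (sg t (fun x => a * f1 x + f2 x)) g0 = ip (fun x => a * f1 x + f2 x) (sg t g0).
  move=> Lg0 a f1 f2 L1 L2' h1 h2.
  have LL : L2 (fun x => a * f1 x + f2 x) by apply: L2D => //; exact: L2Z.
  rewrite (ip_ae (semigroup_linear a t0 L1 L2'))//; last 2 first.
  - exact: L2_sg.
  - by apply: L2D; [apply: L2Z|]; exact: L2_sg.
  rewrite !ipDl ?ipZl ?h1 ?h2//; try exact: L2_sg; try exact: L2Z.
  by apply: L2Z; exact: L2_sg.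
have cl (g0 : S -> R) : L2 g0 -> forall f0, L2 f0 ->
   (forall e, 0 < e -> exists f1, [/\ L2 f1, ip (sg t f1) g0 = ip f1 (sg t g0) &
     nrm (fun x => f0 x - f1 x) <= e]) -> ip (sg t f0) g0 = ip f0 (sg t g0).
  move=> Lg0 f0 L0 h; apply/eqP; rewrite -subr_eq0 -normr_le0; apply/ler_addgt0Pl => e e0.
  have K0 : 0 < 2 * nrm g0 + 1 by rewrite ltr_wpDl// mulr_ge0// nrm_ge0.
  have [f1 [L1 E1 le1]] := h (e / (2 * nrm g0 + 1)) (divr_gt0 e0 K0).
  rewrite addr0.
  have -> : ip (sg t f0) g0 - ip f0 (sg t g0) =
     ip (fun x => sg t f0 x - sg t f1 x) g0 - ip (fun x => f0 x - f1 x) (sg t g0).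
    by rewrite !ipBl ?E1//; try exact: L2_sg; ring.
  apply: le_trans (ler_normB _ _) _.
  have b1 := @cauchy_schwarz _ _ _ mu (fun x => sg t f0 x - sg t f1 x) g0
    (L2B (L2_sg t0 L0) (L2_sg t0 L1)) Lg0.
  have b2 := cauchy_schwarz (L2B L0 L1) (L2_sg t0 Lg0).
  have b3 := nrm_semigroupB t0 L0 L1.
  have b4 := (semigroup_contraction t0 Lg0).2.
  have n1 := nrm_ge0 mu (fun x => f0 x - f1 x).
  have n2 := nrm_ge0 mu g0.
  apply: le_trans (lerD b1 b2) _.
  apply: (@le_trans _ _ (nrm (fun x => f0 x - f1 x) * nrm g0 + nrm (fun x => f0 x - f1 x) * nrm g0)).
    by apply: lerD; [apply: ler_wpM2r|apply: ler_wpM2l].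
  rewrite -mulrDr.
  have : nrm (fun x => f0 x - f1 x) * (2 * nrm g0 + 1) <= e by rewrite -ler_pdivlMr.
  by nra.
have ind A B : measurable A -> measurable B -> ip (sg t \1_A) \1_B = ip \1_A (sg t \1_B).
  move=> mA mB.
  have E A' B' : measurable A' -> measurable B' ->
     ((ip (sg t \1_A') \1_B')%:E = \int[mu]_(x in B') P x (X t @^-1` A'))%E.
    move=> mA' mB'.
    have LA' := L2_indic mu_fin mA'; have LB' := L2_indic mu_fin mB'.
    rewrite ipE//; last exact: L2_sg.
    rewrite [RHS]integral_mkcond; apply: eq_integral => x _.
    rewrite patchE indicE; case: ifP => _; last by rewrite mulr0.
    rewrite mulr1 /semigroup /Rintegral.
    rewrite kernel_indic// fineK// ge0_fin_numE ?measure_ge0//.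
    apply: (@le_lt_trans _ _ (P x setT)); last by rewrite prob_kernel ltry.
    by apply: le_measure; rewrite ?inE// -[X in measurable X]setTI; exact: mX.
  by apply: EFin_inj; rewrite E// ipC E//; exact: hrev.
have half B : measurable B -> forall f0, L2 f0 -> ip (sg t f0) \1_B = ip f0 (sg t \1_B).
  move=> mB; have LB := L2_indic mu_fin mB.
  apply: (L2_ind mu_fin (Q := fun f0 => ip (sg t f0) \1_B = ip f0 (sg t \1_B))); [by move=> A mA; exact: ind|exact: lin|exact: cl].
have sym0 : forall g0, L2 g0 -> ip (sg t g0) f = ip g0 (sg t f).
  apply: (L2_ind mu_fin (Q := fun g0 => ip (sg t g0) f = ip g0 (sg t f))); [|exact: lin|exact: cl].
  by move=> A mA; rewrite ipC -half// ipC.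
by rewrite ipC -sym0// ipC.
Qed.

Local Notation G := (generator P X mu).
Let quot t u x := t^-1 * (sg t u x - u x).

Let L2_quot t u : 0 <= t -> L2 u -> L2 (quot t u).
Proof. by move=> t0 Lu; apply: L2Z; apply: L2B => //; exact: L2_sg. Qed.

Lemma generatorL u v : G u v -> L2 u. Proof. by case. Qed.
Lemma generatorR u v : G u v -> L2 v. Proof. by case. Qed.

Lemma generatorP u v : L2 u -> L2 v ->
  G u v <-> forall e, 0 < e -> \forall t \near 0^'+, nrm (fun x => quot t u x - v x) < e.
Proof.
move=> Lu Lv.
have E t : 0 <= t -> L2norm mu (fun x => quot t u x - v x) = (nrm (fun x => quot t u x - v x))%:E.
  by move=> t0; rewrite L2norm_nrm//; apply: L2B => //; exact: L2_quot.
split=> [[_ _ h] e e0|h].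
  have /fine_cvgP[_ /cvgrPdist_lt /(_ e e0)] := h.
  move=> h2; near=> t.
  have t0 : 0 < t by near: t; exact: nbhs_right_gt.
  have : `|0 - fine (L2norm mu (fun x => quot t u x - v x))| < e by near: t.
  by rewrite E ?ltW//= sub0r normrN ger0_norm ?nrm_ge0.
split => //; apply/fine_cvgP; split.
  near=> t; have t0 : 0 < t by near: t; exact: nbhs_right_gt.
  by rewrite E ?ltW.
apply/cvgrPdist_lt => e e0; have h2 := h e e0; near=> t.
have t0 : 0 < t by near: t; exact: nbhs_right_gt.
rewrite /= E ?ltW//= sub0r normrN ger0_norm ?nrm_ge0//.
by near: t.
Unshelve. all: by end_near. Qed.

Lemma generator_near u v e : G u v -> 0 < e ->
  \forall t \near 0^'+, nrm (fun x => quot t u x - v x) < e.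
Proof.
move=> h; have Lu := generatorL h; have Lv := generatorR h.
by move: h => /(generatorP Lu Lv) h; exact: h.
Qed.

Lemma generator_linear a u v u' v' : G u v -> G u' v' ->
  G (fun x => a * u x + u' x) (fun x => a * v x + v' x).
Proof.
move=> h h'; have Lu := generatorL h; have Lv := generatorR h.
have Lu' := generatorL h'; have Lv' := generatorR h'.
have LL f g : L2 f -> L2 g -> L2 (fun x => a * f x + g x).
  by move=> *; apply: L2D => //; exact: L2Z.
apply/generatorP; [exact: LL|exact: LL|] => e e0.
have K0 : 0 < `|a| + 1 by rewrite ltr_wpDl.
have h1 := generator_near h (divr_gt0 e0 K0).
have h2 := generator_near h' (divr_gt0 e0 K0).
near=> t.
have t0 : 0 < t by near: t; exact: nbhs_right_gt.
have lt1 : nrm (fun x => quot t u x - v x) < e / (`|a| + 1) by near: t.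
have lt2 : nrm (fun x => quot t u' x - v' x) < e / (`|a| + 1) by near: t.
have LQ f g : L2 f -> L2 g -> L2 (fun x => quot t f x - g x).
  by move=> *; apply: L2B => //; apply: L2_quot => //; exact: ltW.
have -> : nrm (fun x => quot t (fun x0 => a * u x0 + u' x0) x - (a * v x + v' x)) =
    nrm (fun x => a * (quot t u x - v x) + (quot t u' x - v' x)).
  apply: nrm_ae; last 2 first.
  - by apply: LQ; exact: LL.
  - by apply: LL; exact: LQ.
  apply: filterS (semigroup_linear a (ltW t0) Lu Lu') => x /(_ I) /= E _.
  by rewrite /quot E; ring.
apply: le_lt_trans (nrmD _ _) _; [by apply: L2Z; exact: LQ|exact: LQ|].
rewrite nrmZ; last exact: LQ.
have : e = `|a| * (e / (`|a| + 1)) + e / (`|a| + 1) by field; rewrite gt_eqF.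
move=> E; rewrite [ltRHS]E; apply: ler_ltD => //; apply: ler_wpM2l => //; exact: ltW.
Unshelve. all: by end_near. Qed.

Lemma generator_ae u v u' v' : G u v -> L2 u' -> L2 v' ->
  u = u' %[ae mu] -> v = v' %[ae mu] -> G u' v'.
Proof.
move=> h Lu' Lv' uu vv; have Lu := generatorL h; have Lv := generatorR h.
apply/generatorP => // e e0; have h1 := generator_near h e0; near=> t.
have t0 : 0 < t by near: t; exact: nbhs_right_gt.
have -> : nrm (fun x => quot t u' x - v' x) = nrm (fun x => quot t u x - v x).
  have /(ae_eq_nrm (L2_sg (ltW t0) Lu) (L2_sg (ltW t0) Lu')) ss :
      nrm (fun x => sg t u x - sg t u' x) = 0.
    apply/eqP; rewrite eq_le nrm_ge0 andbT.
    by apply: le_trans (nrm_semigroupB (ltW t0) Lu Lu') _; rewrite (ae_eq_nrm Lu Lu').2.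
  apply: nrm_ae; last 2 first.
  - by apply: L2B => //; apply: L2_quot => //; exact: ltW.
  - by apply: L2B => //; apply: L2_quot => //; exact: ltW.
  apply: filterS3 ss uu vv => x /= /(_ I) e1 /(_ I) e2 /(_ I) e3 _.
  by rewrite /quot e1 e2 e3.
by near: t.
Unshelve. all: by end_near. Qed.

Lemma generator_uniq u v v' : G u v -> G u v' -> v = v' %[ae mu].
Proof.
move=> h h'; have Lu := generatorL h; have Lv := generatorR h; have Lv' := generatorR h'.
apply/ae_eq_nrm => //; apply/eqP; rewrite eq_le nrm_ge0 andbT.
apply/ler_addgt0Pl => e e0; rewrite addr0.
have e20 : 0 < e / 2 by rewrite divr_gt0.
have h1 := generator_near h e20; have h2 := generator_near h' e20.
near (0 : R)^'+ => t.
have t0 : 0 < t by near: t; exact: nbhs_right_gt.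
have lt1 : nrm (fun x => quot t u x - v x) < e / 2 by near: t.
have lt2 : nrm (fun x => quot t u x - v' x) < e / 2 by near: t.
have LQ := L2_quot (ltW t0) Lu.
apply: le_trans (nrm_triangle Lv LQ Lv') _.
by rewrite nrmBC; apply: le_trans (lerD (ltW lt1) (ltW lt2)) _; rewrite -splitr.
Unshelve. all: by end_near. Qed.

Lemma generator_cst c : G (fun=> c) (fun=> 0).
Proof.
apply/generatorP; [exact: L2_cst|exact: L2_cst|] => e e0; near=> t.
have -> : (fun x => quot t (fun=> c) x - 0) = (fun=> 0).
  apply/funext => x; rewrite /quot /semigroup Rintegral_cst// prob_kernel/=.
  by rewrite mulr1 subrr mulr0 subr0.
by rewrite nrm0.
Unshelve. all: by end_near. Qed.

Lemma generator_sym u v u' v' : G u v -> G u' v' -> ip v u' = ip u v'.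
Proof.
move=> h h'; have Lu := generatorL h; have Lv := generatorR h.
have Lu' := generatorL h'; have Lv' := generatorR h'.
apply/eqP; rewrite -subr_eq0 -normr_le0; apply/ler_addgt0Pl => e e0; rewrite addr0.
have K0 : 0 < nrm u + nrm u' + 1 by rewrite ltr_wpDl// addr_ge0// nrm_ge0.
have h1 := generator_near h (divr_gt0 e0 K0).
have h2 := generator_near h' (divr_gt0 e0 K0).
near (0 : R)^'+ => t.
have t0 : 0 < t by near: t; exact: nbhs_right_gt.
have lt1 : nrm (fun x => quot t u x - v x) < e / (nrm u + nrm u' + 1) by near: t.
have lt2 : nrm (fun x => quot t u' x - v' x) < e / (nrm u + nrm u' + 1) by near: t.
have Q := L2_quot (ltW t0) Lu; have Q' := L2_quot (ltW t0) Lu'.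
have E : ip (quot t u) u' = ip u (quot t u').
  have s1 := L2_sg (ltW t0) Lu; have s2 := L2_sg (ltW t0) Lu'.
  rewrite /quot ipZl ?ipZr ?ipBl ?ipBr ?semigroup_sym ?ltW//; exact: L2B.
have -> : ip v u' - ip u v' = ip u (fun x => quot t u' x - v' x) - ip (fun x => quot t u x - v x) u'.
  by rewrite ipBl// ipBr// E; ring.
have c1 := cauchy_schwarz Lu (L2B Q' Lv'); have c2 := cauchy_schwarz (L2B Q Lv) Lu'.
apply: le_trans (ler_normB _ _) _; apply: le_trans (lerD c1 c2) _.
have n1 := nrm_ge0 mu u; have n2 := nrm_ge0 mu u'.
apply: (@le_trans _ _ (nrm u * (e / (nrm u + nrm u' + 1)) + e / (nrm u + nrm u' + 1) * nrm u')).
  by apply: lerD; [apply: ler_wpM2l|apply: ler_wpM2r] => //; exact: ltW.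
rewrite (mulrC (nrm u)) -mulrDr mulrAC ler_pdivrMr//.
by apply: ler_wpM2l; [exact: ltW|lra].
Unshelve. all: by end_near. Qed.

(** Since P_t is a contraction, <u, P_t u> <= |u|^2, so <u, (P_t u - u) / t> <= 0 for every t >
    0. *)
Lemma generator_neg u v : G u v -> ip u v <= 0.
Proof.
move=> h; have Lu := generatorL h; have Lv := generatorR h.
apply/ler_addgt0Pl => e e0; rewrite addr0.
have K0 : 0 < nrm u + 1 by rewrite ltr_wpDl// nrm_ge0.
have h1 := generator_near h (divr_gt0 e0 K0).
near (0 : R)^'+ => t.
have t0 : 0 < t by near: t; exact: nbhs_right_gt.
have lt1 : nrm (fun x => quot t u x - v x) < e / (nrm u + 1) by near: t.
have Q := L2_quot (ltW t0) Lu.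
have Qneg : ip u (quot t u) <= 0.
  have s1 := L2_sg (ltW t0) Lu.
  rewrite /quot ipZr ?ipBr//; last exact: L2B.
  rewrite pmulr_rle0 ?invr_gt0// subr_le0 -(nrm_sqr _ u) expr2.
  apply: le_trans (ler_norm _) _; apply: le_trans (cauchy_schwarz Lu s1) _.
  by apply: ler_wpM2l; [exact: nrm_ge0|have [] := semigroup_contraction (ltW t0) Lu].
have -> : ip u v = ip u (quot t u) - ip u (fun x => quot t u x - v x) by rewrite ipBr//; ring.
have n1 := nrm_ge0 mu u.
have c1 := cauchy_schwarz Lu (L2B Q Lv).
have : `|ip u (fun x => quot t u x - v x)| <= e.
  apply: le_trans c1 _; apply: (@le_trans _ _ (nrm u * (e / (nrm u + 1)))).
    by apply: ler_wpM2l => //; exact: ltW.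
  by rewrite mulrA ler_pdivrMr// mulrC; apply: ler_wpM2l; [exact: ltW|lra].
move: (ip u (fun x => quot t u x - v x)) Qneg => z; rewrite ler_norml => ? /andP[]; lra.
Unshelve. all: by end_near. Qed.

End reversible_semigroup.

(** * Symmetric dissipative operators *)

(** The properties of the generator retained from the process. As [L] is a graph on functions rather
    than on classes, invariance and uniqueness up to null sets are separate clauses. *)
Record dissipative_symmetric (R : realType) (dS : measure_display) (S : measurableType dS)
    (mu : probability S R) (L : (S -> R) -> (S -> R) -> Prop) : Prop := {
  op_L2l : forall u v, L u v -> u \in Lfun mu 2%:E;
  op_L2r : forall u v, L u v -> v \in Lfun mu 2%:E;
  op_lin : forall a u v u' v', L u v -> L u' v' ->
    L (fun x => a * u x + u' x) (fun x => a * v x + v' x);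
  op_ae : forall u v u' v', L u v -> u' \in Lfun mu 2%:E -> v' \in Lfun mu 2%:E ->
    u = u' %[ae mu] -> v = v' %[ae mu] -> L u' v';
  op_uniq : forall u v v', L u v -> L u v' -> v = v' %[ae mu];
  op_cst : forall c, L (fun=> c) (fun=> 0);
  op_sym : forall u v u' v', L u v -> L u' v' -> ip mu v u' = ip mu u v';
  op_neg : forall u v, L u v -> ip mu u v <= 0 }.

Section operator.
Context (R : realType) (dS : measure_display) (S : measurableType dS)
  (mu : probability S R) (L : (S -> R) -> (S -> R) -> Prop).
Hypothesis hL : dissipative_symmetric mu L.
Implicit Types f g u v c : S -> R.
Local Notation L2 f := (f \in Lfun mu 2%:E).
Local Notation ip := (ip mu).
Local Notation nrm := (nrm mu).

Let mu_fin : (mu setT < +oo)%E.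
Proof. by rewrite probability_setT ltry. Qed.

Lemma op_scale a u v : L u v -> L (fun x => a * u x) (fun x => a * v x).
Proof.
move=> h; have := op_lin hL a h (op_cst hL 0).
by under eq_fun do rewrite addr0; under [X in L _ X -> _]eq_fun do rewrite addr0.
Qed.

Lemma op_add u v u' v' : L u v -> L u' v' -> L (fun x => u x + u' x) (fun x => v x + v' x).
Proof.
move=> h h'; have := op_lin hL 1 h h'.
by under eq_fun do rewrite mul1r; under [X in L _ X -> _]eq_fun do rewrite mul1r.
Qed.

Lemma op_sub u v u' v' : L u v -> L u' v' -> L (fun x => u x - u' x) (fun x => v x - v' x).
Proof.
move=> h h'; have := op_lin hL (-1) h' h.
by under eq_fun do rewrite mulN1r addrC; under [X in L _ X -> _]eq_fun do rewrite mulN1r addrC.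
Qed.

Definition mean u : R := \int[mu]_x u x.

Lemma meanE u : mean u = ip u (fun=> 1).
Proof. by apply: eq_Rintegral => x _; rewrite mulr1. Qed.

Lemma op_mean u v : L u v -> mean v = 0.
Proof.
by move=> h; rewrite meanE (op_sym hL h (op_cst hL 1)) ipC ip0l.
Qed.

Lemma closed_form_op u v : L u v -> closed_form mu L u (- ip u v).
Proof.
move=> h; have Lu := op_L2l hL h; split => //; exists (fun=> u), (fun=> v); split => //.
- have -> : L2norm mu (fun x => u x - u x) = 0%E.
    by under eq_fun do rewrite subrr; rewrite L2norm_nrm ?nrm0//; exact: L2_0.
  exact: cvg_cst.
- move=> e e0; exists 0%N => n k _ _; rewrite /preform.
  by under eq_Rintegral do rewrite subrr mul0r; rewrite Rintegral_cst// mul0r oppr0.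
- exact: cvg_cst.
Qed.

Lemma dirichlet_form_le u v : L u v -> (dirichlet_form mu L u <= (- ip u v)%:E)%E.
Proof. by move=> h; apply: ereal_inf_lbound; exists (- ip u v); [exact: closed_form_op|]. Qed.

Lemma parallelogram f g : L2 f -> L2 g ->
  ip (fun x => f x - g x) (fun x => f x - g x) = 2 * ip f f + 2 * ip g g -
  4 * ip (fun x => 2^-1 * (f x + g x)) (fun x => 2^-1 * (f x + g x)).
Proof.
move=> Lf Lg; have LD := L2D Lf Lg; have LB := L2B Lf Lg; have LZ := L2Z 2^-1 LD.
rewrite (ipBl Lf Lg LB) (ipBr Lf Lg Lf) (ipBr Lf Lg Lg) (ipZl _ LD LZ) (ipZr _ LD LD).
by rewrite (ipDl Lf Lg LD) (ipDr Lf Lg Lf) (ipDr Lf Lg Lg) (ipC _ g f); field.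
Qed.

Lemma ip_sub_scale s f g : L2 f -> L2 g ->
  ip (fun x => f x - s * g x) (fun x => f x - s * g x) =
  ip f f - 2 * s * ip f g + s ^+ 2 * ip g g.
Proof.
move=> Lf Lg; have LZ := L2Z s Lg; have LB := L2B Lf LZ.
rewrite (ipBl Lf LZ LB) (ipBr Lf LZ Lf) (ipBr Lf LZ LZ) !(ipZl _ Lg)//.
by rewrite !(ipZr _ Lg)// (ipC _ g f); ring.
Qed.

Lemma poincare_op m : 0 < m -> poincare mu L m ->
  forall u v, L u v -> mean u = 0 -> m * ip u u <= - ip u v.
Proof.
move=> m0 hp u v h u0; have Lu := op_L2l hL h.
have := hp u (ex_intro _ _ (closed_form_op h)); rewrite -/(mean u) u0.
have -> : (fun x => u x - 0) = u by apply/funext => x; rewrite subr0.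
rewrite L2norm_nrm// => le1.
have le2 : ((m^-1)%:E * dirichlet_form mu L u <= (m^-1)%:E * (- ip u v)%:E)%E.
  by apply: lee_wpmul2l; [rewrite lee_fin invr_ge0 ltW|exact: dirichlet_form_le].
have := le_trans le1 le2; rewrite -EFin_expe -EFinM lee_fin nrm_sqr.
by rewrite ler_pdivlMl.
Qed.

Hypothesis hspec : purely_discrete_spectrum mu L.

(** A positive number cannot be an eigenvalue because <u, L u> <= 0, and the spectrum consists of
    eigenvalues; hence 1 / l lies in the resolvent set. *)
Lemma resolvent_pos l f : 0 < l -> L2 f ->
  exists u v, L u v /\ (fun x => u x - l * v x) = f %[ae mu].
Proof.
move=> l0 Lf.
have : resolvent_set mu L l^-1.
  apply: contrapT => ns; have [[u [[v [h vE]] u0]] _ _] := hspec ns.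
  apply: u0; have Lu := op_L2l hL h; have Lv := op_L2r hL h.
  rewrite L2norm_nrm//; congr EFin.
  have := op_neg hL h; rewrite ipC (ip_ae vE)//; last exact: L2Z.
  rewrite ipZl// pmulr_rle0 ?invr_gt0// => u0.
  by apply/eqP; rewrite -sqrf_eq0 nrm_sqr eq_le u0 ip_ge0.
move=> [+ _] => /(_ (fun x => l^-1 * f x) (L2Z _ Lf)) [u [v [h E]]].
exists u, v; split => //; apply: filterS E => x /= /(_ I) E _.
have -> : u x - l * v x = l * (l^-1 * u x - v x) by field; rewrite gt_eqF.
by rewrite E mulrA divff ?gt_eqF// mul1r.
Qed.

(* The component c - p of c orthogonal to the closure of the domain equals (1 - L) s for some s;
   writing s = (1 - L) w gives |s|^2 = <w, (1 - L) s> = <w, c - p> = 0. *)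
Lemma op_dense c e : L2 c -> 0 < e -> exists u v, L u v /\ nrm (fun x => c x - u x) <= e.
Proof.
move=> Lc e0.
pose A := [set r | exists u v, L u v /\ r = ip (fun x => c x - u x) (fun x => c x - u x)].
have A_lb : lbound A 0 by move=> _ [u [v [_ ->]]]; exact: ip_ge0.
have hinf : has_inf A.
  split; last by exists 0.
  exists (ip (fun x => c x - 0) (fun x => c x - 0)), (fun=> 0), (fun=> 0); split => //.
  exact: (op_cst hL 0).
set d2 := inf A.
have d2le u v : L u v -> d2 <= ip (fun x => c x - u x) (fun x => c x - u x).
  by move=> h; apply: ge_inf; [exact: hinf.2|exists u, v].
(* With this precision the parallelogram identity bounds the square of the k-th increment by 4 (4
   16^k)^-1 = (4^-k)^2, as [L2_complete] requires. *)
have eps k : 0 < (4 * 16 ^+ k)^-1 :> R by rewrite invr_gt0 mulr_gt0// exprn_gt0.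
have /choice [uv uvP] : forall k : nat, exists uv : (S -> R) * (S -> R), L uv.1 uv.2 /\
    ip (fun x => c x - uv.1 x) (fun x => c x - uv.1 x) < d2 + (4 * 16 ^+ k)^-1.
  move=> k; have [_ [u [v [h ->]]] lt] := inf_adherent (eps k) hinf.
  by exists (u, v).
pose u k := (uv k).1.
have hu k : L (u k) (uv k).2 := (uvP k).1.
have Lu k : L2 (u k) := op_L2l hL (hu k).
have LB k : L2 (fun x => c x - u k x) by exact: L2B.
have ltu k : ip (fun x => c x - u k x) (fun x => c x - u k x) < d2 + (4 * 16 ^+ k)^-1 := (uvP k).2.
have incr k : nrm (fun x => u k.+1 x - u k x) <= 1 / 4 ^+ k.
  rewrite -(@ler_pXn2r _ 2)// ?nnegrE ?nrm_ge0 ?divr_ge0 ?exprn_ge0// nrm_sqr.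
  have hm := op_scale 2^-1 (op_add (hu k) (hu k.+1)).
  have := d2le _ _ hm.
  have -> : (fun x => c x - 2^-1 * (u k x + u k.+1 x)) =
      (fun x => 2^-1 * ((c x - u k x) + (c x - u k.+1 x))).
    by apply/funext => x; field.
  have -> : (fun x => u k.+1 x - u k x) = (fun x => (c x - u k x) - (c x - u k.+1 x)).
    by apply/funext => x; ring.
  rewrite parallelogram//; have := ltu k; have := ltu k.+1.
  have -> : (1 / 4 ^+ k) ^+ 2 = 4 * (4 * 16 ^+ k)^-1 :> R.
    have -> : 16 = 4 ^+ 2 :> R by rewrite -natrX.
    by rewrite -exprM mulnC exprM; field; rewrite expf_neq0.
  have : (4 * 16 ^+ k.+1)^-1 <= (4 * 16 ^+ k)^-1 :> R.
    rewrite lef_pV2 ?posrE ?mulr_gt0 ?exprn_gt0//; apply: ler_wpM2l => //.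
    by rewrite exprS ler_peMl ?exprn_ge0//; lra.
  lra.
have [p Lp up] := L2_complete Lu incr.
have orth w Lw : L w Lw -> ip (fun x => c x - p x) w = 0.
  move=> hw; have LW := op_L2l hL hw.
  have small k : `|ip (fun x => c x - u k x) w| <= nrm w / 4 ^+ k.
    (* Moving u_k by s w within the domain cannot bring the squared distance below its infimum; the
       discriminant of this quadratic in s bounds b. *)
    set b := ip _ _; have key s : 0 <= (4 * 16 ^+ k)^-1 - 2 * s * b + s ^+ 2 * ip w w.
      have := d2le _ _ (op_lin hL s hw (hu k)).
      have -> : (fun x => c x - (s * w x + u k x)) = (fun x => (c x - u k x) - s * w x).
        by apply/funext => x; ring.
      by rewrite ip_sub_scale// -/b; have := ltu k; lra.
    rewrite -(@ler_pXn2r _ 2)// ?nnegrE ?normr_ge0 ?divr_ge0 ?nrm_ge0 ?exprn_ge0//.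
    rewrite real_normK ?num_real// expr_div_n nrm_sqr.
    have -> : (4 ^+ k) ^+ 2 = 16 ^+ k :> R by rewrite -exprM mulnC exprM -natrX.
    rewrite ler_pdivlMr ?exprn_gt0//.
    have := ip_ge0 mu w; rewrite le_eqVlt => /orP[/eqP w0|w0].
      have [->|b0] := eqVneq b 0; first by rewrite expr0n mul0r -w0.
      have := key (1 / b); rewrite -w0 mulr0 addr0.
      have -> : 2 * (1 / b) * b = 2 by field.
      have : (4 * 16 ^+ k)^-1 <= 1 :> R.
        rewrite invf_le1 ?mulr_gt0 ?exprn_gt0// -[1]mulr1.
        by apply: ler_pM => //; [lra|apply: exprn_ege1; lra].
      by lra.
    have := key (b / ip w w).
    have E q : q - 2 * (b / ip w w) * b + (b / ip w w) ^+ 2 * ip w w = q - b ^+ 2 / ip w w.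
      by field; rewrite gt_eqF.
    rewrite E.
    rewrite subr_ge0 ler_pdivrMr// => le1.
    rewrite -ler_pdivlMr ?exprn_gt0//; apply: le_trans le1 _.
    rewrite mulrC; apply: ler_wpM2l; first exact: ltW.
    rewrite lef_pV2 ?posrE ?mulr_gt0 ?exprn_gt0//.
    by rewrite ler_peMl ?exprn_ge0//; lra.
  apply/eqP; rewrite -normr_le0; apply/ler_addgt0Pl => e' e'0; rewrite addr0.
  have K0 : 0 < 3 * nrm w + 1 by rewrite ltr_wpDl ?mulr_ge0 ?nrm_ge0.
  have [k ltk] : exists k, (4 ^+ k)^-1 <= e' / (3 * nrm w + 1) :> R.
    have c4 : (4^-1) ^+ k @[k --> \oo] --> (0 : R) by apply: cvg_expr; rewrite ger0_norm; lra.
    have /cvgrPdist_lt /(_ _ (divr_gt0 e'0 K0)) [k _ /(_ k (leqnn _))] := c4.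
    rewrite /= sub0r normrN exprVn ger0_norm ?invr_ge0 ?exprn_ge0// => /ltW h.
    by exists k.
  have -> : ip (fun x => c x - p x) w = ip (fun x => c x - u k x) w + ip (fun x => u k x - p x) w.
    by rewrite !ipBl//; ring.
  apply: le_trans (ler_normD _ _) _.
  have b2 := cauchy_schwarz (L2B (Lu k) Lp) LW.
  apply: le_trans (lerD (small k) b2) _.
  apply: (@le_trans _ _ (nrm w / 4 ^+ k + (2 * 1 / 4 ^+ k) * nrm w)).
    by rewrite lerD2l; apply: ler_wpM2r; [exact: nrm_ge0|exact: up].
  apply: (@le_trans _ _ ((4 ^+ k)^-1 * (3 * nrm w + 1))).
    by have : 0 <= (4 ^+ k)^-1 :> R; [rewrite invr_ge0 exprn_ge0|lra].
  by rewrite -ler_pdivlMr.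
have Ld : L2 (fun x => c x - p x) by exact: L2B.
have [s [t [hst dE]]] := resolvent_pos ltr01 Ld.
have Ls := op_L2l hL hst; have Lt := op_L2r hL hst.
have [w [w' [hw wE]]] := resolvent_pos ltr01 Ls.
have Lw := op_L2l hL hw; have Lw' := op_L2r hL hw.
have s0 : nrm s = 0.
  apply/eqP; rewrite -sqrf_eq0 nrm_sqr; apply/eqP.
  have := orth _ _ hw; rewrite -(ip_ae dE)//; last by apply: L2B => //; exact: L2Z.
  have sE : ip s s = ip (fun x => w x - 1 * w' x) s.
    by rewrite (ip_ae wE)//; apply: L2B => //; exact: L2Z.
  move=> <-; rewrite sE (ipBl Lw (L2Z 1 Lw') Ls) (ipZl _ Lw' Ls).
  rewrite (ipBl Ls (L2Z 1 Lt) Lw) (ipZl _ Lt Lw) (op_sym hL hst hw).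
  by rewrite (ipC _ w s) (ipC _ w' s).
have t0 : t = (fun=> 0) %[ae mu].
  apply: (op_uniq hL (u := fun=> 0)); last exact: (op_cst hL 0).
  apply: (op_ae hL hst) => //; first exact: L2_0.
    by apply/nrm_eq0.
  exact: aeW.
have cp0 : nrm (fun x => c x - p x) = 0.
  apply/nrm_eq0 => //; have s00 := (nrm_eq0 Ls).1 s0.
  by apply: filterS3 dE s00 t0 => x /= /(_ I) <- /(_ I) -> /(_ I) -> _; rewrite mulr0 subr0.
have [k ltk] : exists k, 2 * 1 / 4 ^+ k <= e :> R.
  have c4 : (4^-1) ^+ k @[k --> \oo] --> (0 : R) by apply: cvg_expr; rewrite ger0_norm; lra.
  have e20 : 0 < e / 2 by rewrite divr_gt0.
  have /cvgrPdist_lt /(_ _ e20) [k _ /(_ k (leqnn _))] := c4.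
  rewrite /= sub0r normrN exprVn ger0_norm ?invr_ge0 ?exprn_ge0// => /ltW h.
  by exists k; lra.
exists (u k), (uv k).2; split; first exact: hu.
apply: le_trans (nrm_triangle Lc Lp (Lu k)) _.
by rewrite cp0 add0r nrmBC; apply: le_trans (up k) _.
Qed.

End operator.

(** * Positivity and polynomials of an operator *)

Section schur.
Context (R : realFieldType).

Definition psd n (M : 'I_n -> 'I_n -> R) : Prop :=
  (forall i j, M i j = M j i) /\
  forall c : 'I_n -> R, 0 <= \sum_i \sum_j c i * c j * M i j.

Let ext n (x : R) (c : 'I_n -> R) (i : 'I_n.+1) := oapp c x (unlift ord0 i).

Let ext_form n (M : 'I_n.+1 -> 'I_n.+1 -> R) x c : (forall i j, M i j = M j i) ->
  \sum_i \sum_j ext x c i * ext x c j * M i j =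
  x ^+ 2 * M ord0 ord0 + 2 * x * (\sum_j c j * M ord0 (lift ord0 j))
  + \sum_i \sum_j c i * c j * M (lift ord0 i) (lift ord0 j).
Proof.
move=> Ms; rewrite big_ord_recl big_ord_recl /ext unlift_none /=.
have -> : \sum_(j < n) x * oapp c x (unlift ord0 (lift ord0 j)) * M ord0 (lift ord0 j) =
    x * \sum_(j < n) c j * M ord0 (lift ord0 j).
  by rewrite mulr_sumr; apply: eq_bigr => j _; rewrite liftK /=; ring.
have -> : \sum_(i < n) \sum_j oapp c x (unlift ord0 (lift ord0 i)) *
    oapp c x (unlift ord0 j) * M (lift ord0 i) j =
    x * (\sum_(j < n) c j * M ord0 (lift ord0 j)) +
    \sum_i \sum_j c i * c j * M (lift ord0 i) (lift ord0 j).
  rewrite mulr_sumr -big_split/=; apply: eq_bigr => i _.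
  rewrite big_ord_recl unlift_none liftK /= Ms; congr (_ + _); first by ring.
  by apply: eq_bigr => j _; rewrite liftK.
by ring.
Qed.

(** Induction on the size by Schur complements: M is the sum of the rank-one matrix b_i b_j / a
    built from its first row and of a smaller nonnegative matrix M'. The rank-one part contributes a
    value of the quadratic form of N, the rest is the induction hypothesis. *)
Lemma schur n (M N : 'I_n -> 'I_n -> R) : psd M -> psd N ->
  0 <= \sum_i \sum_j M i j * N i j.
Proof.
elim: n M N => [|n IH] M N [Ms Mp] [Ns Np]; first by rewrite big_ord0.
pose a := M ord0 ord0; pose b j := M ord0 (lift ord0 j).
have MQ x c : 0 <= x ^+ 2 * a + 2 * x * (\sum_j c j * b j)
    + \sum_i \sum_j c i * c j * M (lift ord0 i) (lift ord0 j).
  by rewrite -ext_form.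
have a0 : 0 <= a.
  have := MQ 1 (fun=> 0); rewrite expr1n mul1r.
  have -> : \sum_(j < n) 0 * b j = 0 by rewrite big1// => *; rewrite mul0r.
  by rewrite mulr0 addr0 big1 ?addr0// => i _; rewrite big1// => j _; rewrite !mul0r.
(* A zero on the diagonal of a nonnegative matrix forces its row to vanish; otherwise the form would
   be affine in x and take the value -1. *)
have ab j : a = 0 -> b j = 0.
  move=> az; pose t := M (lift ord0 j) (lift ord0 j).
  have MQ2 x : 0 <= 2 * x * b j + t.
    have := MQ x (fun i => (i == j)%:R); rewrite az mulr0 add0r.
    have d (F : 'I_n -> R) : \sum_i (i == j)%:R * F i = F j.
      by rewrite (bigD1 j)//= eqxx mul1r big1 ?addr0// => i /negbTE ->; rewrite mul0r.
    under [X in _ + X]eq_bigr do under eq_bigr do rewrite -mulrA.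
    by under [X in _ + X]eq_bigr do rewrite -mulr_sumr d; rewrite !d.
  have [//|bj] := eqVneq (b j) 0.
  have := MQ2 (- (t + 1) / (2 * b j)).
  have -> : 2 * (- (t + 1) / (2 * b j)) * b j + t = - 1 by field.
  by rewrite ler0N1.
(* For a = 0 the inverse is 0 by convention, and [ab] makes the decomposition remain correct. *)
pose M' i j := M (lift ord0 i) (lift ord0 j) - b i * b j * a^-1.
pose N' i j := N (lift ord0 i) (lift ord0 j).
have psdM' : psd M'.
  split=> [i j|c]; first by rewrite /M' Ms (mulrC (b i)).
  have := MQ (- (\sum_j c j * b j) * a^-1) c.
  have -> : \sum_i \sum_j c i * c j * M' i j =
     \sum_i \sum_j c i * c j * M (lift ord0 i) (lift ord0 j) -
     (\sum_j c j * b j) ^+ 2 * a^-1.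
    rewrite expr2 [X in _ - X * _]mulr_suml mulr_suml -sumrB; apply: eq_bigr => i _.
    rewrite mulr_sumr mulr_suml -sumrB; apply: eq_bigr => j _; rewrite /M'; ring.
  have E (q s : R) : 0 <= (- s / a) ^+ 2 * a + 2 * (- s / a) * s + q -> 0 <= q - s ^+ 2 / a.
    have [->|an0] := eqVneq a 0.
      by rewrite invr0 !mulr0 mul0r add0r subr0 add0r.
    by congr (0 <= _); field.
  exact: E.
have psdN' : psd N'.
  split=> [i j|c]; first by rewrite /N' Ns.
  have := Np (ext 0 c); rewrite ext_form// expr0n/= !mul0r mulr0 mul0r.
  by rewrite !add0r.
have := IH M' N' psdM' psdN'.
have Nab := Np (ext a b); rewrite ext_form// in Nab.
have -> : \sum_i \sum_j M i j * N i j = a^-1 * (a ^+ 2 * N ord0 ord0 +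
    2 * a * (\sum_j b j * N ord0 (lift ord0 j)) +
    \sum_i \sum_j b i * b j * N (lift ord0 i) (lift ord0 j)) + \sum_i \sum_j M' i j * N' i j.
  have -> : \sum_i \sum_j M' i j * N' i j =
    \sum_i \sum_j M (lift ord0 i) (lift ord0 j) * N (lift ord0 i) (lift ord0 j)
    - a^-1 * \sum_i \sum_j b i * b j * N (lift ord0 i) (lift ord0 j).
    rewrite mulr_sumr -sumrB; apply: eq_bigr => i _.
    rewrite mulr_sumr -sumrB; apply: eq_bigr => j _; rewrite /M' /N'; ring.
  have -> : \sum_i \sum_j M i j * N i j = a * N ord0 ord0 +
    2 * (\sum_j b j * N ord0 (lift ord0 j)) +
    \sum_i \sum_j M (lift ord0 i) (lift ord0 j) * N (lift ord0 i) (lift ord0 j).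
    rewrite big_ord_recl big_ord_recl.
    under [X in _ + X = _]eq_bigr do rewrite big_ord_recl.
    rewrite big_split/=.
    have -> : \sum_(i < n) M (lift ord0 i) ord0 * N (lift ord0 i) ord0 =
      \sum_j b j * N ord0 (lift ord0 j).
      by apply: eq_bigr => i _; rewrite Ms Ns.
    by rewrite -/a; set w := \sum_(i < n) M ord0 _ * _; rewrite -[w]/(\sum_j b j * N ord0 (lift ord0 j)); ring.
  have [az|an0] := eqVneq a 0; last by field.
  rewrite az invr0 !mul0r subr0 add0r.
  have -> : \sum_j b j * N ord0 (lift ord0 j) = 0.
    by rewrite big1// => j _; rewrite ab// mul0r.
  by rewrite mulr0 !add0r.
by move=> h; apply: addr_ge0 => //; apply: mulr_ge0 => //; rewrite invr_ge0.
Qed.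

End schur.

Section cone.
Context (R : realFieldType).

(* If q - p lies in this cone, then p(Z) <= q(Z) for every symmetric Z >= 0. *)
Definition cone (p : {poly R}) : Prop := forall k, 0 <= p`_k.
Implicit Types p q : {poly R}.

Lemma coneD p q : cone p -> cone q -> cone (p + q).
Proof. by move=> hp hq k; rewrite coefD addr_ge0. Qed.

Lemma coneM p q : cone p -> cone q -> cone (p * q).
Proof.
by move=> hp hq k; rewrite coefM; apply: sumr_ge0 => i _; rewrite mulr_ge0.
Qed.

Lemma coneC c : 0 <= c -> cone c%:P.
Proof. by move=> c0 k; rewrite coefC; case: ifP. Qed.

Lemma coneX : cone 'X.
Proof. by move=> k; rewrite coefX. Qed.

Lemma cone0 : cone 0.
Proof. by move=> k; rewrite coef0. Qed.

Lemma cone1 : cone 1.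
Proof. exact: coneC. Qed.

Lemma cone_exp p k : cone p -> cone (p ^+ k).
Proof. by move=> hp; elim: k => [|k IH]; [exact: cone1|rewrite exprS; exact: coneM]. Qed.

Lemma cone_sum (I : Type) (r : seq I) (P : pred I) (F : I -> {poly R}) :
  (forall i, P i -> cone (F i)) -> cone (\sum_(i <- r | P i) F i).
Proof. by move=> h; elim/big_ind: _ => //; [exact: cone0|exact: coneD]. Qed.

Lemma cone_prod (I : Type) (r : seq I) (P : pred I) (F : I -> {poly R}) :
  (forall i, P i -> cone (F i)) -> cone (\prod_(i <- r | P i) F i).
Proof. by move=> h; elim/big_ind: _ => //; [exact: cone1|exact: coneM]. Qed.

End cone.

Section moments.
Context (R : realFieldType) (V : lmodType R) (ip : V -> V -> R) (Z : V -> V -> Prop).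
Hypothesis ip_lin : forall a u v w, ip (a *: u + v) w = a * ip u w + ip v w.
Hypothesis ip_sym : forall u v, ip u v = ip v u.
Hypothesis ip_pos : forall u, 0 <= ip u u.
Hypothesis Z_lin : forall a u v u' v', Z u v -> Z u' v' -> Z (a *: u + u') (a *: v + v').
Hypothesis Z_0 : Z 0 0.
Hypothesis Z_sym : forall u v u' v', Z u v -> Z u' v' -> ip v u' = ip u v'.
Hypothesis Z_pos : forall u v, Z u v -> 0 <= ip v u.

Let ip0 w : ip 0 w = 0.
Proof. by have := ip_lin (-1) 0 0 w; rewrite scaler0 addr0 mulN1r addNr. Qed.

Let ipZ a u w : ip (a *: u) w = a * ip u w.
Proof. by have := ip_lin a u 0 w; rewrite addr0 ip0 addr0. Qed.

Let ipD u v w : ip (u + v) w = ip u w + ip v w.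
Proof. by have := ip_lin 1 u v w; rewrite scale1r mul1r. Qed.

Let form_suml (I : Type) (r : seq I) (F : I -> V) w :
  ip (\sum_(i <- r) F i) w = \sum_(i <- r) ip (F i) w.
Proof. by elim/big_rec2: _ => [//|i x y _ <-]; rewrite ipD. Qed.

Let Z_sum (I : Type) (r : seq I) (F F' : I -> V) : (forall i, Z (F i) (F' i)) ->
  Z (\sum_(i <- r) F i) (\sum_(i <- r) F' i).
Proof.
move=> h; elim/big_rec2: _ => [//|i x y _ Zxy].
by have := Z_lin 1 (h i) Zxy; rewrite !scale1r.
Qed.

Context (n N : nat) (W : 'I_n -> nat -> V).
Hypothesis ZW : forall i k, (k <= N)%N -> Z (W i k) (W i k.+1).

(* mom i l k = <Z^k w_i, w_l> with W i k = Z^k w_i, for k <= 2 (N + 1); as only the powers up to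
   N + 1 are available, the larger ones are split between both arguments. *)
Definition mom i l k : R :=
  if (k <= N.+1)%N then ip (W i k) (W l 0) else ip (W i N.+1) (W l (k - N.+1)).

Let shift i l a b j : (a + j <= N.+1)%N -> (j <= b)%N -> (b <= N.+1)%N ->
  ip (W i a) (W l b) = ip (W i (a + j)) (W l (b - j)).
Proof.
elim: j => [|j IH] aj jb bN; first by rewrite addn0 subn0.
have aj' : (a + j <= N)%N by rewrite -ltnS -addnS.
rewrite IH//; [|exact: leqW|exact: ltnW].
have bj : (b - j = (b - j.+1).+1)%N by rewrite subnSK.
have h1 := ZW i aj'.
have bj1 : (b - j.+1 <= N)%N by rewrite -ltnS -bj; apply: leq_trans bN; exact: leq_subr.
by have := Z_sym h1 (ZW l bj1); rewrite -bj -addnS => ->.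
Qed.

(** The symmetry of Z moves powers from one argument to the other one at a time, so the pairing
    depends on a + b only. *)
Lemma momE i l a b : (a <= N.+1)%N -> (b <= N.+1)%N -> ip (W i a) (W l b) = mom i l (a + b).
Proof.
move=> aN bN; rewrite /mom; case: ifP => abN.
  by rewrite (@shift _ _ _ _ b)// subnn.
have lt : (N.+1 < a + b)%N by rewrite ltnNge abN.
rewrite (@shift _ _ _ _ (N.+1 - a))// ?subnKC//; last by rewrite leq_subLR ltnW.
by congr (ip _ (W l _)); rewrite subnBA// addnC.
Qed.

(** With k split in halves, the quadratic form is |u|^2 for even k and <Z u, u> for odd k, where u
    is the combination of the Z^(k/2) w_i, with k/2 rounded down. *)
Lemma psd_mom k : (k <= N.+1.*2)%N -> psd (fun i l => mom i l k).
Proof.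
move=> kN.
have k2 : (k = odd k + k./2 + k./2)%N by rewrite -addnA addnn odd_double_half.
have [k2N oN] : (k./2 <= N.+1)%N /\ (odd k + k./2 <= N.+1)%N.
  by lia.
split=> [i l|c].
  by rewrite {1}k2 -momE// ip_sym momE// addnC -k2.
pose u := \sum_i c i *: W i k./2; pose v := \sum_i c i *: W i (odd k + k./2)%N.
have -> : \sum_i \sum_j c i * c j * mom i j k = ip v u.
  rewrite /v form_suml; apply: eq_bigr => i _; rewrite ipZ ip_sym form_suml mulr_sumr.
  apply: eq_bigr => l _; rewrite ipZ ip_sym mulrA; congr (_ * _).
  by rewrite momE// -k2.
have [ko|ko] := boolP (odd k).
  rewrite /v ko in oN *.
  apply: Z_pos; apply: Z_sum => i.
  have := Z_lin (c i) (ZW i (oN : (k./2 <= N)%N)) Z_0.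
  by rewrite !addr0.
by rewrite /v (negbTE ko) add0n; exact: ip_pos.
Qed.

(* Lam K r = \sum_(i, l) K_il <r(Z) w_i, w_l>, the square norm of r(Z)^(1/2) \sum_i phi_i w_i if K is
   the Gram matrix of the phi_i. *)
Definition Lam (K : 'I_n -> 'I_n -> R) (r : {poly R}) : R :=
  \sum_(k < (N.+1.*2).+1) r`_k * \sum_i \sum_l K i l * mom i l k.

Lemma Lam_pos K r : psd K -> cone r -> 0 <= Lam K r.
Proof.
move=> hK hr; apply: sumr_ge0 => k _; apply: mulr_ge0 => //.
by apply: schur => //; apply: psd_mom; rewrite -ltnS.
Qed.

Lemma LamD K r r' : Lam K (r + r') = Lam K r + Lam K r'.
Proof. by rewrite /Lam -big_split/=; apply: eq_bigr => k _; rewrite coefD mulrDl. Qed.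

Lemma LamZ K c r : Lam K (c *: r) = c * Lam K r.
Proof. by rewrite /Lam mulr_sumr; apply: eq_bigr => k _; rewrite coefZ mulrA. Qed.

Lemma LamB K (r r' : {poly R}) : Lam K (r - r') = Lam K r - Lam K r'.
Proof. by rewrite LamD -[- r']scaleN1r LamZ mulN1r. Qed.

Lemma Lam_sum (I : Type) (s : seq I) K (F : I -> {poly R}) :
  Lam K (\sum_(i <- s) F i) = \sum_(i <- s) Lam K (F i).
Proof.
elim: s => [|i s IH]; last by rewrite !big_cons LamD IH.
by rewrite !big_nil /Lam big1// => k _; rewrite coef0 mul0r.
Qed.

Lemma LamKD K K' r : Lam (fun i l => K i l + K' i l) r = Lam K r + Lam K' r.
Proof.
rewrite /Lam -big_split/=; apply: eq_bigr => k _; rewrite -mulrDr -big_split/=.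
congr (_ * _); apply: eq_bigr => i _; rewrite -big_split/=.
by apply: eq_bigr => l _; rewrite mulrDl.
Qed.

Lemma LamKZ c K r : Lam (fun i l => c * K i l) r = c * Lam K r.
Proof.
rewrite /Lam mulr_sumr; apply: eq_bigr => k _; rewrite mulrCA; congr (_ * _).
rewrite mulr_sumr; apply: eq_bigr => i _; rewrite mulr_sumr.
by apply: eq_bigr => l _; rewrite mulrA.
Qed.

Lemma LamKB K K' r : Lam (fun i l => K i l - K' i l) r = Lam K r - Lam K' r.
Proof.
rewrite -mulN1r -LamKZ -LamKD; apply: eq_bigr => k _; congr (_ * _).
by apply: eq_bigr => i _; apply: eq_bigr => l _; rewrite mulN1r.
Qed.

(* p(Z) w_i, provided deg p <= N + 1. *)
Definition poly_act i (p : {poly R}) : V := \sum_(k < N.+2) p`_k *: W i k.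

Lemma actD i p q : poly_act i (p + q) = poly_act i p + poly_act i q.
Proof. by rewrite /poly_act -big_split/=; apply: eq_bigr => k _; rewrite coefD scalerDl. Qed.

Lemma actZ i c p : poly_act i (c *: p) = c *: poly_act i p.
Proof. by rewrite /poly_act scaler_sumr; apply: eq_bigr => k _; rewrite coefZ scalerA. Qed.

Lemma act_sum i (I : Type) (s : seq I) (F : I -> {poly R}) :
  poly_act i (\sum_(j <- s) F j) = \sum_(j <- s) poly_act i (F j).
Proof.
elim: s => [|j s IH]; last by rewrite !big_cons actD IH.
by rewrite !big_nil /poly_act big1// => k _; rewrite coef0 scale0r.
Qed.

Lemma actZr i (p : {poly R}) : (size p <= N.+1)%N -> Z (poly_act i p) (poly_act i ('X * p)).
Proof.
move=> sp; rewrite /poly_act big_ord_recr/= nth_default// scale0r addr0.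
rewrite [X in Z _ X]big_ord_recl coefXM eqxx scale0r add0r.
apply: Z_sum => k; rewrite coefXM/=.
by have := Z_lin p`_k (ZW i (ltnSE (ltn_ord k))) Z_0; rewrite !addr0.
Qed.

Let ell i l (r : {poly R}) := \sum_(k < (N.+1.*2).+1) r`_k * mom i l k.

Lemma act_ip i l (p q : {poly R}) : (size p <= N.+2)%N -> (size q <= N.+2)%N ->
  ip (poly_act i p) (poly_act l q) = ell i l (p * q).
Proof.
move=> sp sq.
have pE (r : {poly R}) : (size r <= N.+2)%N -> r = \sum_(k < N.+2) r`_k *: 'X^k.
  move=> sr; apply/polyP => k; rewrite coef_sum.
  have [kN|kN] := ltnP k N.+2.
    rewrite (bigD1 (Ordinal kN))//= coefZ coefXn eqxx mulr1 big1 ?addr0//.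
    move=> j /eqP jk; rewrite coefZ coefXn; case: eqP => [e|]; last by rewrite mulr0.
    by case: jk; apply/val_inj => /=.
  rewrite nth_default ?(leq_trans sr)// big1// => j _; rewrite coefZ coefXn.
  by rewrite gtn_eqF ?mulr0// (leq_trans (ltn_ord j)).
have ellD r r' : ell i l (r + r') = ell i l r + ell i l r'.
  by rewrite /ell -big_split/=; apply: eq_bigr => k _; rewrite coefD mulrDl.
have ellZ c r : ell i l (c *: r) = c * ell i l r.
  by rewrite /ell mulr_sumr; apply: eq_bigr => k _; rewrite coefZ mulrA.
have ell0 : ell i l 0 = 0 by rewrite /ell big1// => k _; rewrite coef0 mul0r.
have ell_sum (F : 'I_N.+2 -> {poly R}) : ell i l (\sum_k F k) = \sum_k ell i l (F k).
  by elim/big_rec2: _ => [//|k x y _ <-]; rewrite ellD.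
rewrite [in RHS](pE p sp) [in RHS](pE q sq) mulr_suml ell_sum /poly_act form_suml.
apply: eq_bigr => a _; rewrite mulr_sumr ell_sum ip_sym form_suml.
apply: eq_bigr => b _; rewrite -scalerAl -scalerAr -exprD !ellZ ipZ ip_sym ipZ mulrCA.
have lt : (a + b < N.+1.*2.+1)%N.
  by rewrite ltnS -addnn leq_add// -ltnS.
congr (_ * (_ * _)); rewrite momE ?(ltnSE (ltn_ord _))//.
rewrite /ell (bigD1 (Ordinal lt))//= coefXn eqxx mul1r big1 ?addr0//.
move=> k /eqP kl; rewrite coefXn; case: eqP => [e|]; last by rewrite mul0r.
by case: kl; apply/val_inj => /=.
Qed.

Lemma act_form (K : 'I_n -> 'I_n -> R) (p q : {poly R}) : (size p <= N.+2)%N -> (size q <= N.+2)%N ->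
  \sum_i \sum_l K i l * ip (poly_act i p) (poly_act l q) = Lam K (p * q).
Proof.
move=> sp sq; under eq_bigr do under eq_bigr do rewrite act_ip// /ell mulr_sumr.
under eq_bigr do rewrite exchange_big/=.
rewrite exchange_big/=; apply: eq_bigr => k _; rewrite mulr_sumr.
by apply: eq_bigr => i _; rewrite mulr_sumr; apply: eq_bigr => l _; rewrite mulrCA.
Qed.

(* The cross terms are dominated through K_jk + K_kj <= K_jj + K_kk. *)
Lemma dyadic_form_le (J : nat) (K : 'I_J -> 'I_J -> 'I_n -> 'I_n -> R)
    (K0 : 'I_n -> 'I_n -> R) (kap : 'I_J -> {poly R}) (r q : {poly R}) (s : R) :
  (forall j, cone (kap j)) -> cone r ->
  (forall j k, psd (fun i l => K j j i l + K k k i l - (K j k i l + K k j i l))) ->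
  (forall j, psd (fun i l => s * K0 i l - K j j i l)) ->
  psd K0 -> 0 <= s ->
  cone (q - r * (\sum_j kap j) ^+ 2) ->
  \sum_j \sum_k Lam (K j k) (r * (kap j * kap k)) <= s * Lam K0 q.
Proof.
move=> ck cr h1 h2 h3 s0 cq.
have cjk j k : cone (r * (kap j * kap k)) by apply: coneM => //; exact: coneM.
(* Doubling symmetrizes in j and k, which is possible since kap_j kap_k is symmetric; the hypothesis
   on the Gram matrices concerns K_jk + K_kj only. *)
have step1 : 2 * (\sum_j \sum_k Lam (K j k) (r * (kap j * kap k))) <=
     2 * \sum_j \sum_k Lam (K j j) (r * (kap j * kap k)).
  have -> : 2 * (\sum_j \sum_k Lam (K j k) (r * (kap j * kap k))) =
     \sum_j \sum_k (Lam (K j k) (r * (kap j * kap k)) + Lam (K k j) (r * (kap j * kap k))).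
    under [RHS]eq_bigr do rewrite big_split/=.
    rewrite big_split/= [X in _ = _ + X]exchange_big/= mulr2n mulrDl mul1r; congr (_ + _).
    by apply: eq_bigr => j _; apply: eq_bigr => k _; rewrite (mulrC (kap k)).
  have -> : 2 * (\sum_j \sum_k Lam (K j j) (r * (kap j * kap k))) =
     \sum_j \sum_k (Lam (K j j) (r * (kap j * kap k)) + Lam (K k k) (r * (kap j * kap k))).
    under [RHS]eq_bigr do rewrite big_split/=.
    rewrite big_split/= [X in _ = _ + X]exchange_big/= mulr2n mulrDl mul1r; congr (_ + _).
    by apply: eq_bigr => j _; apply: eq_bigr => k _; rewrite (mulrC (kap k)).
  apply: ler_sum => j _; apply: ler_sum => k _; rewrite -subr_ge0 -!LamKD -LamKB.
  exact: Lam_pos.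
have step2 : \sum_j \sum_k Lam (K j j) (r * (kap j * kap k)) <=
     \sum_j \sum_k s * Lam K0 (r * (kap j * kap k)).
  apply: ler_sum => j _; apply: ler_sum => k _; rewrite -subr_ge0 -LamKZ -LamKB.
  exact: Lam_pos.
apply: (@le_trans _ _ (\sum_j \sum_k s * Lam K0 (r * (kap j * kap k)))); first by lra.
have -> : \sum_j \sum_k s * Lam K0 (r * (kap j * kap k)) = s * Lam K0 (r * (\sum_j kap j) ^+ 2).
  rewrite expr2 mulr_suml mulr_sumr Lam_sum mulr_sumr; apply: eq_bigr => j _.
  by rewrite -mulr_sumr -Lam_sum -!mulr_sumr.
by apply: ler_wpM2l => //; rewrite -subr_ge0 -LamB; exact: Lam_pos.
Qed.

End moments.

(** * Polynomial estimates for the dyadic partition of unity *)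

Section dyadic_partition.
Context (R : realFieldType) (J : nat).
Implicit Types p q : {poly R}.

(* Polynomials in Z = X - 6. With rho_j = (1 + 4^-j X)^-1 and psi(s) = s^2 (3 - 2 s), the quotients
   polP j / polQ, polB j / polQ, polG j / polQ are psi(rho_j), beta_j = psi(rho_(j+1)) - psi(rho_j)
   and beta_j / X; the common denominator polQ makes all operators polynomial. *)
Definition polX : {poly R} := 'X + 6.
Definition polY (j : nat) : {poly R} := (4 ^- j)%:P * polX.
Definition polU j : {poly R} := 1 + polY j.
Definition polQ : {poly R} := \prod_(i < J.+1) polU i ^+ 3.
Definition polQi (j : nat) : {poly R} := \prod_(i < J.+1 | i != j :> nat) polU i ^+ 3.
Definition polQij (j : nat) : {poly R} :=
  \prod_(i < J.+1 | (i != j :> nat) && (i != j.+1 :> nat)) polU i ^+ 3.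
Definition polP j : {poly R} := (1 + 3 * polY j) * polQi j.
Definition polB j : {poly R} := polP j.+1 - polP j.
Definition polG j : {poly R} := (4 ^- j.+1)%:P *
  (polY j.+1 * (45 + 171 * polY j.+1 + 180 * polY j.+1 ^+ 2) * polQij j).
(** [polR j] / [polQ] is rho_j itself; the increments rho_(j+1) - rho_j serve as telescoping
    majorants below. *)
Definition polR j : {poly R} := polU j ^+ 2 * polQi j.

Lemma cone_nat k : cone (k%:R : {poly R}).
Proof. by rewrite -polyC_natr; exact: coneC. Qed.

Lemma cone_polX : cone polX.
Proof. by apply: coneD; [exact: coneX|exact: cone_nat]. Qed.

Lemma cone_polY j : cone (polY j).
Proof. by apply: coneM; [apply: coneC; rewrite invr_ge0 exprn_ge0|exact: cone_polX]. Qed.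

Let cone_polU j : cone (polU j).
Proof. by apply: coneD; [exact: cone1|exact: cone_polY]. Qed.

Lemma cone_polQi j : cone (polQi j).
Proof. by apply: cone_prod => i _; exact: cone_exp. Qed.

Let cone_polQij j : cone (polQij j).
Proof. by apply: cone_prod => i _; exact: cone_exp. Qed.

Lemma cone_polQ : cone polQ.
Proof. by apply: cone_prod => i _; exact: cone_exp. Qed.

Lemma polQ_polQi j : (j <= J)%N -> polQ = polU j ^+ 3 * polQi j.
Proof. by rewrite -ltnS => jJ; rewrite /polQ (bigD1 (Ordinal jJ)). Qed.

Let Qi_Qij j : (j < J)%N -> polQi j = polU j.+1 ^+ 3 * polQij j.
Proof.
rewrite -ltnS => jJ; rewrite /polQi (bigD1 (Ordinal jJ))/=; last by rewrite gtn_eqF.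
by congr (_ * _); apply: eq_bigl => i; rewrite -val_eqE.
Qed.

Let QiS_Qij j : (j < J)%N -> polQi j.+1 = polU j ^+ 3 * polQij j.
Proof.
rewrite -ltnS => jJ; rewrite /polQi (bigD1 (Ordinal (ltnW jJ)))/=; last by rewrite ltn_eqF.
by congr (_ * _); apply: eq_bigl => i; rewrite -val_eqE andbC.
Qed.

Let ypS j : polY j = 4 * polY j.+1.
Proof.
have -> : (4 : {poly R}) = (4 : R)%:P by rewrite polyC_natr.
rewrite /polY mulrA -polyCM; congr (_%:P * _).
by rewrite exprS; field; rewrite expf_neq0 ?pnatr_eq0.
Qed.

Let XypS j : (4 ^- j.+1)%:P * polX = polY j.+1.
Proof. by []. Qed.

(** The terms of order 0 and 1 in Y cancel because psi is flat at 1. The factor Y^2 gives the decay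
    for small Y; degree 4 against the degree 6 of the two removed cubes gives the decay for large
    Y. *)
Let bpE j : (j < J)%N -> polB j =
  polY j.+1 ^+ 2 * (45 + 171 * polY j.+1 + 180 * polY j.+1 ^+ 2) * polQij j.
Proof.
move=> jJ; rewrite /polB /polP QiS_Qij// Qi_Qij// /polU (ypS j).
by move: (polY j.+1) (polQij j) => y q; ring.
Qed.

Let rpD j : (j < J)%N ->
  polR j.+1 - polR j = 3 * polY j.+1 * (1 + 4 * polY j.+1) ^+ 2 * (1 + polY j.+1) ^+ 2 * polQij j.
Proof.
move=> jJ; rewrite /polR QiS_Qij// Qi_Qij// /polU (ypS j).
by move: (polY j.+1) (polQij j) => y q; ring.
Qed.

Lemma polX_polG j : (j < J)%N -> polX * polG j = polB j.
Proof.
by move=> jJ; rewrite bpE// /polG mulrCA mulrA XypS; move: (polY j.+1) (polQij j) => y q; ring.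
Qed.

Let cone_45 (y : {poly R}) : cone y -> cone (45 + 171 * y + 180 * y ^+ 2).
Proof.
move=> cy; apply: coneD; last by apply: coneM; [exact: cone_nat|exact: cone_exp].
by apply: coneD; [exact: cone_nat|apply: coneM => //; exact: cone_nat].
Qed.

Lemma cone_polG j : cone (polG j).
Proof.
apply: coneM; first by apply: coneC; rewrite invr_ge0 exprn_ge0.
by apply: coneM => //; apply: coneM; [exact: cone_polY|apply: cone_45; exact: cone_polY].
Qed.

Lemma cone_polB j : (j < J)%N -> cone (polB j).
Proof. by move=> jJ; rewrite -polX_polG//; apply: coneM; [exact: cone_polX|exact: cone_polG]. Qed.

Lemma sum_polB : \sum_(j < J) polB j = polP J - polP 0.
Proof. by rewrite -(big_mkord xpredT polB) /polB telescope_sumr. Qed.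

Let sum_rp : \sum_(j < J) (polR j.+1 - polR j) = polR J - polR 0.
Proof. by rewrite -(big_mkord xpredT (fun j => polR j.+1 - polR j)) telescope_sumr. Qed.

Let cone_polR j : cone (polR j).
Proof. by apply: coneM; [exact: cone_exp|exact: cone_polQi]. Qed.

Let polR_sub_le : cone (polQ - (polR J - polR 0)).
Proof.
have -> : polQ - (polR J - polR 0) = polY J * polU J ^+ 2 * polQi J + polR 0.
  by rewrite (polQ_polQi (leqnn J)) /polR /polU; ring.
apply: coneD => //; apply: coneM; last exact: cone_polQi.
by apply: coneM; [exact: cone_polY|exact: cone_exp].
Qed.

Let cone_sub_trans p q (r : {poly R}) : cone (q - p) -> cone (r - q) -> cone (r - p).
Proof.
by move=> h1 h2; rewrite (_ : r - p = (r - q) + (q - p)); [exact: coneD|ring].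
Qed.

Let cone_sub_sum (F G : 'I_J -> {poly R}) : (forall j, cone (G j - F j)) ->
  cone (\sum_j G j - \sum_j F j).
Proof. by move=> h; rewrite -sumrB; exact: cone_sum. Qed.

Lemma polQ_sub_polP j : (j <= J)%N -> polQ - polP j = polY j ^+ 2 * (3 + polY j) * polQi j.
Proof. by move=> jJ; rewrite (polQ_polQi jJ) /polP /polU; ring. Qed.

Lemma cone_polQ_sub_polP j : (j <= J)%N -> cone (polQ - polP j).
Proof.
move=> jJ; rewrite polQ_sub_polP//; apply: coneM; last exact: cone_polQi.
apply: coneM; first by apply: cone_exp; exact: cone_polY.
by apply: coneD; [exact: cone_nat|exact: cone_polY].
Qed.

Lemma cone_polP j : cone (polP j).
Proof.
apply: coneM; last exact: cone_polQi; apply: coneD; first exact: cone1.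
by apply: coneM; [exact: cone_nat|exact: cone_polY].
Qed.

Lemma sum_polB_le : cone (polQ - \sum_(j < J) polB j).
Proof.
rewrite sum_polB; have -> : polQ - (polP J - polP 0) = (polQ - polP J) + polP 0 by ring.
by apply: coneD; [exact: cone_polQ_sub_polP|exact: cone_polP].
Qed.

(** Termwise, 4^j beta_j / X <= 4 (rho_(j+1) - rho_j), and the right-hand sides telescope to at most
    4. At lowest order in Y the comparison reads 45/4 <= 4 * 3. *)
Lemma sum_polG4_le : cone (4 * polQ - \sum_(j < J) (4 ^+ j)%:P * polG j).
Proof.
apply: (cone_sub_trans (q := 4 * \sum_(j < J) (polR j.+1 - polR j))); last first.
  by rewrite sum_rp -mulrBr; apply: coneM => //; exact: cone_nat.
rewrite mulr_sumr; apply: cone_sub_sum => j.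
have cy : cone (polY j.+1) by exact: cone_polY.
have -> : (4 ^+ j)%:P * polG j = (4 ^+ j / 4 ^+ j.+1)%:P *
    (polY j.+1 * (45 + 171 * polY j.+1 + 180 * polY j.+1 ^+ 2) * polQij j).
  by rewrite /polG mulrA -polyCM.
rewrite rpD//.
have -> : 4 ^+ j / 4 ^+ j.+1 = 4^-1 :> R.
  by rewrite exprS; field; rewrite expf_neq0 ?pnatr_eq0.
move: (polY j.+1) cy (polQij j) (cone_polQij j) => y cy q cq.
have -> : 4 * (3 * y * (1 + 4 * y) ^+ 2 * (1 + y) ^+ 2 * q) -
    (4^-1)%:P * (y * (45 + 171 * y + 180 * y ^+ 2) * q) =
  (4^-1)%:P * ((3 + 309 * y + 1404 * y ^+ 2 + 1920 * y ^+ 3 + 768 * y ^+ 4) * y * q).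
  have e4 : (4^-1 : R)%:P * (4 : {poly R}) = 1.
    have -> : (4 : {poly R}) = (4 : R)%:P by rewrite polyC_natr.
    by rewrite -polyCM mulVf ?pnatr_eq0.
  have E (t : {poly R}) : 4 * t = (4^-1)%:P * (4 * (4 * t)) by rewrite [RHS]mulrA e4 mul1r.
  by rewrite E; move: (4^-1)%:P => z; ring.
apply: coneM; first by apply: coneC; rewrite invr_ge0.
apply: coneM => //; apply: coneM => //.
do 4! (apply: coneD; last by apply: coneM; [exact: cone_nat|try exact: cone_exp]).
exact: cone_nat.
Qed.

(** Termwise comparison with 15 (rho_(j+1) - rho_j). The constant 15 is the least that works: the
    leading terms, 15 * 3 * 16 and 4 * 180, cancel exactly. *)
Lemma sum_polB4_le : cone (15 * polQ - \sum_(j < J) (4 ^- j)%:P * (polX * polB j)).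
Proof.
apply: (cone_sub_trans (q := 15 * \sum_(j < J) (polR j.+1 - polR j))); last first.
  by rewrite sum_rp -mulrBr; apply: coneM => //; exact: cone_nat.
rewrite mulr_sumr; apply: cone_sub_sum => j.
have cy : cone (polY j.+1) by exact: cone_polY.
have -> : (4 ^- j)%:P * (polX * polB j) = polY j * polB j by rewrite mulrA.
rewrite rpD// bpE// (ypS j).
move: (polY j.+1) cy (polQij j) (cone_polQij j) => y cy q cq.
have -> : 15 * (3 * y * (1 + 4 * y) ^+ 2 * (1 + y) ^+ 2 * q) -
    4 * y * (y ^+ 2 * (45 + 171 * y + 180 * y ^+ 2) * q) =
  (45 + 450 * y + 1305 * y ^+ 2 + 1116 * y ^+ 3) * y * q by ring.
apply: coneM => //; apply: coneM => //.
do 3! (apply: coneD; last by apply: coneM; [exact: cone_nat|try exact: cone_exp]).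
exact: cone_nat.
Qed.

Let cone_sqr p q : cone p -> cone q -> cone (q - p) -> cone (q ^+ 2 - p ^+ 2).
Proof.
move=> cp cq h; have -> : q ^+ 2 - p ^+ 2 = (q - p) * (q + p) by ring.
by apply: coneM => //; exact: coneD.
Qed.

Lemma sum_polB_sqr_le : cone (polQ ^+ 2 - (\sum_(j < J) polB j) ^+ 2).
Proof.
apply: cone_sqr; [|exact: cone_polQ|exact: sum_polB_le].
by apply: cone_sum => j _; exact: cone_polB.
Qed.

(** This controls d_tt g, where the 4^j of two time derivatives meets beta_j / X. *)
Lemma sum_polG4_sqr_le : cone ((4 * polQ) ^+ 2 - (\sum_(j < J) (4 ^+ j)%:P * polG j) ^+ 2).
Proof.
apply: cone_sqr; [| |exact: sum_polG4_le].
  apply: cone_sum => j _; apply: coneM; [|exact: cone_polG].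
  by apply: coneC; rewrite exprn_ge0.
by apply: coneM; [exact: cone_nat|exact: cone_polQ].
Qed.

(* Cauchy-Schwarz: the difference is half the sum of
   [f j * f k * (w j - w k) ^+ 2]. *)
Let cone_cauchy (f : 'I_J -> {poly R}) (w : 'I_J -> R) : (forall j, cone (f j)) ->
  cone ((\sum_j f j) * (\sum_j (w j ^+ 2)%:P * f j) - (\sum_j (w j)%:P * f j) ^+ 2).
Proof.
move=> cf.
have -> : (\sum_j f j) * (\sum_j (w j ^+ 2)%:P * f j) - (\sum_j (w j)%:P * f j) ^+ 2 =
    (2^-1)%:P * \sum_j \sum_k f j * f k * ((w j - w k) ^+ 2)%:P.
  have -> : \sum_j \sum_k f j * f k * ((w j - w k) ^+ 2)%:P =
     \sum_j \sum_k (((w j ^+ 2)%:P * f j) * f k) + \sum_j \sum_k (f j * ((w k ^+ 2)%:P * f k))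
     - 2 * (\sum_j \sum_k ((w j)%:P * f j) * ((w k)%:P * f k)).
    rewrite mulr_sumr -big_split -sumrB/=; apply: eq_bigr => j _.
    rewrite mulr_sumr -big_split -sumrB/=; apply: eq_bigr => k _.
    by rewrite !rmorphXn/= rmorphB/=; ring.
  have prodE (a b : 'I_J -> {poly R}) : \sum_j \sum_k a j * b k = (\sum_j a j) * (\sum_k b k).
    by rewrite mulr_suml; apply: eq_bigr => j _; rewrite mulr_sumr.
  rewrite !prodE.
  have e2 : (2^-1 : R)%:P * (2 : {poly R}) = 1.
    have -> : (2 : {poly R}) = (2 : R)%:P by rewrite polyC_natr.
    by rewrite -polyCM mulVf ?pnatr_eq0.
  move: (\sum_j _) (\sum_j (w j ^+ 2)%:P * f j) (\sum_j f j) => x y z.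
  have -> : (2^-1)%:P * (y * z + z * y - 2 * (x * x)) = ((2^-1)%:P * 2) * (y * z - x * x) by ring.
  by rewrite e2; ring.
apply: coneM; first by apply: coneC; rewrite invr_ge0.
apply: cone_sum => j _; apply: cone_sum => k _; apply: coneM; first exact: coneM.
by apply: coneC; exact: sqr_ge0.
Qed.

(** This controls the energy of d_t g. By Cauchy-Schwarz the square of the sum of the 2^j G_j is at
    most the sum of the G_j times the sum of the 4^j G_j; the factor X turns the first sum into that
    of the B_j, at most Q, and the second is at most 4 Q. *)
Lemma sum_polG2_sqr_le : cone (4 * polQ ^+ 2 - polX * (\sum_(j < J) (2 ^+ j)%:P * polG j) ^+ 2).
Proof.
have E : \sum_(j < J) polB j = polX * \sum_(j < J) polG j.
  by rewrite mulr_sumr; apply: eq_bigr => j _; rewrite polX_polG.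
have h := @cone_cauchy (fun j => polG j) (fun j => 2 ^+ j) (fun j => cone_polG j).
have E4 : \sum_(j < J) ((2 ^+ j) ^+ 2)%:P * polG j = \sum_(j < J) (4 ^+ j)%:P * polG j.
  apply: eq_bigr => j _; congr (_%:P * _).
  by rewrite -exprM mulnC exprM; congr (_ ^+ _); rewrite -natrX.
rewrite E4 in h; set A := \sum_(j < J) (4 ^+ j)%:P * polG j in h *.
apply: (cone_sub_trans (q := (\sum_(j < J) polB j) * A)).
  by rewrite E -mulrA -mulrBr; apply: coneM => //; exact: cone_polX.
have -> : 4 * polQ ^+ 2 - (\sum_(j < J) polB j) * A =
   (4 * polQ - A) * polQ + A * (polQ - \sum_(j < J) polB j) by ring.
apply: coneD; first by apply: coneM; [exact: sum_polG4_le|exact: cone_polQ].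
apply: coneM; last exact: sum_polB_le.
by apply: cone_sum => j _; apply: coneM; [apply: coneC; rewrite exprn_ge0|exact: cone_polG].
Qed.

(** The counterpart for the energy of h: Cauchy-Schwarz with weights 2^-j, where X now goes to the
    sum with weights 4^-j. *)
Lemma sum_polB2_sqr_le : cone (15 * polQ ^+ 2 - polX * (\sum_(j < J) (2 ^- j)%:P * polB j) ^+ 2).
Proof.
have h := @cone_cauchy (fun j => polB j) (fun j => 2 ^- j) (fun j => cone_polB (ltn_ord j)).
have E4 : polX * (\sum_(j < J) ((2 ^- j) ^+ 2)%:P * polB j) = \sum_(j < J) (4 ^- j)%:P * (polX * polB j).
  rewrite mulr_sumr; apply: eq_bigr => j _; rewrite mulrCA; congr (_%:P * _).
  by rewrite exprVn -exprM mulnC exprM; congr (_ ^- _); rewrite -natrX.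
set A := \sum_(j < J) (4 ^- j)%:P * (polX * polB j) in E4.
apply: (cone_sub_trans (q := (\sum_(j < J) polB j) * A)).
  by rewrite -E4 mulrCA -mulrBr; apply: coneM => //; exact: cone_polX.
have -> : 15 * polQ ^+ 2 - (\sum_(j < J) polB j) * A =
   (15 * polQ - A) * polQ + A * (polQ - \sum_(j < J) polB j) by ring.
apply: coneD; first by apply: coneM; [exact: sum_polB4_le|exact: cone_polQ].
apply: coneM; last exact: sum_polB_le.
apply: cone_sum => j _; apply: coneM; first by apply: coneC; rewrite invr_ge0 exprn_ge0.
by apply: coneM; [exact: cone_polX|exact: cone_polB].
Qed.

(** The place where the shift by 6 counts: after removal of a common factor, Q - 8 P_0 is (7 + Z)^3
    - 8 (19 + 3 Z), whose coefficients are nonnegative. *)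
Lemma polP0_sqr_le : cone (polQ ^+ 2 - 64 * polP 0 ^+ 2).
Proof.
have -> : 64 * polP 0 ^+ 2 = (8 * polP 0) ^+ 2 by ring.
apply: cone_sqr; [by apply: coneM; [exact: cone_nat|exact: cone_polP]|exact: cone_polQ|].
have y0 : polY 0 = polX by rewrite /polY expr0 invr1 mul1r.
have -> : polQ - 8 * polP 0 = (191 + 123 * 'X + 21 * 'X ^+ 2 + 'X ^+ 3) * polQi 0.
  by rewrite (polQ_polQi (leq0n J)) /polP /polU y0 /polX; move: (polQi 0) => q; ring.
apply: coneM; last exact: cone_polQi.
apply: coneD; last by apply: cone_exp; exact: coneX.
do 2! (apply: coneD; last by apply: coneM; [exact: cone_nat|try apply: cone_exp; exact: coneX]).
exact: cone_nat.
Qed.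

(** The high-frequency remainder satisfies 1 - psi(rho_J) <= 3 4^-J X. It is small as J grows only
    on a fixed F in the domain, since X F appears on the right. *)
Lemma polQ_polP_sqr_le : cone ((3 * (4 ^- J)%:P * polX * polQ) ^+ 2 - (polQ - polP J) ^+ 2).
Proof.
have E : 3 * (4 ^- J)%:P * polX * polQ = 3 * polY J * polQ by rewrite -!mulrA.
apply: cone_sqr; [exact: cone_polQ_sub_polP| |].
  by rewrite E; apply: coneM; [apply: coneM; [exact: cone_nat|exact: cone_polY]|exact: cone_polQ].
rewrite E polQ_sub_polP// (polQ_polQi (leqnn J)) /polU.
have -> : 3 * polY J * ((1 + polY J) ^+ 3 * polQi J) - polY J ^+ 2 * (3 + polY J) * polQi J =
  polY J * (3 + 6 * polY J + 8 * polY J ^+ 2 + 3 * polY J ^+ 3) * polQi J by ring.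
have cy := cone_polY J.
apply: coneM; last exact: cone_polQi; apply: coneM => //.
do 3! (apply: coneD; last by apply: coneM; [exact: cone_nat|try exact: cone_exp]).
exact: cone_nat.
Qed.

Let size_polU j : (size (polU j) <= 2)%N.
Proof.
rewrite /polU /polY /polX; apply: leq_trans (size_polyD _ _) _; rewrite geq_max size_poly1/=.
apply: leq_trans (size_polyMleq _ _) _.
have h1 := size_polyC_leq1 (4 ^- j : R).
have h2 : (size ('X + 6 : {poly R})%R <= 2)%N.
  by rewrite -[6]polyC_natr size_XaddC.
by move: h1 h2; case: (size _) => [|[|]]//; case: (size _) => [|[|[|]]].
Qed.

Lemma size_prod_polU (P : pred 'I_J.+1) :
  (size (\prod_(i < J.+1 | P i) polU i ^+ 3)%R <= (3 * #|P|).+1)%N.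
Proof.
apply: leq_trans (size_poly_prod_leq _ _) _.
have : (\sum_(i | P i) size (polU i ^+ 3) <= \sum_(i | P i) 4)%N.
  apply: leq_sum => i _; apply: leq_trans (size_poly_exp_leq _ _) _.
  by have := size_polU i; lia.
have -> : (\sum_(i < J.+1 | P i) 4 = 4 * #|P|)%N.
  by rewrite -sum1_card big_distrr/=; apply: eq_bigr => i _; rewrite muln1.
by move: (\sum_(i < J.+1 | P i) _)%N #|P| => a c; lia.
Qed.

Lemma size_polQ : (size polQ <= (3 * J.+1).+1)%N.
Proof. by apply: leq_trans (size_prod_polU xpredT) _; rewrite card_ord. Qed.

Lemma size_polP j : (j <= J)%N -> (size (polP j) <= 3 * J.+1)%N.
Proof.
move=> jJ; rewrite /polP; apply: leq_trans (size_polyMleq _ _) _.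
have h1 : (size (1 + 3 * polY j)%R <= 2)%N.
  apply: leq_trans (size_polyD _ _) _; rewrite geq_max size_poly1/=.
  have -> : 3 * polY j = (3 * 4 ^- j)%:P * ('X + 6%:P).
    by rewrite /polY /polX mulrA polyCM !polyC_natr.
  apply: leq_trans (size_polyMleq _ _) _; rewrite size_XaddC.
  by have := size_polyC_leq1 (3 * 4 ^- j : R); case: (size _) => [|[|]].
have h2 := size_prod_polU (fun i => i != j :> nat).
rewrite -/(polQi j) in h2.
have h3 : #|(fun i : 'I_J.+1 => i != j :> nat)| = J.
  have jJ' : (j < J.+1)%N by [].
  rewrite -[RHS]/(J.+1.-1) -[J.+1 in RHS]card_ord -(cardC1 (Ordinal jJ')).
  by apply: eq_card => i; rewrite !inE -val_eqE.
by rewrite h3 in h2; lia.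
Qed.

Lemma size_polB j : (j < J)%N -> (size (polB j) <= 3 * J.+1)%N.
Proof.
move=> jJ; rewrite /polB; apply: leq_trans (size_polyD _ _) _.
by rewrite geq_max size_polyN !size_polP// ltnW.
Qed.

Lemma size_polG j : (j < J)%N -> (size (polG j) <= 3 * J.+1)%N.
Proof.
move=> jJ; have [->|g0] := eqVneq (polG j) 0; first by rewrite size_poly0.
have := size_polB jJ; rewrite -polX_polG// size_monicM//.
  have -> : size polX = 2%N by rewrite /polX -[6]polyC_natr size_XaddC.
  by lia.
by rewrite /polX -[6]polyC_natr monicXaddC.
Qed.

End dyadic_partition.

(** * Smooth functions of time *)

Section smooth1.
Context (R : realType).
Implicit Types f g : R -> R.

Fixpoint Cn k f : Prop :=
  match k with
  | 0%N => continuous f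
  | k'.+1 => (forall t, derivable f t 1) /\ Cn k' (derive1 f)
  end.

Definition smooth f := forall k, Cn k f.

Lemma Cn_intro k f f' : (forall t, is_derive t (1 : R) f (f' t)) -> Cn k f' -> Cn k.+1 f.
Proof.
move=> h hf; split; first by move=> t; have [] := h t.
suff -> : (derive1 f) = f' by [].
by apply/funext => t; rewrite derive1E; have [_ ->] := h t.
Qed.

Lemma Cn_is_derive k f t : Cn k.+1 f -> is_derive t (1 : R) f ((derive1 f) t).
Proof. by move=> [h _]; rewrite derive1E; apply: derivableP. Qed.

Lemma Cn_S k f : Cn k.+1 f -> Cn k f.
Proof.
elim: k f => [|k IH] f [h hf]; last by split => //; exact: IH.
by move=> t; apply: differentiable_continuous; exact/derivable1_diffP.
Qed.

Lemma Cn_continuous k f : Cn k f -> continuous f.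
Proof. by elim: k f => [//|k IH] f /Cn_S /IH. Qed.

Lemma Cn_D k f g : Cn k f -> Cn k g -> Cn k (fun t => f t + g t).
Proof.
elim: k f g => [|k IH] f g hf hg.
  by move=> t; apply: cvgD; [exact: hf|exact: hg].
apply: (@Cn_intro _ _ (fun t => (derive1 f) t + (derive1 g) t)); last by apply: IH; [case: hf|case: hg].
by move=> t; exact: (is_deriveD (Cn_is_derive t hf) (Cn_is_derive t hg)).
Qed.

Lemma Cn_cst k c : Cn k (fun=> c).
Proof.
elim: k c => [|k IH] c; first by move=> t; exact: cvg_cst.
by apply: (@Cn_intro _ _ (fun=> 0)).
Qed.

Lemma Cn_M k f g : Cn k f -> Cn k g -> Cn k (fun t => f t * g t).
Proof.
elim: k f g => [|k IH] f g hf hg.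
  by move=> t; apply: cvgM; [exact: hf|exact: hg].
apply: (@Cn_intro _ _ (fun t => f t * (derive1 g) t + g t * (derive1 f) t)); last first.
  apply: Cn_D; apply: IH; [exact: Cn_S|by case: hg|exact: Cn_S|by case: hf].
by move=> t; exact: (is_deriveM (Cn_is_derive t hf) (Cn_is_derive t hg)).
Qed.

Lemma Cn_Z k a f : Cn k f -> Cn k (fun t => a * f t).
Proof. by move=> hf; apply: Cn_M => //; exact: Cn_cst. Qed.

Lemma Cn_sum k n (F : 'I_n -> R -> R) : (forall i, Cn k (F i)) ->
  Cn k (fun t => \sum_(i < n) F i t).
Proof.
elim: n F => [|n IH] F h.
  by under eq_fun do rewrite big_ord0; exact: Cn_cst.
by under eq_fun do rewrite big_ord_recl; apply: Cn_D => //; exact: IH.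
Qed.

Lemma is_derive_affine (a b t : R) : is_derive t (1 : R) (fun t : R => a * t + b) a.
Proof.
have h1 := @is_deriveM R R (fun=> a) (fun x => x) t 1 0 1 (is_derive_cst _ _ _) (is_derive_id _ _).
have h2 := is_deriveD h1 (is_derive_cst b t 1).
by refine (is_derive_eq h2 _); rewrite -![_ *: _]/(_ * _); ring.
Qed.

Lemma Cn_affine k f a b : Cn k f -> Cn k (fun t => f (a * t + b)).
Proof.
elim: k f => [|k IH] f hf.
  move=> t; apply: (@continuous_comp _ _ _ (fun t => a * t + b) f); last exact: hf.
  by have [/derivable1_diffP /differentiable_continuous] := is_derive_affine a b t.
apply: (@Cn_intro _ _ (fun t => a * (derive1 f) (a * t + b))); last first.
  by apply: Cn_Z; apply: IH; case: hf.
move=> t; have h := @is_derive1_comp R f (fun t => a * t + b) t _ _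
  (Cn_is_derive (a * t + b) hf) (is_derive_affine a b t).
by refine (is_derive_eq h _); rewrite mulrC.
Qed.

Lemma smoothD f g : smooth f -> smooth g -> smooth (fun t => f t + g t).
Proof. by move=> h1 h2 k; exact: Cn_D. Qed.

Lemma smoothZ a f : smooth f -> smooth (fun t => a * f t).
Proof. by move=> h1 k; exact: Cn_Z. Qed.

Lemma smooth_cst c : smooth (fun=> c).
Proof. by move=> k; exact: Cn_cst. Qed.

Lemma smooth_affine f a b : smooth f -> smooth (fun t => f (a * t + b)).
Proof. by move=> h1 k; exact: Cn_affine. Qed.

Lemma smooth_sum n (F : 'I_n -> R -> R) : (forall i, smooth (F i)) ->
  smooth (fun t => \sum_(i < n) F i t).
Proof. by move=> h k; apply: Cn_sum => i; exact: h. Qed.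

Lemma smooth_derive f : smooth f -> smooth (derive1 f).
Proof. by move=> h k; have [] := h k.+1. Qed.

Lemma smooth_is_derive f t : smooth f -> is_derive t (1 : R) f ((derive1 f) t).
Proof. by move=> h; exact: (Cn_is_derive t (h 1%N)). Qed.

Lemma smooth_continuous f : smooth f -> continuous f.
Proof. by move=> h; exact: (h 0%N). Qed.

Lemma smooth_intro f f' : (forall t, is_derive t (1 : R) f (f' t)) -> smooth f' -> smooth f.
Proof.
move=> h hf [|k]; last exact: (Cn_intro h).
by apply: (@Cn_continuous 1); exact: Cn_intro h (hf 0%N).
Qed.

Lemma derive1_is_derive f f' : (forall t, is_derive t (1 : R) f (f' t)) -> (derive1 f) = f'.
Proof. by move=> h; apply/funext => t; rewrite derive1E; have [_ ->] := h t. Qed.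

(** From exp(x) >= 1 + x >= x at x = u / n one gets u^n <= n^n exp(u). *)
Lemma expR_dominates n : exists2 C : R, 0 <= C & forall u, 0 < u -> u ^+ n * expR (- u) <= C.
Proof.
case: n => [|n].
  exists 1 => // u u0; rewrite expr0 mul1r -[leRHS]expR0 ler_expR; lra.
exists (n.+1%:R ^+ n.+1); first by rewrite exprn_ge0.
move=> u u0; rewrite expRN ler_pdivrMr ?expR_gt0//.
have n0 : 0 < n.+1%:R :> R by rewrite ltr0n.
have -> : u = n.+1%:R * (u / n.+1%:R) by field; rewrite gt_eqF.
rewrite expRM_natl exprMn ler_wpM2l ?exprn_ge0//.
apply: lerXn2r; rewrite ?nnegrE ?expR_ge0 ?(divr_ge0 (ltW u0))//.
by move: (u / n.+1%:R) => x; have := expR_ge1Dx x; lra.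
Qed.

Lemma poly_expR_dominates (p : {poly R}) n :
  exists2 C : R, 0 <= C & forall u, 0 < u -> `|p.[u]| * u ^+ n * expR (- u) <= C.
Proof.
elim/poly_ind: p n => [|p c IH] n.
  by exists 0 => // u u0; rewrite horner0 normr0 !mul0r.
have [C1 C10 h1] := IH n.+1; have [C2 C20 h2] := expR_dominates n.
exists (C1 + `|c| * C2); first by rewrite addr_ge0 ?mulr_ge0.
move=> u u0; rewrite hornerMXaddC.
apply: (@le_trans _ _ ((`|p.[u]| * u + `|c|) * u ^+ n * expR (- u))).
  apply: ler_wpM2r; first exact: expR_ge0.
  apply: ler_wpM2r; first by rewrite exprn_ge0 ?ltW.
  by apply: le_trans (ler_normD _ _) _; rewrite normrM (ger0_norm (ltW u0)).
rewrite !mulrDl lerD//; last by rewrite -mulrA ler_wpM2l// h2.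
by apply: le_trans (h1 u u0); rewrite exprS !mulrA.
Qed.

(* The family p(1/t) exp(-1/t) is stable under differentiation, which gives smoothness at 0. *)
Definition flat (p : {poly R}) (t : R) : R :=
  if 0 < t then p.[t^-1] * expR (- t^-1) else 0.

Let flat_deriv (p : {poly R}) : {poly R} := 'X^2 * (p - p^`()).

Lemma is_derive_quadratic f C : f 0 = 0 -> (forall h, `|f h| <= C * h ^+ 2) ->
  is_derive (0 : R) (1 : R) f 0.
Proof.
move=> f0 fC.
have h : (fun h : R => h^-1 *: ((f \o shift 0) (h *: (1 : R)) - f 0)) @ 0^' --> (0 : R).
  have C0 : 0 <= C.
    by have := fC 1; rewrite expr1n mulr1; apply: le_trans.
  apply/cvgrPdist_le => e e0; near=> h.
  have h0 : h != 0 by near: h; exact: nbhs_dnbhs_neq.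
  rewrite sub0r normrN /= addr0 f0 subr0 -[h *: 1]/(h * 1) mulr1.
  rewrite normrZ normfV ler_pdivrMl ?normr_gt0//.
  apply: le_trans (fC h) _; rewrite -real_normK ?num_real// expr2 mulrCA.
  apply: ler_wpM2l => //.
  have hl : `|h| <= e / (C + 1).
    near: h; apply: dnbhs0_le; rewrite divr_gt0// ltr_wpDl//.
  apply: (@le_trans _ _ ((C + 1) * `|h|)); first by apply: ler_wpM2r => //; lra.
  by rewrite mulrC -ler_pdivlMr// ltr_wpDl.
by split; [apply/cvg_ex; exists 0|exact: cvg_lim h].
Unshelve. all: by end_near. Qed.

Lemma flat_is_derive p t : is_derive t (1 : R) (flat p) (flat (flat_deriv p) t).
Proof.
have [t0|] := ltP 0 t.
  have e1 : \forall s \near t, p.[s^-1] * expR (- s^-1) = flat p s.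
    near=> s; rewrite /flat ifT//; near: s; exact: lt_nbhsr.
  have iv : is_derive t (1 : R) (fun s : R => s^-1) (- t ^- 2).
    have h := @is_deriveV R id t 1 1 (lt0r_neq0 t0) (is_derive_id _ _).
    by refine (is_derive_eq h _); rewrite -![_ *: _]/(_ * _) mulr1.
  have d1 := is_derive1_comp (is_derive_poly p t^-1) iv.
  have d2 := @is_derive1_comp R (@expR R) (- (fun s => s^-1)) t _ _
    (is_derive_expR (- t^-1)) (is_deriveN iv).
  have d3 := is_deriveM d1 d2.
  apply: (near_eq_is_derive e1).
  refine (is_derive_eq d3 _).
  rewrite /flat t0 /flat_deriv hornerM hornerXn hornerD hornerN -![_ *: _]/(_ * _) /=.
  by rewrite exprVn; ring.
rewrite le_eqVlt => /predU1P[->|t0].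
  (* The exponent 2, at u = 1 / h, gives |flat p h| <= C h^2, hence derivative 0 at the origin. *)
  have [C C0 hC] := poly_expR_dominates p 2.
  have -> : flat (flat_deriv p) 0 = 0 by rewrite /flat ltxx.
  apply: (@is_derive_quadratic _ C); first by rewrite /flat ltxx.
  move=> h; rewrite /flat; case: ifPn => [h0|_]; last by rewrite normr0 mulr_ge0// sqr_ge0.
  have := hC h^-1; rewrite invr_gt0 => /(_ h0) hh.
  rewrite normrM (ger0_norm (expR_ge0 _)).
  have hh0 : 0 < h ^+ 2 by rewrite exprn_gt0.
  by rewrite -ler_pdivrMr//; apply: le_trans hh; rewrite -exprVn mulrAC.
have e1 : \forall s \near t, 0 = flat p s.
  near=> s; rewrite /flat ifF//; apply/negbTE; rewrite -leNgt ltW//; near: s.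
  exact: lt_nbhsl.
apply: (near_eq_is_derive e1).
by apply: is_derive_eq; rewrite /flat ifF//; apply/negbTE; rewrite -leNgt ltW.
Unshelve. all: by end_near. Qed.

Lemma smooth_flat p : smooth (flat p).
Proof.
move=> k; elim: k p => [|k IH] p; last by apply: (Cn_intro (flat_is_derive p)).
move=> t; have [/derivable1_diffP /differentiable_continuous] := flat_is_derive p t.
by [].
Qed.

Definition bump (t : R) : R := flat 1 t * flat 1 (-1 * t + 1).

Lemma smooth_bump : smooth bump.
Proof.
by move=> k; apply: Cn_M; [exact: smooth_flat|apply: Cn_affine; exact: smooth_flat].
Qed.

Lemma bump_gt0 t : 0 < t < 1 -> 0 < bump t.
Proof.
move=> /andP[t0 t1]; rewrite /bump /flat t0 ifT; last by lra.
by rewrite -[1 : {poly R}]/(1%:P) !hornerC !mul1r mulr_gt0// expR_gt0.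
Qed.

Lemma bump_eq0 t : ~~ (0 < t < 1) -> bump t = 0.
Proof.
rewrite negb_and -!leNgt => /orP[t0|t1]; rewrite /bump /flat.
  by rewrite ltNge t0 mul0r.
by rewrite [X in _ * X]ifF ?mulr0//; apply/negbTE; rewrite -leNgt; lra.
Qed.

Lemma bump_ge0 t : 0 <= bump t.
Proof.
by have [/bump_gt0/ltW//|/bump_eq0 ->] := boolP (0 < t < 1).
Qed.

Lemma is_derive_continuous F f : (forall t, is_derive t (1 : R) F (f t)) -> continuous F.
Proof. by move=> h t; have [/derivable1_diffP /differentiable_continuous] := h t. Qed.

Lemma is_derive_ndecr F f a b : (forall t, is_derive t (1 : R) F (f t)) -> a <= b ->
  (forall t, a <= t <= b -> 0 <= f t) -> F a <= F b.
Proof.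
move=> dF ab f0.
have [c cab e] := MVT_segment ab (fun x _ => dF x)
  (continuous_subspaceT (is_derive_continuous dF)).
rewrite -subr_ge0 e mulr_ge0 ?subr_ge0//; apply: f0.
by move: cab; rewrite in_itv.
Qed.

Definition prim f (t : R) : R :=
  if 0 <= t then \int[lebesgue_measure]_(s in `[0, t]) f s
  else - \int[lebesgue_measure]_(s in `[t, 0]) f s.

Lemma prim_is_derive f t : continuous f -> is_derive t (1 : R) (prim f) (f t).
Proof.
move=> cf; pose M := `|t| + 1.
have tM : - M < t < M.
  by rewrite -ltr_norml /M ltrDl.
have M0 : 0 < M by rewrite /M ltr_wpDl.
have fi a b : lebesgue_measure.-integrable `[a, b] (EFin \o f).
  by apply: continuous_compact_integrable; [exact: segment_compact|exact: continuous_subspaceT].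
(* The fundamental theorem needs t inside the interval of integration, so the base point is moved
   from 0 to - M; near t this changes the primitive by a constant. *)
pose G s := \int[lebesgue_measure]_(r in `[- M, s]) f r.
have GE : \forall s \near t, G s - G 0 = prim f s.
  near=> s.
  have sM : - M < s < M.
    apply/andP; split; near: s.
      by apply: lt_nbhsr; case/andP: tM.
    by apply: lt_nbhsl; case/andP: tM.
  case/andP: sM => sM1 sM2.
  rewrite /prim /G; case: ifPn => [s0|]; last rewrite -ltNge => s0.
    rewrite Rintegral_itvB ?bnd_simp//; last lra.
    by rewrite Rintegral_itv_obnd_cbnd//; apply: integrableS (fi 0 s) => //; exact: subset_itv_oc_cc.
  rewrite -opprB Rintegral_itvB ?bnd_simp//; [|lra|lra].
  by rewrite Rintegral_itv_obnd_cbnd//; apply: integrableS (fi s 0) => //; exact: subset_itv_oc_cc.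
have [tM1 tM2] := andP tM.
have [dG eG] := @continuous_FTC1_closed R f (- M) t M tM2 (fi _ _) tM1 (cf t).
have iG : is_derive t (1 : R) G (f t).
  by rewrite -eG derive1E; exact: derivableP.
apply: (near_eq_is_derive GE).
refine (is_derive_eq (is_deriveB iG (is_derive_cst (G 0) t 1)) _).
by rewrite subr0.
Unshelve. all: by end_near. Qed.

Definition intg f a b := prim f b - prim f a.

Lemma intgE f F a b : (forall t, is_derive t (1 : R) F (f t)) -> continuous f ->
  intg f a b = F b - F a.
Proof.
move=> dF cf.
have d t : is_derive t (1 : R) (fun s => prim f s - F s) 0.
  by refine (is_derive_eq (is_deriveB (prim_is_derive t cf) (dF t)) _); rewrite subrr.
have key x y : x <= y -> prim f x - F x = prim f y - F y.
  move=> xy; apply/eqP; rewrite eq_le (is_derive_ndecr d)//=.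
  rewrite -lerN2; apply: (@is_derive_ndecr (fun s => - (prim f s - F s)) (fun=> 0)) => // t.
  by refine (is_derive_eq (is_deriveN (d t)) _); rewrite oppr0.
rewrite /intg; have [ab|/ltW ab] := leP a b; have := key _ _ ab; lra.
Qed.

Lemma intgxx f a : intg f a a = 0.
Proof. by rewrite /intg subrr. Qed.

Lemma intg_cat f a b c : intg f a b + intg f b c = intg f a c.
Proof. by rewrite /intg; ring. Qed.

Lemma intg_cells f (t : nat -> R) n : \sum_(k < n) intg f (t k) (t k.+1) = intg f (t 0%N) (t n).
Proof.
elim: n => [|n IH]; first by rewrite big_ord0 intgxx.
by rewrite big_ord_recr/= IH intg_cat.
Qed.

Lemma intgD f g a b : continuous f -> continuous g ->
  intg (fun t => f t + g t) a b = intg f a b + intg g a b.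
Proof.
move=> cf cg; have dF t := is_deriveD (prim_is_derive t cf) (prim_is_derive t cg).
rewrite (intgE a b dF); first by rewrite /intg -![(_ + _) _]/(_ + _); ring.
by move=> t; apply: cvgD; [exact: cf|exact: cg].
Qed.

Lemma intgZ c f a b : continuous f -> intg (fun t => c * f t) a b = c * intg f a b.
Proof.
move=> cf; have dF t := is_deriveZ c (prim_is_derive t cf).
rewrite (intgE a b dF); first by rewrite /intg mulrBr.
by move=> t; apply: cvgM; [exact: cvg_cst|exact: cf].
Qed.

Lemma intg_cst c a b : intg (fun=> c) a b = c * (b - a).
Proof.
rewrite (intgE a b (is_derive_affine c 0)); first by ring.
by move=> t; exact: cvg_cst.
Qed.

Lemma intg_ge0 f a b : continuous f -> a <= b -> (forall t, a <= t <= b -> 0 <= f t) ->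
  0 <= intg f a b.
Proof.
by move=> cf ab f0; rewrite subr_ge0; apply: is_derive_ndecr f0 => // t; exact: prim_is_derive.
Qed.

Lemma le_intg f g a b : continuous f -> continuous g -> a <= b ->
  (forall t, a <= t <= b -> f t <= g t) -> intg f a b <= intg g a b.
Proof.
move=> cf cg ab fg; rewrite -subr_ge0 -mulN1r -intgZ// -intgD//; last first.
  by move=> t; apply: cvgM; [exact: cvg_cst|exact: cf].
apply: intg_ge0 => //.
  by move=> t; apply: cvgD; [exact: cg|apply: cvgM; [exact: cvg_cst|exact: cf]].
by move=> t /fg; lra.
Qed.

Lemma continuous_sqr f : continuous f -> continuous (fun t => f t ^+ 2).
Proof. by move=> cf t; under eq_fun do rewrite expr2; apply: cvgM; exact: cf. Qed.

Lemma intg_sqr_le f a b : continuous f -> a <= b ->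
  intg f a b ^+ 2 <= (b - a) * intg (fun t => f t ^+ 2) a b.
Proof.
move=> cf; rewrite le_eqVlt => /predU1P[->|ab].
  by rewrite !intgxx mulr0 expr0n.
have ab0 : 0 < b - a by rewrite subr_gt0.
pose s := intg f a b / (b - a).
have cf2 := continuous_sqr cf.
have cZ c : continuous (fun t => c * f t).
  by move=> t; apply: cvgM; [exact: cvg_cst|exact: cf].
have cC (c : R) : continuous (fun _ : R => c).
  by move=> t; exact: cvg_cst.
have cA : continuous (fun t => (- 2 * s) * f t + s ^+ 2).
  by move=> t; apply: cvgD; [exact: cZ|exact: cC].
have : 0 <= intg (fun t => f t ^+ 2 + ((- 2 * s) * f t + s ^+ 2)) a b.
  apply: intg_ge0; [|exact: ltW|].
    by move=> t; apply: cvgD; [exact: cf2|exact: cA].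
  move=> t _; have := sqr_ge0 (f t - s).
  by congr (_ <= _); ring.
rewrite intgD// intgD// intgZ// intg_cst.
have se : s * (b - a) = intg f a b by rewrite /s divfK// gt_eqF.
move=> /(ler_wpM2r (ltW ab0)); rewrite mul0r mulrDl => h.
rewrite -subr_ge0; apply: le_trans h _.
rewrite -se le_eqVlt; apply/orP; left; apply/eqP; ring.
Qed.

Lemma smooth_prim f : smooth f -> smooth (prim f).
Proof.
move=> sf; apply: (@smooth_intro _ f) => // t; apply: prim_is_derive.
exact: smooth_continuous.
Qed.

Lemma continuous_bump : continuous bump.
Proof. exact: smooth_continuous smooth_bump. Qed.

Definition step (t : R) : R := (intg bump 0 1)^-1 * intg bump 0 t.

Lemma bump_mass_gt0 : 0 < intg bump 0 1.
Proof.
rewrite lt_neqAle eq_sym intg_ge0 ?andbT//; last 2 first.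
- exact: continuous_bump.
- by move=> t _; exact: bump_ge0.
apply/negP => /eqP e0.
have mono x y : x <= y -> prim bump x <= prim bump y.
  move=> xy; rewrite -subr_ge0; apply: intg_ge0 => // [|t _]; first exact: continuous_bump.
  exact: bump_ge0.
have cst t : 0 < t < 1 -> prim bump t = prim bump 1.
  move=> /andP[t0 t1]; have := mono _ _ (ltW t0); have := mono _ _ (ltW t1).
  by move: e0; rewrite /intg; lra.
have h : (0 < 2^-1 :> R) && (2^-1 < 1 :> R).
  by rewrite invr_gt0 ltr0n invf_lt1 ?ltr1n ?ltr0n.
have e1 : \forall s \near (2^-1 : R), prim bump 1 = prim bump s.
  near=> s; rewrite cst//; apply/andP; split; near: s; [apply: lt_nbhsr|apply: lt_nbhsl]; lra.
have := near_eq_is_derive e1 (is_derive_cst (prim bump 1) (2^-1 : R) 1).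
move=> [_]; have [_ ->] := prim_is_derive 2^-1 continuous_bump.
by move=> b0; have := bump_gt0 h; rewrite b0 ltxx.
Unshelve. all: by end_near. Qed.

Lemma step_is_derive t : is_derive t (1 : R) step ((intg bump 0 1)^-1 * bump t).
Proof.
have h := is_deriveZ (intg bump 0 1)^-1
  (is_deriveB (prim_is_derive t continuous_bump) (is_derive_cst (prim bump 0) t 1)).
by refine (is_derive_eq h _); rewrite subr0.
Qed.

Lemma smooth_step : smooth step.
Proof. by apply: (smooth_intro step_is_derive); apply: smoothZ; exact: smooth_bump. Qed.

Lemma step_le0 t : t <= 0 -> step t = 0.
Proof.
move=> t0; rewrite /step; apply/eqP; rewrite mulf_eq0; apply/orP; right; apply/eqP.
suff : intg bump t 0 = 0 by rewrite /intg; lra.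
apply/eqP; rewrite eq_le; have cb := continuous_bump.
rewrite [X in _ && X]intg_ge0//; last by move=> s _; exact: bump_ge0.
rewrite andbT; apply: (@le_trans _ _ (intg (fun=> 0) t 0)); last by rewrite intg_cst mul0r.
apply: le_intg => //; first by move=> s; exact: cvg_cst.
by move=> s /andP[_ s0]; rewrite bump_eq0// negb_and -!leNgt s0.
Qed.

Lemma step_ge1 t : 1 <= t -> step t = 1.
Proof.
move=> t1; rewrite /step -[X in _ * X](intg_cat _ _ 1).
suff -> : intg bump 1 t = 0 by rewrite addr0 mulVf// gt_eqF// bump_mass_gt0.
apply/eqP; rewrite eq_le.
have cb := continuous_bump.
rewrite [X in _ && X]intg_ge0//; last by move=> s _; exact: bump_ge0.
rewrite andbT; apply: (@le_trans _ _ (intg (fun=> 0) 1 t)); last by rewrite intg_cst mul0r.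
apply: le_intg => //; first by move=> s; exact: cvg_cst.
by move=> s /andP[s1 _]; rewrite bump_eq0// negb_and -!leNgt s1 orbT.
Qed.

End smooth1.

(** * Averaging operators in time *)

Section profiles.
Context (R : realType).
Implicit Types f g : R -> R.

Lemma contD f g : continuous f -> continuous g -> continuous (fun t => f t + g t).
Proof. by move=> cf cg t; apply: cvgD; [exact: cf|exact: cg]. Qed.

Lemma contM f g : continuous f -> continuous g -> continuous (fun t => f t * g t).
Proof. by move=> cf cg t; apply: cvgM; [exact: cf|exact: cg]. Qed.

Lemma contZ (c : R) f : continuous f -> continuous (fun t => c * f t).
Proof. by move=> cf; apply: contM => // t; exact: cvg_cst. Qed.

Lemma contB f g : continuous f -> continuous g -> continuous (fun t => f t - g t).
Proof. by move=> cf cg t; apply: cvgB; [exact: cf|exact: cg]. Qed.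

Lemma cont_sum n (F : 'I_n -> R -> R) : (forall i, continuous (F i)) ->
  continuous (fun t => \sum_(i < n) F i t).
Proof. by move=> h; exact: (@Cn_sum _ 0). Qed.

Lemma is_derive_fsum n (F : 'I_n -> R -> R) (D : 'I_n -> R) (t : R) :
  (forall i, is_derive t (1 : R) (F i) (D i)) ->
  is_derive t (1 : R) (fun t => \sum_(i < n) F i t) (\sum_(i < n) D i).
Proof.
elim: n F D => [|n IH] F D h.
  under eq_fun do rewrite big_ord0.
  by rewrite big_ord0; exact: is_derive_cst.
under eq_fun do rewrite big_ord_recl.
rewrite big_ord_recl.
exact: (is_deriveD (h ord0) (IH _ _ (fun i => h (lift ord0 i)))).
Qed.

Lemma intg_sum n (F : 'I_n -> R -> R) a b : (forall i, continuous (F i)) ->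
  intg (fun t => \sum_(i < n) F i t) a b = \sum_(i < n) intg (F i) a b.
Proof.
elim: n F => [|n IH] F h.
  under [X in intg X]eq_fun do rewrite big_ord0.
  by rewrite intg_cst mul0r big_ord0.
under [X in intg X]eq_fun do rewrite big_ord_recl.
by rewrite intgD// ?IH ?big_ord_recl//; exact: cont_sum.
Qed.

Definition profile f := smooth f /\ forall t, ~~ (0 < t < 1) -> f t = 0.

(** For the endpoints 0 and 1 of a profile, where the derivative vanishes as a limit from outside;
    the sign of e selects the side. *)
Lemma continuous_zero_at f t (e : R) : continuous f -> 0 < `|e| ->
  (forall s, 0 < s -> f (t + e * s) = 0) -> f t = 0.
Proof.
move=> cf; rewrite normr_gt0 => e0 h; apply/eqP/negP => /negP ft.
have : \forall s \near t, f s != 0 by apply: (@cvgr_neq0 _ R^o _ _ _ f _ (cf t)).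
move=> /nbhs_ballP[r /= r0 hr].
have e1 : 0 < `|e| by rewrite normr_gt0.
have s0 : 0 < r / 2 / `|e| by rewrite !divr_gt0.
have := hr (t + e * (r / 2 / `|e|)).
rewrite h// eqxx; have : ball t r (t + e * (r / 2 / `|e|)); last by move=> b /(_ b).
rewrite /ball /= opprD addrA subrr add0r normrN normrM (gtr0_norm s0).
by rewrite mulrC divfK ?gt_eqF//; lra.
Qed.

Lemma profile_derive f : profile f -> profile (derive1 f).
Proof.
move=> [sf f0]; split; first exact: smooth_derive.
have loc t : (t < 0) || (1 < t) -> derive1 f t = 0.
  move=> ht; have e1 : \forall s \near t, f s = 0.
    case/orP: ht => ht; near=> s; apply: f0; rewrite negb_and -!leNgt; apply/orP.
      by left; apply: ltW; near: s; exact: lt_nbhsl.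
    by right; apply: ltW; near: s; exact: lt_nbhsr.
  have := near_eq_is_derive e1 (smooth_is_derive t sf).
  by move=> [_ <-]; rewrite derive_cst.
move=> t; rewrite negb_and -!leNgt => /orP[t0|t1].
  apply: (@continuous_zero_at _ _ (- 1)).
  - exact/smooth_continuous/smooth_derive.
  - by rewrite normrN normr1.
  - by move=> s s0; apply: loc; apply/orP; left; lra.
apply: (@continuous_zero_at _ _ 1).
- exact/smooth_continuous/smooth_derive.
- by rewrite normr1.
- by move=> s s0; apply: loc; apply/orP; right; lra.
Unshelve. all: by end_near. Qed.

Lemma profile_bounded f : profile f -> exists2 B : R, 0 <= B & forall t, f t ^+ 2 <= B.
Proof.
move=> [sf f0]; have cf := smooth_continuous sf.
have [c _ hc] := EVT_max (@ler01 R) (continuous_subspaceT (continuous_sqr cf)).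
exists (f c ^+ 2); first exact: sqr_ge0.
move=> t; have [t01|/f0 ->] := boolP (0 < t < 1); last by rewrite expr0n sqr_ge0.
by apply: hc; rewrite in_itv/=; case/andP: t01 => *; rewrite !ltW.
Qed.

Lemma step_profile : profile (derive1 (@step R)).
Proof.
rewrite (derive1_is_derive (@step_is_derive R)); split.
  by apply: smoothZ; exact: smooth_bump.
by move=> t /bump_eq0 ->; rewrite mulr0.
Qed.

End profiles.

Section time_operators.
Context (R : realType) (T : R) (hT : 0 < T).
Implicit Types (phi psi : R -> R) (a b : nat -> R).

Definition tip phi psi := intg (fun t => phi t * psi t) 0 T.

Lemma tipC phi psi : tip phi psi = tip psi phi.
Proof. by congr intg; apply/funext => t; rewrite mulrC. Qed.

Lemma tip_ge0 phi : continuous phi -> 0 <= tip phi phi.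
Proof.
move=> cp; apply: intg_ge0; [exact: contM|exact: ltW|].
by move=> t _; rewrite -expr2 sqr_ge0.
Qed.

Lemma tip_suml n (c : 'I_n -> R) (F : 'I_n -> R -> R) psi : (forall i, continuous (F i)) ->
  continuous psi -> tip (fun t => \sum_i c i * F i t) psi = \sum_i c i * tip (F i) psi.
Proof.
move=> cF cp; rewrite /tip; under [X in intg X]eq_fun do rewrite mulr_suml.
rewrite intg_sum; last by move=> i; apply: contM => //; exact: contZ.
apply: eq_bigr => i _; rewrite -intgZ; last exact: contM.
by congr intg; apply/funext => t; rewrite mulrA.
Qed.

Lemma tip_sum n (c : 'I_n -> R) (F : 'I_n -> R -> R) : (forall i, continuous (F i)) ->
  tip (fun t => \sum_i c i * F i t) (fun t => \sum_i c i * F i t) =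
  \sum_i \sum_l c i * c l * tip (F i) (F l).
Proof.
move=> cF; rewrite tip_suml//; last by apply: cont_sum => i; exact: contZ.
apply: eq_bigr => i _; rewrite tipC tip_suml// mulr_sumr; apply: eq_bigr => l _.
by rewrite mulrA tipC.
Qed.

Lemma tipB_le phi psi : continuous phi -> continuous psi ->
  tip (fun t => phi t - psi t) (fun t => phi t - psi t) <= 2 * tip phi phi + 2 * tip psi psi.
Proof.
move=> cp cs; rewrite /tip -!intgZ; [|exact: contM|exact: contM].
rewrite -intgD; [|by apply: contZ; exact: contM..].
apply: le_intg; [by apply: contM; exact: contB| |exact: ltW|].
  by apply: contD; apply: contZ; exact: contM.
by move=> t _; have := sqr_ge0 (phi t + psi t); rewrite sqrrD !expr2; lra.
Qed.

Context (j : nat).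
Let n := (2 ^ j)%N.
Let ell : R := T / 2 ^+ j.
Let exp2_gt0 : (0 : R) < 2 ^+ j.
Proof. by rewrite exprn_gt0. Qed.
Let ell0 : 0 < ell.
Proof. exact: divr_gt0. Qed.
Let ell_ge0 : 0 <= ell := ltW ell0.
Let ellT : n%:R * ell = T.
Proof. by rewrite /ell /n natrX mulrC divfK// gt_eqF. Qed.

(** The affine argument maps the k-th cell onto [0, 1], so for a profile eta the summands live on
    different cells. *)
Definition comb (eta : R -> R) a t := \sum_(k < n) a k * eta (ell^-1 * t + - k%:R).

Lemma smooth_comb eta a : smooth eta -> smooth (comb eta a).
Proof. by move=> se; apply: smooth_sum => k; apply: smoothZ; exact: smooth_affine. Qed.

Lemma comb_is_derive eta a t : smooth eta ->
  is_derive t (1 : R) (comb eta a) (ell^-1 * comb (derive1 eta) a t).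
Proof.
move=> se; rewrite /comb mulr_sumr; apply: is_derive_fsum => k.
have h := @is_derive1_comp R eta (fun t => ell^-1 * t + - k%:R) t _ _
  (smooth_is_derive _ se) (is_derive_affine _ _ t).
by refine (is_derive_eq (is_deriveZ (a k) h) _); rewrite -[_ *: _]/(_ * _); ring.
Qed.

Lemma combD eta a b t : comb eta (fun k => a k + b k) t = comb eta a t + comb eta b t.
Proof. by rewrite /comb -big_split/=; apply: eq_bigr => k _; rewrite mulrDl. Qed.

Lemma combZ eta c a t : comb eta (fun k => c * a k) t = c * comb eta a t.
Proof. by rewrite /comb mulr_sumr; apply: eq_bigr => k _; rewrite mulrA. Qed.

Let cell_arg (k : nat) (t : R) : k%:R * ell <= t -> forall i, (i < k)%N -> 1 <= ell^-1 * t + - i%:R.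
Proof.
move=> kt i ik; rewrite lerBrDr -[leLHS](mulKf (lt0r_neq0 ell0)).
rewrite ler_wpM2l ?invr_ge0//; apply: le_trans kt.
by rewrite mulrC ler_wpM2r// nat1r ler_nat.
Qed.

Let cell_arg2 (k : nat) (t : R) : t <= k%:R * ell -> forall i, (k <= i)%N -> ell^-1 * t + - i%:R <= 0.
Proof.
move=> kt i ik; rewrite subr_le0 ler_pdivrMl//; apply: le_trans kt _.
by rewrite mulrC ler_wpM2l// ler_nat.
Qed.

Lemma comb_cell eta a (k : 'I_n) t : profile eta -> k%:R * ell <= t <= k.+1%:R * ell ->
  comb eta a t = a k * eta (ell^-1 * t + - k%:R).
Proof.
move=> [_ e0] /andP[t1 t2]; rewrite /comb (bigD1 k)//= big1 ?addr0// => i ik.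
have [ltik|ltki|/val_inj eik] := ltngtP i k; last by rewrite eik eqxx in ik.
  by rewrite e0 ?mulr0// negb_and -!leNgt (cell_arg t1) ?orbT.
by rewrite e0 ?mulr0// negb_and -!leNgt (cell_arg2 t2).
Qed.

Lemma comb_left eta a t : profile eta -> t <= 0 -> comb eta a t = 0.
Proof.
move=> [_ e0] t0; rewrite /comb big1// => i _.
by rewrite e0 ?mulr0// negb_and -!leNgt (@cell_arg2 0) ?mul0r.
Qed.

Lemma comb_right eta a t : profile eta -> T <= t -> comb eta a t = 0.
Proof.
move=> [_ e0] t0; rewrite /comb big1// => i _.
by rewrite e0 ?mulr0// negb_and -!leNgt (@cell_arg n) ?orbT// ellT.
Qed.

Let grid_le (k : nat) : k%:R * ell <= k.+1%:R * ell.
Proof. by rewrite ler_wpM2r// ler_nat. Qed.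

Let cells f : \sum_(k < n) intg f (k%:R * ell) (k.+1%:R * ell) = intg f 0 T.
Proof.
by have := intg_cells f (fun k => k%:R * ell) n; rewrite mul0r ellT => <-.
Qed.

(** On each cell a single summand survives, so the square norm is computed cell by cell. *)
Lemma comb_norm eta a B : profile eta -> (forall t, eta t ^+ 2 <= B) ->
  tip (comb eta a) (comb eta a) <= ell * B * \sum_(k < n) a k ^+ 2.
Proof.
move=> pe hB; have ce := smooth_continuous (smooth_comb a pe.1).
rewrite /tip -cells mulr_sumr; apply: ler_sum => k _.
have cst (c : R) : continuous (fun _ : R => c).
  by move=> t; exact: cvg_cst.
apply: le_trans (_ : intg (fun=> B * a k ^+ 2) (k%:R * ell) (k.+1%:R * ell) <= _).
  apply: le_intg => //; first exact: contM.
  by move=> t /(comb_cell a pe) ->; rewrite -expr2 exprMn mulrC ler_wpM2r ?sqr_ge0.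
rewrite intg_cst le_eqVlt; apply/orP; left; apply/eqP.
by rewrite -natr1; ring.
Qed.

Definition cellmass phi k := intg phi (k%:R * ell) (k.+1%:R * ell).

Lemma cellmass_sqr phi : continuous phi -> \sum_(k < n) cellmass phi k ^+ 2 <= ell * tip phi phi.
Proof.
move=> cp; rewrite /tip -cells mulr_sumr; apply: ler_sum => k _.
apply: le_trans (intg_sqr_le cp (grid_le k)) _.
have -> : k.+1%:R * ell - k%:R * ell = ell by rewrite -natr1; ring.
by under [X in intg X]eq_fun do rewrite expr2.
Qed.

(* opU averages phi over each cell against a bump supported in the cell; opU1, opU2 are its first and
   second derivatives and opV the primitive of phi - opU phi, rescaled to be bounded uniformly in j. *)
Definition opU phi t := ell^-1 * comb (derive1 (@step R)) (cellmass phi) t.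

Definition opU1 phi t := 2 ^- j * (ell^-1 * (ell^-1 *
  comb (derive1 (derive1 (@step R))) (cellmass phi) t)).

Definition opU2 phi t := 4 ^- j * (ell^-1 * (ell^-1 * (ell^-1 *
  comb (derive1 (derive1 (derive1 (@step R)))) (cellmass phi) t))).

Definition opV phi t := 2 ^+ j * (intg phi 0 t - comb (@step R) (cellmass phi) t).

Let step1 := @step_profile R.
Let step2 := profile_derive step1.
Let step3 := profile_derive step2.

Lemma opU_is_derive phi t : is_derive t (1 : R) (opU phi) (2 ^+ j * opU1 phi t).
Proof.
refine (is_derive_eq (is_deriveZ ell^-1 (comb_is_derive (cellmass phi) t step1.1)) _).
by rewrite /opU1 mulrA divff ?mul1r// gt_eqF.
Qed.

Lemma opU1_is_derive phi t : is_derive t (1 : R) (fun t => 2 ^+ j * opU1 phi t) (4 ^+ j * opU2 phi t).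
Proof.
have h := is_deriveZ ell^-1 (is_deriveZ ell^-1 (comb_is_derive (cellmass phi) t step2.1)).
have -> : (fun t => 2 ^+ j * opU1 phi t) =
    (fun t => ell^-1 * (ell^-1 * comb (derive1 (derive1 (@step R))) (cellmass phi) t)).
  by apply/funext => s; rewrite /opU1 mulrA divff ?mul1r// gt_eqF.
refine (is_derive_eq h _); by rewrite /opU2 mulrA divff ?mul1r// gt_eqF// exprn_gt0.
Qed.

Lemma opV_is_derive phi t : continuous phi ->
  is_derive t (1 : R) (fun t => 2 ^- j * opV phi t) (phi t - opU phi t).
Proof.
move=> cp; have -> : (fun t => 2 ^- j * opV phi t) =
    (fun t => prim phi t - prim phi 0 - comb (@step R) (cellmass phi) t).
  by apply/funext => s; rewrite /opV mulrA mulVf ?mul1r// gt_eqF.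
have h1 := is_deriveB (prim_is_derive t cp) (is_derive_cst (prim phi 0) t 1).
refine (is_derive_eq (is_deriveB h1 (comb_is_derive (cellmass phi) t (@smooth_step R))) _).
by rewrite subr0.
Qed.

Lemma cont_opU phi : continuous (opU phi).
Proof. by apply: contZ; exact: smooth_continuous (smooth_comb _ step1.1). Qed.

Lemma cont_opU1 phi : continuous (opU1 phi).
Proof. by do 3!apply: contZ; exact: smooth_continuous (smooth_comb _ step2.1). Qed.

Lemma cont_opU2 phi : continuous (opU2 phi).
Proof. by do 4!apply: contZ; exact: smooth_continuous (smooth_comb _ step3.1). Qed.

Lemma cont_opV phi : continuous phi -> continuous (opV phi).
Proof.
move=> cp; apply: contZ; apply: contB.
  apply: contB; last by move=> t; exact: cvg_cst.
  exact: is_derive_continuous (fun t => prim_is_derive t cp).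
exact: smooth_continuous (smooth_comb _ (@smooth_step R)).
Qed.

Lemma smooth_opU phi : smooth (opU phi).
Proof. by apply: smoothZ; exact: smooth_comb step1.1. Qed.

Lemma smooth_opV phi : smooth phi -> smooth (opV phi).
Proof.
move=> sp; apply: smoothZ.
have -> : (fun t => intg phi 0 t - comb (@step R) (cellmass phi) t) =
   (fun t => (prim phi t + - prim phi 0) + (-1) * comb (@step R) (cellmass phi) t).
  by apply/funext => t; rewrite mulN1r.
apply: smoothD; last by apply: smoothZ; apply: smooth_comb; exact: smooth_step.
by apply: smoothD; [exact: smooth_prim|exact: smooth_cst].
Qed.

Lemma opU_vanish phi t : (t <= 0) || (T <= t) -> opU phi t = 0.
Proof.
move=> /orP[t0|t1]; rewrite /opU.
  by rewrite comb_left ?mulr0//; exact: step1.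
by rewrite comb_right ?mulr0//; exact: step1.
Qed.

(** At a grid point each earlier copy of [step] has reached 1 and each later one is still 0, so the
    sum of masses equals the primitive. This gives the zeros at 0 and T and at the left end of every
    cell. *)
Lemma opV_grid phi (k : nat) : (k <= n)%N -> opV phi (k%:R * ell) = 0.
Proof.
move=> kn; have h := intg_cells phi (fun k => k%:R * ell) k.
rewrite mul0r in h; rewrite /opV -h /comb.
suff -> : \sum_(k0 < n) cellmass phi k0 * step (ell^-1 * (k%:R * ell) + - k0%:R) =
    \sum_(k0 < k) cellmass phi k0 by rewrite subrr mulr0.
rewrite (big_ord_widen n (fun i => cellmass phi i) kn) [RHS]big_mkcond/=.
apply: eq_bigr => i _; case: ltnP => ik.
  by rewrite step_ge1 ?mulr1//; exact: cell_arg ik.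
by rewrite step_le0 ?mulr0//; exact: cell_arg2 ik.
Qed.

Lemma opV_0 phi : opV phi 0 = 0.
Proof. by have := @opV_grid phi 0 isT; rewrite mul0r. Qed.

Lemma opV_T phi : opV phi T = 0.
Proof. by rewrite -ellT opV_grid. Qed.

Lemma tipZ c phi : continuous phi -> tip (fun t => c * phi t) (fun t => c * phi t) = c ^+ 2 * tip phi phi.
Proof.
move=> cp; rewrite /tip -intgZ; last exact: contM.
by congr intg; apply/funext => t; ring.
Qed.

Lemma comb_mass_norm eta phi B : profile eta -> (forall t, eta t ^+ 2 <= B) -> continuous phi ->
  tip (comb eta (cellmass phi)) (comb eta (cellmass phi)) <= ell ^+ 2 * B * tip phi phi.
Proof.
move=> pe hB cp; apply: le_trans (comb_norm _ pe hB) _.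
have B0 : 0 <= B by apply: le_trans (hB 0); exact: sqr_ge0.
have := ler_wpM2l (mulr_ge0 ell_ge0 B0) (cellmass_sqr cp).
by move=> h; apply: le_trans h _; rewrite le_eqVlt; apply/orP; left; apply/eqP; ring.
Qed.

Lemma opU_norm B phi : (forall t, derive1 (@step R) t ^+ 2 <= B) -> continuous phi ->
  tip (opU phi) (opU phi) <= B * tip phi phi.
Proof.
move=> hB cp; rewrite tipZ; last exact: smooth_continuous (smooth_comb _ step1.1).
have := ler_wpM2l (sqr_ge0 ell^-1) (comb_mass_norm step1 hB cp).
move=> h; apply: le_trans h _; rewrite le_eqVlt; apply/orP; left; apply/eqP.
by field; rewrite gt_eqF.
Qed.

Lemma opU1_norm B phi : (forall t, derive1 (derive1 (@step R)) t ^+ 2 <= B) -> continuous phi ->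
  tip (opU1 phi) (opU1 phi) <= T ^- 2 * B * tip phi phi.
Proof.
move=> hB cp; have cc := smooth_continuous (smooth_comb (cellmass phi) step2.1).
rewrite tipZ; last by do 2!apply: contZ.
rewrite tipZ; last by apply: contZ.
rewrite tipZ//.
have := ler_wpM2l (sqr_ge0 (2 ^- j * (ell^-1 * ell^-1))) (comb_mass_norm step2 hB cp).
rewrite !exprMn -!mulrA => h; apply: le_trans h _; rewrite le_eqVlt; apply/orP; left; apply/eqP.
by rewrite /ell; field; rewrite !gt_eqF.
Qed.

Lemma opU2_norm B phi : (forall t, derive1 (derive1 (derive1 (@step R))) t ^+ 2 <= B) ->
  continuous phi -> tip (opU2 phi) (opU2 phi) <= T ^- 4 * B * tip phi phi.
Proof.
move=> hB cp; have cc := smooth_continuous (smooth_comb (cellmass phi) step3.1).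
rewrite tipZ; last by do 3!apply: contZ.
rewrite tipZ; last by do 2!apply: contZ.
rewrite tipZ; last by apply: contZ.
rewrite tipZ//.
have := ler_wpM2l (sqr_ge0 (4 ^- j * (ell^-1 * (ell^-1 * ell^-1)))) (comb_mass_norm step3 hB cp).
rewrite !exprMn -!mulrA => h; apply: le_trans h _; rewrite le_eqVlt; apply/orP; left; apply/eqP.
have e4 : 4 ^+ j = 2 ^+ j * 2 ^+ j :> R by rewrite -exprMn; congr (_ ^+ _); ring.
by rewrite /ell e4; field; rewrite !gt_eqF.
Qed.

(** A Poincare inequality on each cell: 2^-j V vanishes at its left end, so its square is at most
    ell times the integral of the squared derivative over the cell. The factor ell^2 4^j equals
    T^2. *)
Lemma opV_norm phi : continuous phi -> tip (opV phi) (opV phi) <=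
  T ^+ 2 * tip (fun t => phi t - opU phi t) (fun t => phi t - opU phi t).
Proof.
move=> cp; pose v t := 2 ^- j * opV phi t.
have cU : continuous (fun t => phi t - opU phi t) by apply: contB => //; exact: cont_opU.
have cv : continuous v by apply: contZ; exact: cont_opV.
have cst (c : R) : continuous (fun _ : R => c).
  by move=> t; exact: cvg_cst.
have -> : opV phi = (fun t => 2 ^+ j * v t).
  by apply/funext => t; rewrite /v mulrA divff ?mul1r// gt_eqF.
rewrite tipZ//; have : tip v v <= ell ^+ 2 * tip (fun t => phi t - opU phi t) (fun t => phi t - opU phi t).
  rewrite /tip -!cells mulr_sumr; apply: ler_sum => k _.
  set q := fun t => (phi t - opU phi t) * (phi t - opU phi t).
  have cq : continuous q by exact: contM.
  set a := k%:R * ell; set b := k.+1%:R * ell.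
  apply: le_trans (_ : intg (fun=> ell * intg q a b) a b <= _).
    apply: le_intg => //; [exact: contM|exact: grid_le|].
    move=> t /andP[at_ tb]; have va : v a = 0 by rewrite /v opV_grid ?mulr0// ltnW.
    have -> : v t = intg (fun t => phi t - opU phi t) a t.
      rewrite (intgE a t (fun s => opV_is_derive s cp))//.
      by rewrite -/(v t) -/(v a) va subr0.
    rewrite -expr2; apply: le_trans (intg_sqr_le cU at_) _.
    have -> : (fun t => (phi t - opU phi t) ^+ 2) = q by apply/funext => s; rewrite expr2.
    have q0 s : 0 <= q s by rewrite /q -expr2 sqr_ge0.
    have ba : b - a = ell by rewrite /a /b -natr1; ring.
    apply: ler_pM; [lra|by apply: intg_ge0|rewrite -ba; lra|].
    rewrite -(intg_cat q a t b) lerDl; exact: intg_ge0.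
  rewrite intg_cst le_eqVlt; apply/orP; left; apply/eqP.
  by rewrite /a /b -natr1; ring.
move=> /(ler_wpM2l (sqr_ge0 (2 ^+ j))) h; apply: le_trans h _.
rewrite le_eqVlt; apply/orP; left; apply/eqP.
by rewrite /ell; field; rewrite gt_eqF.
Qed.

Lemma cellmass_lin c phi psi k : continuous phi -> continuous psi ->
  cellmass (fun t => c * phi t + psi t) k = c * cellmass phi k + cellmass psi k.
Proof. by move=> cp cq; rewrite /cellmass intgD ?intgZ//; exact: contZ. Qed.

Lemma comb_lin eta c phi psi t : continuous phi -> continuous psi ->
  comb eta (cellmass (fun t => c * phi t + psi t)) t =
  c * comb eta (cellmass phi) t + comb eta (cellmass psi) t.
Proof.
move=> cp cq; have -> : cellmass (fun t => c * phi t + psi t) =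
    (fun k => c * cellmass phi k + cellmass psi k).
  by apply/funext => k; exact: cellmass_lin.
by rewrite combD combZ.
Qed.

End time_operators.

Section time_op.
Context (R : realType) (T : R).

Record time_op (b : R) (S : (R -> R) -> (R -> R)) : Prop := TimeOp {
  top_cont : forall phi : R -> R, continuous phi -> continuous (S phi);
  top_lin : forall (c : R) (phi psi : R -> R), continuous phi -> continuous psi ->
    S (fun t => c * phi t + psi t) = (fun t => c * S phi t + S psi t);
  top_le : forall phi : R -> R, continuous phi -> tip T (S phi) (S phi) <= b * tip T phi phi }.

Lemma top_sum b S n (c : 'I_n -> R) (F : 'I_n -> R -> R) : time_op b S ->
  (forall i, continuous (F i)) ->
  S (fun t => \sum_i c i * F i t) = (fun t => \sum_i c i * S (F i) t).
Proof.
move=> hS; elim: n c F => [|n IH] c F cF.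
  have c0 : continuous (fun _ : R => 0 : R).
    by move=> t; exact: cvg_cst.
  have := top_lin hS (-1) c0 c0.
  have -> : (fun t : R => \sum_(i < 0) c i * F i t) = (fun=> 0) by apply/funext => t; rewrite big_ord0.
  have -> : (fun _ : R => -1 * 0 + 0 : R) = (fun=> 0) by apply/funext => t; rewrite mulr0 addr0.
  by move=> ->; apply/funext => t; rewrite big_ord0 mulN1r addNr.
under [X in S X]eq_fun do rewrite big_ord_recl.
rewrite (top_lin hS) ?IH//; last by apply: cont_sum => i; exact: contZ.
by apply/funext => t; rewrite big_ord_recl.
Qed.

Lemma time_op_le b b' S : 0 < T -> b <= b' -> time_op b S -> time_op b' S.
Proof.
move=> T0 bb [h1 h2 h3]; split => // phi cp; apply: le_trans (h3 _ cp) _.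
by rewrite ler_wpM2r// tip_ge0.
Qed.

(** The rescalings by powers of 2 in the definitions cancel the cost of differentiation and the gain
    of integration, so one bound serves all levels. It depends only on T and the maxima of three
    derivatives of [step]. *)
Lemma time_ops (T0 : 0 < T) : exists2 b : R, 0 <= b & forall j,
  [/\ time_op b (opU T j), time_op b (opU1 T j), time_op b (opU2 T j), time_op b (opV T j)
    & time_op b (fun phi t => phi t - opU T j phi t)].
Proof.
have p1 := @step_profile R; have p2 := profile_derive p1; have p3 := profile_derive p2.
have [B1 B10 h1] := profile_bounded p1.
have [B2 B20 h2] := profile_bounded p2.
have [B3 B30 h3] := profile_bounded p3.
have t2 : 0 <= T ^- 2 * B2 by rewrite mulr_ge0// invr_ge0 exprn_ge0// ltW.
have t4 : 0 <= T ^- 4 * B3 by rewrite mulr_ge0// invr_ge0 exprn_ge0// ltW.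
have t1 : 0 <= T ^+ 2 * (2 + 2 * B1) by rewrite mulr_ge0 ?sqr_ge0//; lra.
pose b := 2 + 2 * B1 + T ^- 2 * B2 + T ^- 4 * B3 + T ^+ 2 * (2 + 2 * B1).
exists b; first by rewrite /b; lra.
move=> j.
have UB phi : continuous phi -> tip T (fun t => phi t - opU T j phi t) (fun t => phi t - opU T j phi t)
    <= (2 + 2 * B1) * tip T phi phi.
  move=> cp; have cu : continuous (opU T j phi) by exact: cont_opU.
  apply: le_trans (tipB_le T0 cp cu) _.
  have := opU_norm T0 j h1 cp; lra.
have lU (c : R) (phi psi : R -> R) : continuous phi -> continuous psi ->
    opU T j (fun t => c * phi t + psi t) = (fun t => c * opU T j phi t + opU T j psi t).
  by move=> cp cq; apply/funext => t; rewrite /opU comb_lin//; ring.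
split.
- apply: (@time_op_le B1) => //; first by rewrite /b; lra.
  by split => //; [move=> *; exact: cont_opU|move=> phi; exact: opU_norm].
- apply: (@time_op_le (T ^- 2 * B2)) => //; first by rewrite /b; lra.
  split => //; [by move=> *; exact: cont_opU1| |by move=> phi; exact: opU1_norm].
  by move=> *; apply/funext => t; rewrite /opU1 comb_lin//; ring.
- apply: (@time_op_le (T ^- 4 * B3)) => //; first by rewrite /b; lra.
  split => //; [by move=> *; exact: cont_opU2| |by move=> phi; exact: opU2_norm].
  by move=> *; apply/funext => t; rewrite /opU2 comb_lin//; ring.
- apply: (@time_op_le (T ^+ 2 * (2 + 2 * B1))) => //; first by rewrite /b; lra.
  split => //; first by move=> *; exact: cont_opV.
    move=> c phi psi cp cq; apply/funext => t; rewrite /opV comb_lin// intgD ?intgZ//; first by ring.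
    exact: contZ.
  move=> phi cp; apply: le_trans (opV_norm T0 j cp) _; rewrite -mulrA ler_wpM2l ?sqr_ge0//.
  exact: UB.
- apply: (@time_op_le (2 + 2 * B1)) => //; first by rewrite /b; lra.
  split => //; first by move=> phi cp; apply: contB => //; exact: cont_opU.
  by move=> c phi psi cp cq; rewrite lU//; apply/funext => t; ring.
Qed.

End time_op.

(** * Functions of time and space *)

Section Ck_calculus.
Context (R : realType).
Implicit Types V : normedModType R.

Lemma Ck_continuous V k (U : set V) F x : Ck k U F -> U x -> {for x, continuous F}.
Proof. by case: k => [|k] [h _] /h. Qed.

Lemma Ck_S V k (U : set V) (F : V -> R) : Ck k.+1 U F -> Ck k U F.
Proof.
elim: k F => [|k IH] F [h1 h2]; first by split.
by split => // v; have [h3 h4] := h2 v; split => //; exact: IH.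
Qed.

Lemma Ck_ext V k (U : set V) F G : open U -> (forall x, U x -> F x = G x) ->
  Ck k U F -> Ck k U G.
Proof.
move=> oU; elim: k F G => [|k IH] F G FG [h1 h2].
all: have nFG x : U x -> \forall y \near x, F y = G y
  by move=> Ux; have := open_nbhs_nbhs (conj oU Ux); apply: filterS => y; exact: FG.
all: have cG : forall x, U x -> {for x, continuous G}.
1,3: move=> x Ux; rewrite /prop_for /continuous_at -FG//.
1,2: by apply: cvg_trans (h1 x Ux); apply: near_eq_cvg; exact: nFG.
- by split.
split => // v; have [h3 h4] := h2 v; split.
  by move=> x Ux; apply: near_eq_derivable (h3 x Ux); exact: nFG.
by apply: IH h4 => x Ux; apply: near_eq_derive; exact: nFG.
Qed.

Lemma Ck_subset V k (U U' : set V) (F : V -> R) : U' `<=` U -> Ck k U F -> Ck k U' F.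
Proof.
move=> UU; elim: k F => [|k IH] F [h1 h2].
  by split => // x /UU; exact: h1.
split; first by move=> x /UU; exact: h1.
by move=> v; have [h3 h4] := h2 v; split; [move=> x /UU; exact: h3|exact: IH].
Qed.

Lemma Ck_cst V k (U : set V) (c : R) : Ck k U (fun=> c).
Proof.
elim: k c => [|k IH] c; first by split => // x _; exact: cvg_cst.
split; first by move=> x _; exact: cvg_cst.
move=> v; split; first by move=> x _; exact: derivable_cst.
by have -> : (fun x => 'D_v (fun=> c) x) = (fun=> 0 : R); [apply/funext => x; rewrite derive_cst|exact: IH].
Qed.

Lemma Ck_D V k (U : set V) (F G : V -> R) : open U -> Ck k U F -> Ck k U G ->
  Ck k U (fun x => F x + G x).
Proof.
move=> oU; elim: k F G => [|k IH] F G [h1 h2] [g1 g2].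
  by split => // x Ux; apply: cvgD; [exact: h1|exact: g1].
split; first by move=> x Ux; apply: cvgD; [exact: h1|exact: g1].
move=> v; have [h3 h4] := h2 v; have [g3 g4] := g2 v; split.
  by move=> x Ux; exact: derivableD (h3 x Ux) (g3 x Ux).
apply: Ck_ext (IH _ _ h4 g4) => // x Ux.
exact: esym (deriveD (h3 x Ux) (g3 x Ux)).
Qed.

Lemma Ck_M V k (U : set V) (F G : V -> R) : open U -> Ck k U F -> Ck k U G ->
  Ck k U (fun x => F x * G x).
Proof.
move=> oU; elim: k F G => [|k IH] F G hF hG.
  by split => // x Ux; apply: cvgM; [exact: Ck_continuous hF _|exact: Ck_continuous hG _].
have [h1 h2] := hF; have [g1 g2] := hG.
split; first by move=> x Ux; apply: cvgM; [exact: h1|exact: g1].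
move=> v; have [h3 h4] := h2 v; have [g3 g4] := g2 v; split.
  by move=> x Ux; exact: derivableM (h3 x Ux) (g3 x Ux).
have Ck1 := IH _ _ (Ck_S hF) g4; have Ck2 := IH _ _ (Ck_S hG) h4.
apply: Ck_ext (Ck_D oU Ck1 Ck2) => // x Ux.
exact: esym (deriveM (h3 x Ux) (g3 x Ux)).
Qed.

Lemma Ck_smooth k (f : R -> R) : smooth f -> Ck k setT f.
Proof.
elim: k f => [|k IH] f sf; first by split => // x _; exact: smooth_continuous.
split; first by move=> x _; exact: smooth_continuous.
have d v x : is_derive x v f (v * derive1 f x).
  have [/derivable1_diffP df e] := smooth_is_derive x sf.
  split; first exact: diff_derivable.
  by rewrite -e !deriveE// -[X in 'd f x X]mulr1 -[v * 1]/(v *: 1) linearZ.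
move=> v; split; first by move=> x _; have [] := d v x.
have -> : (fun x => 'D_v f x) = (fun x => v * derive1 f x).
  by apply/funext => x; have [] := d v x.
by apply: IH; apply: smoothZ; exact: smooth_derive.
Qed.

Lemma Ck_fst (V W : normedModType R) k (U : set V) (F : V -> R) :
  Ck k U F -> Ck k [set z : V * W | U z.1] (fun z => F z.1).
Proof.
elim: k F => [|k IH] F [h1 h2].
  by split => // z Uz; apply: continuous_comp; [exact: cvg_fst|exact: h1].
split.
  by move=> z Uz; apply: continuous_comp; [exact: cvg_fst|exact: h1].
move=> v; have [h3 h4] := h2 v.1; split; first by move=> z Uz; exact: (h3 z.1 Uz).
exact: (IH _ h4).
Qed.

Lemma Ck_snd (V W : normedModType R) k (U : set W) (F : W -> R) :
  Ck k U F -> Ck k [set z : V * W | U z.2] (fun z => F z.2).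
Proof.
elim: k F => [|k IH] F [h1 h2].
  by split => // z Uz; apply: continuous_comp; [exact: cvg_snd|exact: h1].
split.
  by move=> z Uz; apply: continuous_comp; [exact: cvg_snd|exact: h1].
move=> v; have [h3 h4] := h2 v.2; split; first by move=> z Uz; exact: (h3 z.2 Uz).
exact: (IH _ h4).
Qed.

End Ck_calculus.

Section smooth_spacetime.
Context (R : realType) (d : nat) (S : set 'rV[R]_d) (x0 : S) (T : R).
Implicit Types u v : measurableTypeR R * state x0 -> R.

Lemma smooth_spacetime0 : smooth_spacetime T (fun _ : measurableTypeR R * state x0 => 0).
Proof.
exists setT, (fun=> 0); split => //; first exact: openT.
by move=> k; exact: Ck_cst.
Qed.

Lemma smooth_spacetime_lin a u v : smooth_spacetime T u -> smooth_spacetime T v ->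
  smooth_spacetime T (fun z => a * u z + v z).
Proof.
move=> [U [F [oU jU hF uF]]] [U' [F' [oU' jU' hF' uF']]].
exists (U `&` U'), (fun z => a * F z + F' z); split.
- exact: openI.
- by move=> z hz; split; [exact: jU|exact: jU'].
- move=> k; have oI := openI oU oU'; apply: Ck_D => //.
    by apply: Ck_M => //; [exact: Ck_cst|apply: Ck_subset (hF k) => z []].
  by apply: Ck_subset (hF' k) => z [].
- by move=> i Di; rewrite uF// uF'.
Qed.

Lemma smooth_spacetime_tensor (psi : R -> R) (w : state x0 -> R) : smooth psi -> smooth_space w ->
  smooth_spacetime T (fun z : measurableTypeR R * state x0 => psi z.1 * w z.2).
Proof.
move=> sp [U [F [oU jU hF uF]]].
have oU2 : open [set z : R * 'rV[R]_d | U z.2].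
  by apply: (open_comp _ oU) => z _; exact: cvg_snd.
exists [set z : R * 'rV[R]_d | U z.2], (fun z => psi z.1 * F z.2); split => //.
- by move=> _ [z _ <-]; apply: jU; exists z.2.
- move=> k; apply: Ck_M => //; last exact: Ck_snd.
  by apply: Ck_subset (Ck_fst 'rV[R]_d (Ck_smooth k sp)).
- by move=> z _; rewrite uF.
Qed.

End smooth_spacetime.

(** * Integration over time and space *)

Section lower_integral.
Context d (T : measurableType d) (R : realType) (m : {measure set T -> \bar R}).

(* The energies of the time slices are not known to be measurable in t; the integral of a
   nonnegative function is still monotone, being a supremum over simple minorants. *)
Lemma ge0_le_integral_nonmeasurable (f g : T -> \bar R) : (forall x, 0 <= f x)%E ->
  (forall x, f x <= g x)%E -> (\int[m]_x f x <= \int[m]_x g x)%E.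
Proof.
move=> f0 fg; have g0 x : (0 <= g x)%E by apply: le_trans (fg x).
rewrite !ge0_integralTE//.
by apply: ereal_sup_le => _ [h /= hf <-]; exists h => //= x; exact: le_trans (fg x).
Qed.

(** Raising the majorant to +oo on the exceptional null set keeps it measurable and its integral
    unchanged, and makes the inequality pointwise. *)
Lemma ge0_ae_le_integral (f : T -> \bar R) (g : T -> R) : (forall x, 0 <= f x)%E ->
  measurable_fun setT g -> (forall x, 0 <= g x) -> {ae m, forall x, (f x <= (g x)%:E)%E} ->
  (\int[m]_x f x <= \int[m]_x (g x)%:E)%E.
Proof.
move=> f0 mg g0 [N [mN N0 sub]].
pose g' x := if x \in N then +oo%E else (g x)%:E.
have mg' : measurable_fun setT g'.
  apply: measurable_fun_ifT => //; last exact/measurable_EFinP.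
  by apply: (@measurable_fun_bool _ _ _ _ true); rewrite setTI preimage_mem_true.
apply: (@le_trans _ _ (\int[m]_x g' x)%E).
  apply: ge0_le_integral_nonmeasurable => // x; rewrite /g'.
  case: ifPn => xN; first exact: leey.
  by apply: contrapT => nle; move: xN; rewrite notin_setE; apply; apply: sub.
rewrite le_eqVlt; apply/orP; left; apply/eqP; apply: ae_eq_integral => //.
  exact/measurable_EFinP.
exists N; split => // x /= nx; apply: contrapT => xN; apply: nx => _.
by rewrite /g' memNset.
Qed.

End lower_integral.

Section fubini.
Context (R : realType) d1 d2 (T1 : measurableType d1) (T2 : measurableType d2)
  (m1 : {finite_measure set T1 -> \bar R}) (m2 : {finite_measure set T2 -> \bar R}).
Local Notation P := (m1 \x m2)%E.
Local Notation L2 m f := (f \in Lfun m 2%:E).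
Implicit Types u w : T1 * T2 -> R.

(** The slices with non-finite inner integral, for which the real-valued integral is a default, form
    a null set. *)
Lemma fubini_ip u w : L2 P u -> L2 P w ->
  let b t := ip m2 (fun x => u (t, x)) (fun x => w (t, x)) in
  measurable_fun setT b /\ (\int[m1]_t (b t)%:E = (ip P u w)%:E)%E.
Proof.
move=> Lu Lw b; have iuw := ip_integrable Lu Lw.
have FI := integrable_fubini_F iuw.
have bE : b = fine \o fubini_F m2 (EFin \o (fun z => u z * w z)) by [].
have mF := measurable_fubini_F iuw.
have mb : measurable_fun setT b.
  by rewrite bE; apply: measurableT_comp => //; exact: measurable_fine.
split => //; rewrite ipE// -(integral12_prod_meas1 iuw).
apply: ae_eq_integral => //; first exact/measurable_EFinP.
apply: filterS (integrable_ae measurableT FI) => t /= /(_ I) h _.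
by rewrite bE /= fineK.
Qed.

Lemma fiber_L2 u : L2 P u -> {ae m1, forall t, L2 m2 (fun x => u (t, x))}.
Proof.
move=> Lu; have h := ae_integrable1 (ip_integrable Lu Lu).
apply: filterS h => t /integrableP[_ h]; apply/L2P; split.
  by apply: measurableT_comp; [exact: L2_measurable Lu|exact: measurable_pair1].
apply: le_lt_trans h; rewrite le_eqVlt; apply/orP; left; apply/eqP.
by apply: eq_integral => x _ /=; rewrite -expr2 ger0_norm ?sqr_ge0.
Qed.

Lemma measurable_tensor (phi : T1 -> R) (v : T2 -> R) : measurable_fun setT phi ->
  measurable_fun setT v -> measurable_fun setT (fun z : T1 * T2 => phi z.1 * v z.2).
Proof. by move=> mp mv; apply: measurable_funM; exact: measurableT_comp. Qed.

Lemma L2_tensor (phi : T1 -> R) (v : T2 -> R) : L2 m1 phi -> L2 m2 v ->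
  L2 P (fun z => phi z.1 * v z.2).
Proof.
move=> Lp Lv; have /L2P[mp fp] := Lp; have /L2P[mv fv] := Lv.
have mt := measurable_tensor mp mv.
apply/L2P; split => //; rewrite fubini_tonelli1; last 2 first.
- by apply/measurable_EFinP; exact: measurable_funX.
- by move=> z; rewrite lee_fin sqr_ge0.
rewrite (eq_integral (fun t => (ip m2 v v)%:E * ((phi t) ^+ 2)%:E)%E).
  rewrite ge0_integralZl//.
  - by rewrite lte_mul_pinfty ?lee_fin ?ip_ge0.
  - by apply/measurable_EFinP; exact: measurable_funX.
  - by move=> t _; rewrite lee_fin sqr_ge0.
  - by rewrite lee_fin ip_ge0.
move=> t _; rewrite /fubini_F ipE// muleC -ge0_integralZl//.
- by apply: eq_integral => x _; rewrite /= -EFinM exprMn [in RHS]expr2.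
- by apply/measurable_EFinP; exact: measurable_funM.
- by move=> x _; rewrite lee_fin -expr2 sqr_ge0.
- by rewrite lee_fin sqr_ge0.
Qed.

Lemma ip_tensor (phi psi : T1 -> R) (v w : T2 -> R) : L2 m1 phi -> L2 m1 psi ->
  L2 m2 v -> L2 m2 w ->
  ip P (fun z => phi z.1 * v z.2) (fun z => psi z.1 * w z.2) = ip m1 phi psi * ip m2 v w.
Proof.
move=> Lp Lq Lv Lw; have [_ E] := fubini_ip (L2_tensor Lp Lv) (L2_tensor Lq Lw).
apply: EFin_inj; rewrite -E /= mulrC EFinM (ipE Lp Lq) -integralZl//; last exact: ip_integrable.
apply: eq_integral => t _; rewrite -EFinM; congr EFin.
rewrite ipZl//; last exact: L2Z.
by rewrite ipZr//; ring.
Qed.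

End fubini.

Section time_measure.
Context (R : realType) (T : R) (hT : 0 < T).
Implicit Types f g : R -> R.

Lemma leb_lty : (leb T setT < +oo)%E.
Proof.
rewrite /leb /= /mrestr setTI lebesgue_measure_itv/= lte_fin; case: ifP => _; last exact: ltry.
by rewrite -EFinB ltry.
Qed.

Let leb_fin : fin_num_fun (leb T).
Proof.
move=> A mA; rewrite ge0_fin_numE//; apply: le_lt_trans leb_lty.
by apply: le_measure => //; rewrite inE.
Qed.

Definition lebf : {finite_measure set (measurableTypeR R) -> \bar R} :=
  HB.pack (Measure.sort (leb T)) (Measure_isFinite.Build _ _ _ (leb T) leb_fin).

Lemma integral_leb (f : R -> \bar R) : measurable_fun setT f ->
  (\int[leb T]_t f t = \int[lebesgue_measure]_(t in `[0%R, T]) f t)%E.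
Proof.
move=> mf; have m01 := @measurable_itv R `[0, T].
transitivity (\int[leb T]_(t in `[0%R, T]) f t)%E.
  rewrite [RHS]integral_mkcond; apply: ae_eq_integral => //.
    by apply/(measurable_restrictT _ m01); exact: measurable_funS mf.
  exists (~` `[0%R, T]); split; first exact: measurableC.
    by rewrite /= /mrestr setICl measure0.
  move=> t /= nt t01; apply: nt => _; rewrite patchE mem_set//.
apply: eq_measure_integral => A mA A01 /=.
by rewrite /mrestr setIidl.
Qed.

Lemma measurable_continuous f : continuous f -> measurable_fun setT (f : measurableTypeR R -> R).
Proof. by move=> cf; exact: continuous_measurable_fun. Qed.

Lemma integral_leb_continuous f : continuous f -> (\int[leb T]_t (f t)%:E = (intg f 0 T)%:E)%E.
Proof.
move=> cf; rewrite integral_leb; last by apply/measurable_EFinP; exact: measurable_continuous.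
have cp := is_derive_continuous (fun t => prim_is_derive t cf).
rewrite (@continuous_FTC2 _ f (prim f) _ _ hT)//.
- exact: continuous_subspaceT.
- split.
  + by move=> t _; have [] := prim_is_derive t cf.
  + by apply: cvg_at_right_filter; exact: cp.
  + by apply: cvg_at_left_filter; exact: cp.
- by move=> t _; rewrite derive1E; have [_ ->] := prim_is_derive t cf.
Qed.

Lemma L2_continuous f : continuous f -> f \in Lfun (leb T) 2%:E.
Proof.
move=> cf; apply/L2P; split; first exact: measurable_continuous.
by rewrite (@integral_leb_continuous (fun t => f t ^+ 2)) ?ltry//; exact: continuous_sqr.
Qed.

Lemma ip_leb f g : continuous f -> continuous g -> ip (leb T) f g = tip T f g.
Proof.
move=> cf cg; apply: EFin_inj; rewrite ipE; [|exact: L2_continuous..].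
by rewrite (@integral_leb_continuous (fun t => f t * g t))//; exact: contM.
Qed.

End time_measure.

Section spacetime.
Context (R : realType) (T : R) (hT : 0 < T) d (S : measurableType d) (mu : probability S R).
Local Notation P := (leb T \x mu)%E.
Implicit Types (u w : measurableTypeR R * S -> R) (phi psi : R -> R) (v : S -> R).

Lemma L2T_tensor phi v : continuous phi -> v \in Lfun mu 2%:E ->
  (fun z : measurableTypeR R * S => phi z.1 * v z.2) \in Lfun P 2%:E.
Proof. by move=> cp; exact: (@L2_tensor R _ _ _ _ (lebf T) mu phi v (L2_continuous hT cp)). Qed.

Lemma ipT_tensor phi psi v v' : continuous phi -> continuous psi ->
  v \in Lfun mu 2%:E -> v' \in Lfun mu 2%:E ->
  ip P (fun z => phi z.1 * v z.2) (fun z => psi z.1 * v' z.2) = tip T phi psi * ip mu v v'.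
Proof.
move=> cp cq Lv Lv'; rewrite -(ip_leb hT)//.
exact: (@ip_tensor R _ _ _ _ (lebf T) mu phi psi v v' (L2_continuous hT cp) (L2_continuous hT cq)).
Qed.

Lemma fubini_ipT u w : u \in Lfun P 2%:E -> w \in Lfun P 2%:E ->
  let b t := ip mu (fun x => u (t, x)) (fun x => w (t, x)) in
  measurable_fun setT b /\ (\int[leb T]_t (b t)%:E = (ip P u w)%:E)%E.
Proof. exact: (@fubini_ip R _ _ _ _ (lebf T) mu). Qed.

Lemma fiber_L2T u : u \in Lfun P 2%:E -> {ae leb T, forall t, (fun x => u (t, x)) \in Lfun mu 2%:E}.
Proof. exact: (@fiber_L2 R _ _ _ _ (lebf T) mu). Qed.

Lemma spacetime_lty : (P setT < +oo)%E.
Proof.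
rewrite -setXTT (@product_measure1E _ _ _ _ _ (leb T) mu)//.
apply: lte_mul_pinfty => //; first by rewrite ge0_fin_numE//; exact: leb_lty.
by apply: le_lt_trans (probability_le1 mu measurableT) _; rewrite ltry.
Qed.

End spacetime.

Lemma le1_2e (R : realType) : (1 <= 2%:E :> \bar R)%E.
Proof. by rewrite lee_fin ler1n. Qed.

(** * Representing c as Q(Z) w by means of resolvents *)

Section chain.
Context (R : realType) (dS : measure_display) (S : measurableType dS)
  (mu : probability S R) (L : (S -> R) -> (S -> R) -> Prop).
Hypothesis hL : dissipative_symmetric mu L.
Hypothesis hspec : purely_discrete_spectrum mu L.
Variable (m : R).
Hypothesis m0 : 0 < m.
Hypothesis hp : poincare mu L m.
Local Notation L2 f := (f \in Lfun mu 2%:E).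
Local Notation ip := (ip mu).
Local Notation nrm := (nrm mu).

(** The elements are functions and not classes, so [ip] is only semidefinite here; this is all that
    the section on moments assumes. *)
Definition L2V := LfunType mu (@le1_2e R).
Implicit Types u v w c : L2V.

Let mu_fin : (mu setT < +oo)%E.
Proof. by rewrite probability_setT ltry. Qed.

Lemma L2V_L2 u : L2 (u : S -> R).
Proof. exact: LfunP. Qed.

Definition vec (f : S -> R) (h : L2 f) : L2V := Lfun_Sub (le1_2e R) h.

Lemma vip_lin (a : R) u v (w : S -> R) : L2 w -> ip (a *: u + v : L2V) w = a * ip u w + ip v w.
Proof.
move=> Lw; rewrite -ipZl//; last exact: L2V_L2.
by rewrite -ipDl//; [exact: L2Z (L2V_L2 u)|exact: L2V_L2].
Qed.

(* Z = X - 6 with X = - (6 / m) L, which is >= 6 on mean-zero functions by the Poincare inequality. *)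
Definition Zop u v := mean mu u = 0 /\ L u (fun x => - (m / 6) * (v x + 6 * u x)).

Lemma Zop_lin (a : R) u v u' v' : Zop u v -> Zop u' v' -> Zop (a *: u + u') (a *: v + v').
Proof.
move=> [h1 h2] [h1' h2']; split.
  rewrite meanE; apply: etrans (vip_lin a u u' (L2_cst mu_fin 1)) _.
  by rewrite -!meanE h1 h1' mulr0 addr0.
have := op_lin hL a h2 h2'; congr L.
apply/funext => x; apply: (@etrans _ _ (- (m / 6) * (a * v x + v' x + 6 * (a * u x + u' x)))) => //.
ring.
Qed.

Lemma Zop_0 : Zop 0 0.
Proof.
split; first by rewrite meanE; exact: ip0l.
have := op_cst hL 0; congr L.
by apply/funext => x; rewrite -![(0 : L2V) x]/(0 : R); ring.
Qed.

Let ip_Zop u v (w : S -> R) : L2 w -> ip (fun x => - (m / 6) * (v x + 6 * u x)) w =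
  - (m / 6) * (ip v w + 6 * ip u w).
Proof.
move=> Lw; have Lu := L2V_L2 u; have Lv := L2V_L2 v; have Lu6 := L2Z 6 Lu.
by rewrite ipZl//; [rewrite ipDl// ipZl|exact: L2D].
Qed.

Lemma Zop_sym u v u' v' : Zop u v -> Zop u' v' -> ip v u' = ip u v'.
Proof.
move=> [_ h2] [_ h2']; have := op_sym hL h2 h2'.
rewrite (ip_Zop u v (L2V_L2 u')) [X in _ = X -> _]ipC (ip_Zop u' v' (L2V_L2 u)).
rewrite (ipC _ v' u) (ipC _ u' u).
have : - (m / 6) != 0 by rewrite oppr_eq0 gt_eqF// divr_gt0.
by move=> n0 /(mulfI n0) /addIr.
Qed.

(** The Poincare inequality m |u|^2 <= - <u, L u>, where the right-hand side is (m / 6) (<Z u, u> +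
    6 |u|^2). *)
Lemma Zop_pos u v : Zop u v -> 0 <= ip v u.
Proof.
move=> [h1 h2]; have := poincare_op hL m0 hp h2 h1.
rewrite ipC (ip_Zop u v (L2V_L2 u)) mulNr opprK mulrDr mulrA divfK// addrC lerDl.
by rewrite pmulr_rge0// divr_gt0.
Qed.

(** Here u solves (1 + l X) u = w, that is, u - (6 l / m) L u = w. It inherits mean zero from w
    because L u has mean zero. *)
Lemma Zop_resolvent l w : 0 < l -> mean mu w = 0 ->
  exists u, Zop u (l^-1 *: (w - (1 + 6 * l) *: u)).
Proof.
move=> l0 w0; have l60 : 0 < 6 * l / m by rewrite divr_gt0// mulr_gt0.
have [u [v [h E]]] := resolvent_pos hL hspec l60 (L2V_L2 w).
have Lu := op_L2l hL h; have Lv := op_L2r hL h; have Lw := L2V_L2 w.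
exists (vec Lu).
set z := _ *: _.
have zE x : z x = l^-1 * (w x - (1 + 6 * l) * u x) by [].
split.
  have := op_mean hL h; rewrite !meanE => v0.
  have : ip (fun x => u x - 6 * l / m * v x) (fun=> 1) = ip w (fun=> 1).
    by apply: ip_ae => //; [apply: L2B => //; exact: L2Z|exact: L2_cst].
  have Lv1 := L2Z (6 * l / m) Lv; have L1 := L2_cst mu_fin 1.
  by rewrite ipBl// ipZl// v0 mulr0 subr0 => ->; rewrite -meanE.
apply: (op_ae hL h) => //.
  by apply: L2Z; apply: L2D; [exact: L2V_L2|exact: L2Z].
  exact: ae_eq_refl.
apply: filterS E => x /= /(_ I) E _.
apply: (@etrans _ _ (- (m / 6) * (l^-1 * (w x - (1 + 6 * l) * u x) + 6 * u x))) => //.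
by rewrite -E; field; rewrite !gt_eqF.
Qed.

(* Every c in the domain of Z is of the form q(Z) w. *)
Definition chainable (q : {poly R}) (N : nat) := (size q <= N.+1)%N /\
  forall c c', Zop c c' -> exists W : nat -> L2V,
    (forall k, (k <= N)%N -> Zop (W k) (W k.+1)) /\ c = \sum_(k < N.+2) q`_k *: W k.

Lemma chainable1 : chainable 1 0.
Proof.
split; first by rewrite size_polyC oner_eq0.
move=> c c' h; exists (fun k => if k is 0%N then c else c'); split; first by case.
by rewrite !big_ord_recl big_ord0/= !coefC/= scale1r scale0r !addr0.
Qed.

(** A resolvent gains one application of Z: solving (1 + l X) w' = w turns a chain of powers of Z on
    w into a longer one on w'. *)
Lemma chainableM l q N : 0 < l -> chainable q N -> chainable ((1 + l%:P * ('X + 6)) * q) N.+1.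
Proof.
move=> l0 [sq hq].
have E6 : 6 = 6%:P :> {poly R} by rewrite -polyC_natr.
have sE : (1 + l%:P * ('X + 6)) * q = (1 + 6 * l) *: q + l *: (q * 'X).
  by rewrite -!mul_polyC polyCD polyCM E6; ring.
split.
  rewrite sE; apply: leq_trans (size_polyD _ _) _; rewrite geq_max; apply/andP; split.
    by apply: leq_trans (size_scale_leq _ _) _; apply: leq_trans sq _.
  apply: leq_trans (size_scale_leq _ _) _; apply: leq_trans (size_polyMleq _ _) _.
  by rewrite size_polyX addn2.
move=> c c' h; have [W [ZW cE]] := hq c c' h.
have [u hu] := Zop_resolvent l0 (ZW 0%N (leq0n _)).1.
(* The chain is forced by its start: W_k = (1 + 6 l) W'_k + l W'_(k+1) determines W'_(k+1). That
   these are successive powers of Z follows from linearity, without solving any further equation. *)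
pose W' := fix W' k := if k is k'.+1 then l^-1 *: (W k' - (1 + 6 * l) *: W' k') else u.
have rec k : W k = (1 + 6 * l) *: W' k + l *: W' k.+1.
  by rewrite /= scalerA divff ?gt_eqF// scale1r addrC subrK.
exists W'; split.
  elim=> [|k IH] kN; first exact: hu.
  have h1 := IH (ltnW kN); have h2 := ZW k kN.
  have -> : W' k.+1 = (l^-1 *: W k + (- (l^-1 * (1 + 6 * l))) *: W' k + 0).
    by rewrite addr0 /= scalerBr scalerA scaleNr.
  have -> : W' k.+2 = (l^-1 *: W k.+1 + (- (l^-1 * (1 + 6 * l))) *: W' k.+1 + 0).
    by rewrite addr0 [LHS]/= scalerBr scalerA scaleNr.
  by rewrite -!addrA; apply: Zop_lin => //; apply: Zop_lin => //; exact: Zop_0.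
rewrite cE sE; clearbody W'; under eq_bigr do rewrite rec scalerDr !scalerA.
under [RHS]eq_bigr do rewrite coefD !coefZ scalerDl.
rewrite !big_split/=; congr (_ + _).
  rewrite [RHS]big_ord_recr/= nth_default ?mulr0 ?scale0r ?addr0; last exact: leq_trans sq _.
  by apply: eq_bigr => k _; rewrite mulrC.
rewrite [RHS]big_ord_recl/= coefMX eqxx mulr0 scale0r add0r.
by apply: eq_bigr => k _; rewrite coefMX/= mulrC.
Qed.

Lemma chainable_polQ J : chainable (polQ R J) (3 * J.+1).
Proof.
rewrite /polQ; elim: J.+1 => [|n IH]; first by rewrite big_ord0; exact: chainable1.
rewrite big_ord_recr/= mulnS mulrC /polU /polY /polX !exprS expr0 mulr1 -!mulrA.
have l0 : 0 < 4 ^- n :> R by rewrite invr_gt0 exprn_gt0.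
exact: chainableM l0 (chainableM l0 (chainableM l0 IH)).
Qed.

End chain.

(** * Corrections at fixed level *)

Section gram.
Context (R : realType) (T : R) (hT : 0 < T).
Implicit Types f g h : R -> R.

Lemma tipBl f g h : continuous f -> continuous g -> continuous h ->
  tip T (fun t => f t - g t) h = tip T f h - tip T g h.
Proof.
move=> cf cg ch; rewrite /tip -[X in _ - X]mul1r -mulNr -intgZ; last exact: contM.
rewrite -intgD; [|exact: contM|by apply: contZ; exact: contM].
by congr intg; apply/funext => t; ring.
Qed.

Lemma psd_gram n (F : 'I_n -> R -> R) : (forall i, continuous (F i)) ->
  psd (fun i l => tip T (F i) (F l)).
Proof.
move=> cF; split; first by move=> i l; rewrite tipC.
move=> c; rewrite -tip_sum//; apply: tip_ge0 => //.
by apply: cont_sum => i; exact: contZ.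
Qed.

Context n (F : 'I_n -> R -> R) (cF : forall i, continuous (F i)).

Lemma psd_gram_sub (A B : (R -> R) -> (R -> R)) b : time_op T b A -> time_op T b B ->
  psd (fun i l => tip T (A (F i)) (A (F l)) + tip T (B (F i)) (B (F l)) -
    (tip T (A (F i)) (B (F l)) + tip T (B (F i)) (A (F l)))).
Proof.
move=> hA hB; have cA i := top_cont hA (@cF i); have cB i := top_cont hB (@cF i).
have := psd_gram (fun i => contB (cA i) (cB i)); congr psd.
apply/funext => i; apply/funext => l; rewrite tipBl//; last exact: contB.
by rewrite !(tipC _ _ (fun t => _ - _)) !tipBl// !(tipC _ _ (_ (F i))); ring.
Qed.

(** The operator inequality A* A <= b, read on combinations of the phi_i. *)
Lemma psd_gram_le (A : (R -> R) -> (R -> R)) b : time_op T b A ->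
  psd (fun i l => b * tip T (F i) (F l) - tip T (A (F i)) (A (F l))).
Proof.
move=> hA; have cA i := top_cont hA (@cF i); split.
  by move=> i l; rewrite tipC [X in _ - X]tipC.
move=> c; have := top_le hA (cont_sum (fun i => contZ (c := c i) (@cF i))).
rewrite (top_sum _ hA)// !tip_sum// mulr_sumr -subr_ge0 -sumrB; congr (0 <= _).
apply: eq_bigr => i _; rewrite mulr_sumr -sumrB; apply: eq_bigr => l _; ring.
Qed.

End gram.

Section estimate.
Context (R : realType) (dS : measure_display) (S : measurableType dS)
  (mu : probability S R) (L : (S -> R) -> (S -> R) -> Prop).
Hypothesis hL : dissipative_symmetric mu L.
Variable (m : R).
Hypothesis m0 : 0 < m.
Hypothesis hp : poincare mu L m.
Variables (T : R) (hT : 0 < T).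
Local Notation P := (leb T \x mu)%E.
Local Notation L2 mu f := (f \in Lfun mu 2%:E).
Local Notation V := (L2V mu).
Local Notation ST := (measurableTypeR R * S)%type.

Definition dsum J n (f : 'I_J -> 'I_n -> R -> R) (v : 'I_J -> 'I_n -> S -> R) (z : ST) : R :=
  \sum_j \sum_i f j i z.1 * v j i z.2.

Section dsum.
Variables (J n : nat) (f f' : 'I_J -> 'I_n -> R -> R) (v v' : 'I_J -> 'I_n -> S -> R).
Hypothesis cf : forall j i, continuous (f j i).
Hypothesis Lv : forall j i, L2 mu (v j i).
Hypothesis cf' : forall j i, continuous (f' j i).
Hypothesis Lv' : forall j i, L2 mu (v' j i).

Lemma L2_dsum : L2 P (dsum f v).
Proof. by apply: L2_sum => j; apply: L2_sum => i; exact: L2T_tensor. Qed.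

Lemma ip_dsum : ip P (dsum f v) (dsum f' v') =
  \sum_j \sum_k \sum_i \sum_l tip T (f j i) (f' k l) * ip mu (v j i) (v' k l).
Proof.
have L1 j i := L2T_tensor hT (@cf j i) (@Lv j i).
have L1' j i := L2T_tensor hT (@cf' j i) (@Lv' j i).
have L2j' j := L2_sum (L1' j).
rewrite (ip_suml (fun j => L2_sum (L1 j)) (L2_sum L2j')); apply: eq_bigr => j _.
rewrite ipC (ip_suml L2j' (L2_sum (L1 j))); apply: eq_bigr => k _.
rewrite ipC (ip_suml (L1 j) (L2j' k)); apply: eq_bigr => i _.
rewrite ipC (ip_suml (L1' k) (L1 j i)); apply: eq_bigr => l _.
by rewrite ipC; exact: ipT_tensor.
Qed.

End dsum.

Variables (n N : nat) (phi : 'I_n -> R -> R) (W : 'I_n -> nat -> V).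
Hypothesis cphi : forall i, continuous (phi i).
Hypothesis ZW : forall i k, (k <= N)%N -> Zop L m (W i k) (W i k.+1).

Let vip (u v : V) := ip mu u v.
Let vip_linear (a : R) (u v w : V) : vip (a *: u + v) w = a * vip u w + vip v w.
Proof. exact: vip_lin (L2V_L2 w). Qed.
Let vip_sym (u v : V) : vip u v = vip v u. Proof. exact: ipC. Qed.
Let vip_pos (u : V) : 0 <= vip u u. Proof. exact: ip_ge0. Qed.

Definition op_gram := Lam vip N W.
Definition time_gram (i l : 'I_n) := tip T (phi i) (phi l).

(** The choice r = 1 gives square norms, and r = X gives energies up to a multiple. *)
Lemma dsum_le J (A : 'I_J -> (R -> R) -> (R -> R)) (kap : 'I_J -> {poly R}) (r q : {poly R}) b :
  0 <= b -> (forall j, time_op T b (A j)) -> (forall j, cone (kap j)) -> cone r ->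
  (forall j, (size (kap j) <= N.+2)%N) -> (forall j, (size (r * kap j)%R <= N.+2)%N) ->
  cone (q - r * (\sum_j kap j) ^+ 2) ->
  ip P (dsum (fun j i => A j (phi i)) (fun j i => poly_act N W i (kap j)))
       (dsum (fun j i => A j (phi i)) (fun j i => poly_act N W i (r * kap j))) <= b * op_gram time_gram q.
Proof.
move=> b0 hA ck cr s1 s2 cq; have cA j i := top_cont (hA j) (@cphi i).
rewrite ip_dsum//; try by move=> *; exact: L2V_L2.
have h := @dyadic_form_le R V vip (Zop L m) vip_linear vip_sym vip_pos
  (Zop_lin hL (m:=m)) (Zop_0 hL m) (Zop_sym hL m0) (Zop_pos hL m0 hp) n N W ZW J
  (fun j k i l => tip T (A j (phi i)) (A k (phi l))) time_gram kap r q b ck cr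
  (fun j k => psd_gram_sub hT cphi (hA j) (hA k)) (fun j => psd_gram_le cphi (hA j))
  (psd_gram hT cphi) b0 cq.
apply: le_trans h; rewrite le_eqVlt; apply/orP; left; apply/eqP.
apply: eq_bigr => j _; apply: eq_bigr => k _.
rewrite mulrCA.
exact: (act_form vip_linear vip_sym (Zop_sym hL m0) ZW _ (s1 j) (s2 k)).
Qed.

Definition tsum (v : 'I_n -> S -> R) (z : ST) : R := \sum_i phi i z.1 * v i z.2.

Lemma L2_tsum (v : 'I_n -> S -> R) : (forall i, L2 mu (v i)) -> L2 P (tsum v).
Proof. by move=> Lv; apply: L2_sum => i; exact: L2T_tensor. Qed.

Lemma Lm_sqr (q : {poly R}) : (size q <= N.+2)%N ->
  ip P (tsum (poly_act N W ^~ q)) (tsum (poly_act N W ^~ q)) = op_gram time_gram (q ^+ 2).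
Proof.
move=> sq; rewrite expr2 /op_gram.
rewrite -(act_form vip_linear vip_sym (Zop_sym hL m0) ZW _ sq sq).
have L1 i := L2T_tensor hT (@cphi i) (L2V_L2 (poly_act N W i q)).
rewrite (ip_suml L1 (L2_sum L1)); apply: eq_bigr => i _.
rewrite ipC (ip_suml L1 (L1 i)); apply: eq_bigr => l _.
rewrite ipC; apply: ipT_tensor => //; exact: L2V_L2.
Qed.

Lemma act_Xp i p x : poly_act N W i (polX R * p) x = poly_act N W i ('X * p) x + 6 * poly_act N W i p x.
Proof.
have -> : polX R * p = 'X * p + 6 *: p.
  by rewrite /polX mulrDl -mul_polyC -polyC_natr.
by rewrite actD actZ.
Qed.

Lemma act_op i (p : {poly R}) : (size p <= N.+1)%N ->
  L (poly_act N W i p) (fun x => - (m / 6) * poly_act N W i (polX R * p) x).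
Proof.
move=> sp; have [_ h] := actZr (Zop_lin hL (m:=m)) (Zop_0 hL m) ZW i sp.
by have := h; congr L; apply/funext => x; rewrite act_Xp.
Qed.

Lemma Lm_le q q' : cone (q' - q) -> op_gram time_gram q <= op_gram time_gram q'.
Proof.
move=> c; rewrite -subr_ge0 /op_gram -LamB.
exact: (Lam_pos vip_linear vip_sym vip_pos (Zop_lin hL (m:=m)) (Zop_0 hL m)
  (Zop_sym hL m0) (Zop_pos hL m0 hp) ZW (psd_gram hT cphi) c).
Qed.

End estimate.

(** * Test functions and functions approximable by them *)

Section nice.
Context (R : realType) (d : nat) (S : set 'rV[R]_d) (x0 : S)
  (mu : probability (state x0) R)
  (L : (state x0 -> R) -> (state x0 -> R) -> Prop) (T : R).
Hypothesis hL : dissipative_symmetric mu L.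
Hypothesis hT : 0 < T.
Hypothesis hcore : operator_core mu L
       [set v : state x0 -> R | smooth_space v /\ v \in Lfun mu 2%:E].
Local Notation ST := (measurableTypeR R * state x0)%type.
Local Notation nrmT := (nrm (lebmu mu T)).
Local Notation ipT := (ip (lebmu mu T)).
Implicit Types (U W : nat -> ST -> R) (psi : R -> R) (v w : state x0 -> R).

(* U 0, U 1, U 2, U 3, U 4 stand for u, d_t u, d_tt u, L u, L d_t u. *)
Record nice U : Prop := {
  nice_L2 : forall i, L2T mu T (U i);
  nice_test : test_function mu T (U 0%N);
  nice_dt : is_dt T (U 0%N) (U 1%N);
  nice_dtt : is_dt T (U 1%N) (U 2%N);
  nice_op : forall t, L (fun x => U 0%N (t, x)) (fun x => U 3%N (t, x));
  nice_opt : forall t, L (fun x => U 1%N (t, x)) (fun x => U 4%N (t, x));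
  nice_mean : ipT (U 1%N) (fun=> 1) = 0 }.

Let L2T1 : L2T mu T (fun=> 1).
Proof. by apply: L2_cst; exact: spacetime_lty. Qed.

Lemma nice0 : nice (fun _ _ => 0).
Proof.
split.
- by move=> i; exact: L2_0.
- by split; [exact: smooth_spacetime0|exact: L2_0|].
- by move=> t x _; exact: is_derive_cst.
- by move=> t x _; exact: is_derive_cst.
- by move=> t; exact: op_cst hL 0.
- by move=> t; exact: op_cst hL 0.
- exact: ip0l.
Qed.

Lemma nice_lin (a : R) U W : nice U -> nice W -> nice (fun i z => a * U i z + W i z).
Proof.
move=> [u1 [u2 u2' u2''] u3 u4 u5 u6 u7] [w1 [w2 w2' w2''] w3 w4 w5 w6 w7].
have LL i : L2T mu T (fun z => a * U i z + W i z) := L2D (L2Z a (u1 i)) (w1 i).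
split => //.
- split => //; first exact: smooth_spacetime_lin.
  by move=> x; have [-> ->] := u2'' x; have [-> ->] := w2'' x; rewrite mulr0 addr0.
- by move=> t x t0; exact: (is_deriveD (is_deriveZ a (u3 t x t0)) (w3 t x t0)).
- by move=> t x t0; exact: (is_deriveD (is_deriveZ a (u4 t x t0)) (w4 t x t0)).
- by move=> t; exact: (op_lin hL a (u5 t) (w5 t)).
- by move=> t; exact: (op_lin hL a (u6 t) (w6 t)).
- have h := u1 1%N; have h' := w1 1%N; have h1 := L2Z a h.
  by rewrite (ipDl h1 h' L2T1) (ipZl a h L2T1) u7 w7 mulr0 addr0.
Qed.

(** The time factor of the i-th component in the numbering of [nice]; the default case covers 0, 3
    and all indices above 4. *)
Definition jet psi (i : nat) : R -> R :=
  match i with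
  | 1%N | 4%N => derive1 psi
  | 2%N => derive1 (derive1 psi)
  | _ => psi
  end.

Definition jet_tensor psi v w (i : nat) (z : ST) : R :=
  jet psi i z.1 * (if (i < 3)%N then v else w) z.2.

Lemma smooth_jet psi i : smooth psi -> smooth (jet psi i).
Proof.
move=> sp; have s1 := smooth_derive sp; have s2 := smooth_derive s1.
by case: i => [|[|[|[|[|i]]]]].
Qed.

Lemma nice_tensor psi v w : smooth psi -> psi 0 = 0 -> psi T = 0 ->
  smooth_space v -> L v w -> nice (jet_tensor psi v w).
Proof.
move=> sp p0 pT sv h; have Lv := op_L2l hL h; have Lw := op_L2r hL h.
have LL i : L2T mu T (jet_tensor psi v w i).
  apply: L2T_tensor => //; first exact/smooth_continuous/smooth_jet.
  by case: ifP.
have dd (f : R -> R) (c t : R) : smooth f -> is_derive t (1 : R) (fun s => f s * c) (derive1 f t * c).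
  move=> sf; have h1 := is_deriveM (smooth_is_derive t sf) (is_derive_cst c t 1).
  by refine (is_derive_eq h1 _); rewrite scaler0 add0r mulrC.
have s1 := smooth_derive sp.
split => //.
- split => //; first exact: smooth_spacetime_tensor.
  by move=> x; rewrite /jet_tensor /= p0 pT !mul0r.
- by move=> t x _; exact: (dd psi (v x) t sp).
- by move=> t x _; exact: (dd (derive1 psi) (v x) t s1).
- by move=> t; exact: (op_scale hL (psi t) h).
- by move=> t; exact: (op_scale hL (derive1 psi t) h).
- have L1 : (fun=> 1) \in Lfun mu 2%:E.
    exact: (op_L2l hL (op_cst hL 1)).
  have c1 : continuous (fun _ : R => 1 : R).
    by move=> t; exact: cvg_cst.
  have -> : (fun=> 1) = (fun z : ST => (fun _ : R => 1) z.1 * (fun _ : state x0 => 1 : R) z.2) by apply/funext => z; rewrite mulr1.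
  apply: etrans (ipT_tensor hT (smooth_continuous s1) c1 Lv L1) _.
  rewrite /tip; under [X in intg X]eq_fun do rewrite mulr1.
  by rewrite (intgE 0 T (fun t => smooth_is_derive t sp)) ?p0 ?pT ?subrr ?mul0r//; exact: smooth_continuous.
Qed.

(** Corrections built from resolvents lie in the domain of L but need not be smooth in x. This is
    the substitute: all components are simultaneously close in L^2 to those of a test function. *)
Record app U : Prop := {
  app_L2 : forall i, L2T mu T (U i);
  app_op : forall t, L (fun x => U 0%N (t, x)) (fun x => U 3%N (t, x));
  app_nice : forall e : R, 0 < e ->
    exists W, nice W /\ forall i, nrmT (fun z => U i z - W i z) <= e }.

Lemma app_lin (a : R) U W : app U -> app W -> app (fun i z => a * U i z + W i z).
Proof.
move=> [u1 u3 u2] [w1 w3 w2]; split.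
- by move=> i; apply: L2D; [apply: L2Z; exact: u1|exact: w1].
- by move=> t; exact: (op_lin hL a (u3 t) (w3 t)).
move=> e e0; have a0 : 0 < `|a| + 1 by rewrite ltr_wpDl.
have [U' [nU hU]] := u2 _ (divr_gt0 e0 a0); have [W' [nW hW]] := w2 _ (divr_gt0 e0 a0).
exists (fun i z => a * U' i z + W' i z); split; first exact: nice_lin.
move=> i; have -> : (fun z => a * U i z + W i z - (a * U' i z + W' i z)) =
    (fun z => a * (U i z - U' i z) + (W i z - W' i z)) by apply/funext => z; ring.
have LU := L2B (u1 i) (nice_L2 nU i); have LW := L2B (w1 i) (nice_L2 nW i).
apply: le_trans (nrmD (L2Z a LU) LW) _; rewrite (nrmZ a LU).
apply: le_trans (lerD (ler_wpM2l (normr_ge0 a) (hU i)) (hW i)) _.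
by rewrite le_eqVlt; apply/orP; left; apply/eqP; field; rewrite gt_eqF.
Qed.

Lemma app0 : app (fun _ _ => 0).
Proof.
split.
- by move=> i; exact: L2_0.
- by move=> t; exact: op_cst hL 0.
move=> e e0; exists (fun _ _ => 0); split; first exact: nice0.
by move=> i; under eq_fun do rewrite subrr; rewrite nrm0 ltW.
Qed.

Lemma app_add U W : app U -> app W -> app (fun i z => U i z + W i z).
Proof.
move=> aU aW; have := app_lin 1 aU aW; congr app.
by apply/funext => i; apply/funext => z; rewrite mul1r.
Qed.

Lemma app_sum n (F : 'I_n -> nat -> ST -> R) : (forall k, app (F k)) ->
  app (fun i z => \sum_(k < n) F k i z).
Proof.
elim: n F => [|n IH] F aF.
  by under eq_fun do under eq_fun do rewrite big_ord0; exact: app0.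
under eq_fun do under eq_fun do rewrite big_ord_recl.
by apply: app_add => //; exact: IH.
Qed.

Let le_sum3 (a b c : R) : 0 <= a -> 0 <= b -> 0 <= c ->
  [/\ 0 < a + b + c + 1, a <= a + b + c + 1, b <= a + b + c + 1 & c <= a + b + c + 1].
Proof. by move=> *; split; lra. Qed.

(** The core property replaces v by a smooth v' with both v' and L v' close; the time factor is
    kept, so the boundary values stay zero. *)
Lemma app_tensor psi v w : smooth psi -> psi 0 = 0 -> psi T = 0 -> L v w ->
  app (jet_tensor psi v w).
Proof.
move=> sp p0 pT h; have Lv := op_L2l hL h; have Lw := op_L2r hL h.
have cj i : continuous (jet psi i) by exact/smooth_continuous/smooth_jet.
have Lvw (i : nat) : (if (i < 3)%N then v else w) \in Lfun mu 2%:E by case: ifP.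
split.
- by move=> i; exact: L2T_tensor.
- by move=> t; exact: (op_scale hL (psi t) h).
move=> e e0.
(* A bound uniform in the index exists because only psi and its first two derivatives occur as time
   factors. *)
have [K K0 hK] : exists2 K, 0 < K & forall i, Num.sqrt (tip T (jet psi i) (jet psi i)) <= K.
  pose q i := Num.sqrt (tip T (jet psi i) (jet psi i)).
  have q0 i : 0 <= q i by exact: sqrtr_ge0.
  have qE i : Num.sqrt (tip T (jet psi i) (jet psi i)) = q i by [].
  have q3 i : q i.+3 = if i == 1%N then q 1%N else q 0%N by case: i => [|[|i]].
  clearbody q; have [q123 h0 h1 h2] := le_sum3 (q0 0%N) (q0 1%N) (q0 2%N).
  exists (q 0%N + q 1%N + q 2%N + 1) => //.
  by move=> i; rewrite qE; case: i => [|[|[|i]]]; rewrite ?q3//; case: ifP.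
have [v' [w' [[sv' Lv'] h' lt]]] := hcore h (divr_gt0 e0 K0).
have Lw' := op_L2r hL h'.
exists (jet_tensor psi v' w'); split; first exact: nice_tensor.
move=> i.
have lt' : nrm mu (fun x => (if (i < 3)%N then v else w) x - (if (i < 3)%N then v' else w') x) <= e / K.
  move: lt; rewrite !L2norm_nrm; [|exact: L2B..]; rewrite -EFinD lte_fin.
  move=> /ltW; apply: le_trans; case: ifP => _; first by rewrite lerDl nrm_ge0.
  by rewrite lerDr nrm_ge0.
have LB : (fun x => (if (i < 3)%N then v else w) x - (if (i < 3)%N then v' else w') x) \in Lfun mu 2%:E.
  by apply: L2B => //; case: ifP.
have -> : (fun z => jet_tensor psi v w i z - jet_tensor psi v' w' i z) =
    (fun z => jet psi i z.1 * ((fun x => (if (i < 3)%N then v else w) x -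
       (if (i < 3)%N then v' else w') x) z.2)).
  by apply/funext => z; rewrite /jet_tensor mulrBr.
rewrite {1}/nrm; have -> := ipT_tensor hT (cj i) (cj i) LB LB.
rewrite sqrtrM; last exact: tip_ge0.
have -> : e = K * (e / K) by field; rewrite gt_eqF.
by apply: ler_pM => //; exact: sqrtr_ge0.
Qed.

End nice.

Section core.
Context (R : realType) (d : nat) (S : set 'rV[R]_d) (x0 : S)
  (mu : probability (state x0) R)
  (L : (state x0 -> R) -> (state x0 -> R) -> Prop) (T : R).
Hypothesis hL : dissipative_symmetric mu L.
Hypothesis hspec : purely_discrete_spectrum mu L.
Hypothesis hT : 0 < T.
Hypothesis hcore : operator_core mu L
       [set v : state x0 -> R | smooth_space v /\ v \in Lfun mu 2%:E].
Variable (m : R).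
Hypothesis m0 : 0 < m.
Hypothesis hp : poincare mu L m.
Local Notation ST := (measurableTypeR R * state x0)%type.
Local Notation nrmT := (nrm (lebmu mu T)).
Local Notation ipT := (ip (lebmu mu T)).
Local Notation V := (L2V mu).

Section fixed_level.
Variables (n J : nat) (phi : 'I_n -> R -> R) (W : 'I_n -> nat -> V) (b : R).
Local Notation N := (3 * J.+1)%N.
Hypothesis sphi : forall i, smooth (phi i).
Hypothesis ZW : forall i k, (k <= N)%N -> Zop L m (W i k) (W i k.+1).
Hypothesis b1 : 1 <= b.
Hypothesis tops : forall j,
  [/\ time_op T b (opU T j), time_op T b (opU1 T j), time_op T b (opU2 T j),
      time_op T b (opV T j) & time_op T b (fun phi t => phi t - opU T j phi t)].

Local Notation act := (poly_act N W).
Local Notation Lm := (op_gram N W).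
Local Notation K0 := (time_gram T phi).
Local Notation bp j := (polB R J j).
Local Notation gp j := (polG R J j).
Local Notation Qp := (polQ R J).
Local Notation Xp := (polX R).
Local Notation ds A kap := (dsum (fun j i => A (j : nat) (phi i)) (fun (j : 'I_J) i => act i (kap (j : nat)))).

Let cphi i : continuous (phi i). Proof. exact: smooth_continuous. Qed.

Definition corr_h (k : nat) (z : ST) : R := \sum_(j < J) \sum_(i < n)
  jet_tensor (fun t => 2 ^- j * opV T j (phi i) t) (act i (bp j))
    (fun x => - (m / 6) * act i (Xp * bp j) x) k z.

(** The factor 3 / m comes from L = - (m / 6) X: applying - 2 L to (3 / m) beta_j / X gives
    beta_j. *)
Definition corr_g (k : nat) (z : ST) : R := \sum_(j < J) \sum_(i < n)
  jet_tensor (opU T j (phi i)) (fun x => 3 / m * act i (gp j) x)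
    (fun x => - 2^-1 * act i (bp j) x) k z.

Lemma app_corr_h : app mu L T corr_h.
Proof.
apply: app_sum => // j; apply: app_sum => // i; apply: app_tensor => //.
- by apply: smoothZ; exact: smooth_opV.
- by rewrite opV_0 ?mulr0.
- by rewrite opV_T ?mulr0.
- by apply: (act_op hL ZW); apply: leq_trans (size_polB R (ltn_ord j)) _.
Qed.

Lemma app_corr_g : app mu L T corr_g.
Proof.
apply: app_sum => // j; apply: app_sum => // i; apply: app_tensor => //.
- exact: smooth_opU.
- by rewrite opU_vanish// lexx.
- by rewrite opU_vanish// lexx orbT.
- have h : (size (gp j) <= N.+1)%N by apply: leq_trans (size_polG R (ltn_ord j)) _.
  have := op_scale hL (3 / m) (act_op hL ZW i h); rewrite polX_polG//; congr L.
  by apply/funext => x; field; rewrite gt_eqF.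
Qed.

Let actM i (c : R) p x : act i (c%:P * p) x = c * act i p x.
Proof. by rewrite mul_polyC actZ. Qed.

Let actXM i (c : R) p x : act i (Xp * (c%:P * p)) x = c * act i (Xp * p) x.
Proof. by rewrite mulrCA mul_polyC actZ. Qed.

Definition source : ST -> R := tsum phi (act^~ Qp).

Let sizeN (p : {poly R}) : (size p <= N)%N -> (size p <= N.+2)%N.
Proof. by move=> /leq_trans; apply; rewrite (leq_trans (leqnSn _)). Qed.

Let sizeX (p : {poly R}) : (size p <= N)%N -> (size (Xp * p)%R <= N.+2)%N.
Proof.
move=> sp; apply: leq_trans (size_polyMleq _ _) _.
have -> : size Xp = 2%N.
  by rewrite /polX -[6]opprK -polyC_natr -polyCN size_XsubC.
by rewrite add2n /= ltnS ltnW// ltnS.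
Qed.

Lemma source_sqr : nrmT source ^+ 2 = Lm K0 (Qp ^+ 2).
Proof.
rewrite nrm_sqr; apply: (Lm_sqr hL m0 hT cphi ZW).
exact: leq_trans (size_polQ R J) _.
Qed.

Let b0 : 0 <= b. Proof. exact: le_trans ler01 b1. Qed.

Let LmZ (c : nat) (q : {poly R}) : Lm K0 (c%:R * q) = c%:R * Lm K0 q.
Proof. by rewrite -polyC_natr mul_polyC; exact: LamZ. Qed.

Lemma est_norm (A : nat -> (R -> R) -> (R -> R)) (kap : nat -> {poly R}) (c : nat) :
  (forall j, time_op T b (A j)) -> (forall j, (j < J)%N -> cone (kap j)) ->
  (forall j, (j < J)%N -> (size (kap j) <= N)%N) ->
  cone (c%:R * Qp ^+ 2 - (\sum_(j < J) kap j) ^+ 2) ->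
  nrmT (ds A kap) ^+ 2 <= b * (c%:R * nrmT source ^+ 2).
Proof.
move=> hA ck sk cc; rewrite source_sqr -LmZ nrm_sqr.
have := @dsum_le _ _ _ _ _ hL _ m0 hp _ hT n N phi W cphi ZW J (fun j => A j) (fun j => kap j)
  1 (c%:R * Qp ^+ 2) b b0 (fun j => hA j) (fun j => ck j (ltn_ord j)) (cone1 R)
  (fun j => sizeN (sk j (ltn_ord j))).
have -> : (fun (j : 'I_J) i => act i (1 * kap j) : state x0 -> R) = (fun j i => act i (kap j)).
  by apply/funext => j; apply/funext => i; rewrite mul1r.
apply; last by rewrite mul1r.
by move=> j; rewrite mul1r; exact: sizeN (sk j (ltn_ord j)).
Qed.

Lemma est_form (A : nat -> (R -> R) -> (R -> R)) (kap : nat -> {poly R}) (c : nat) :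
  (forall j, time_op T b (A j)) -> (forall j, (j < J)%N -> cone (kap j)) ->
  (forall j, (j < J)%N -> (size (kap j) <= N)%N) ->
  cone (c%:R * Qp ^+ 2 - Xp * (\sum_(j < J) kap j) ^+ 2) ->
  nrmT (ds A kap) ^+ 2 <= b * (c%:R * nrmT source ^+ 2) /\
  ipT (ds A kap) (ds A (fun j => Xp * kap j)) <= b * (c%:R * nrmT source ^+ 2).
Proof.
move=> hA ck sk cc; split.
  apply: est_norm => //.
  (* X - 1 = Z + 5 has nonnegative coefficients, so the bound on the energy contains the bound on
     the norm. *)
  have -> : c%:R * Qp ^+ 2 - (\sum_(j < J) kap j) ^+ 2 =
      (c%:R * Qp ^+ 2 - Xp * (\sum_(j < J) kap j) ^+ 2) + ('X + 5%:R) * (\sum_(j < J) kap j) ^+ 2.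
    by rewrite /polX; ring.
  apply: coneD => //; apply: coneM; first by apply: coneD; [exact: coneX|exact: cone_nat].
  by apply: cone_exp; apply: cone_sum => j _; exact: ck.
rewrite source_sqr -LmZ.
exact: (@dsum_le _ _ _ _ _ hL _ m0 hp _ hT n N phi W cphi ZW J (fun j => A j) (fun j => kap j)
  Xp (c%:R * Qp ^+ 2) b b0 (fun j => hA j) (fun j => ck j (ltn_ord j)) (cone_polX R)
  (fun j => sizeN (sk j (ltn_ord j))) (fun j => sizeX (sk j (ltn_ord j)))).
Qed.

(** The powers of 2 are moved from the time factors to the polynomials, leaving time operators
    bounded uniformly in j. *)
Let eVb := fun j => (2 ^- j)%:P * bp j.
Let eg2 := fun j => (2 ^+ j)%:P * gp j.
Let eg4 := fun j => (4 ^+ j)%:P * gp j.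
(** For g itself the weight 2^j in [eg2] is compensated by 2^-j <= 1 in time, so the estimate made
    for d_t g also serves g. *)
Let sU := fun j phi t => 2 ^- j * opU T j phi t.
Let sW := fun j phi t => phi t - opU T j phi t.

Let jderiv (f f' : R -> R) : (forall t, is_derive t (1 : R) f (f' t)) -> derive1 f = f'.
Proof. exact: derive1_is_derive. Qed.

Let n2 j : 2 ^+ j != 0 :> R. Proof. by rewrite expf_neq0. Qed.

Lemma corr_h0 : corr_h 0%N = ds (opV T) eVb.
Proof.
apply/funext => z; apply: eq_bigr => j _; apply: eq_bigr => i _.
by rewrite /jet_tensor/= actM; ring.
Qed.

Lemma corr_h1 : corr_h 1%N = ds sW (fun j => bp j).
Proof.
apply/funext => z; apply: eq_bigr => j _; apply: eq_bigr => i _.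
by rewrite /jet_tensor/= (jderiv (fun t => opV_is_derive T j t (@cphi i))).
Qed.

Lemma corr_h3 : corr_h 3%N = (fun z => - (m / 6) * ds (opV T) (fun j => Xp * eVb j) z).
Proof.
apply/funext => z; rewrite /dsum mulr_sumr; apply: eq_bigr => j _.
rewrite mulr_sumr; apply: eq_bigr => i _.
by rewrite /jet_tensor/= actXM; ring.
Qed.

Lemma corr_g0 : corr_g 0%N = (fun z => 3 / m * ds sU eg2 z).
Proof.
apply/funext => z; rewrite /dsum mulr_sumr; apply: eq_bigr => j _.
rewrite mulr_sumr; apply: eq_bigr => i _.
by rewrite /jet_tensor/= (actM _ _ (gp j)) /sU; field; rewrite n2 gt_eqF.
Qed.

Lemma corr_g1 : corr_g 1%N = (fun z => 3 / m * ds (opU1 T) eg2 z).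
Proof.
apply/funext => z; rewrite /dsum mulr_sumr; apply: eq_bigr => j _.
rewrite mulr_sumr; apply: eq_bigr => i _.
rewrite /jet_tensor/= (jderiv (opU_is_derive T j (phi i))) (actM _ _ (gp j)).
by field; rewrite gt_eqF.
Qed.

Lemma corr_g2 : corr_g 2%N = (fun z => 3 / m * ds (opU2 T) eg4 z).
Proof.
apply/funext => z; rewrite /dsum mulr_sumr; apply: eq_bigr => j _.
rewrite mulr_sumr; apply: eq_bigr => i _.
rewrite /jet_tensor/= (jderiv (opU_is_derive T j (phi i))).
rewrite (jderiv (opU1_is_derive T j (phi i))) (actM _ _ (gp j)).
by field; rewrite gt_eqF.
Qed.

Lemma corr_g3 : corr_g 3%N = (fun z => - 2^-1 * ds (opU T) (fun j => bp j) z).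
Proof.
apply/funext => z; rewrite /dsum mulr_sumr; apply: eq_bigr => j _.
rewrite mulr_sumr; apply: eq_bigr => i _.
by rewrite /jet_tensor/= mulrCA.
Qed.

(** Here L g is written with the time factors of g in [corr_g0], so that the pairing of g with L g
    has the shape required by [est_form]. *)
Lemma corr_g3' : corr_g 3%N = (fun z => - 2^-1 * ds sU (fun j => Xp * eg2 j) z).
Proof.
apply/funext => z; rewrite /dsum mulr_sumr; apply: eq_bigr => j _.
rewrite mulr_sumr; apply: eq_bigr => i _.
by rewrite /jet_tensor/= (actXM _ _ (gp j)) polX_polG// /sU; field; rewrite n2.
Qed.

Lemma corr_g4 : corr_g 4%N = (fun z => - 2^-1 * ds (opU1 T) (fun j => Xp * eg2 j) z).
Proof.
apply/funext => z; rewrite /dsum mulr_sumr; apply: eq_bigr => j _.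
rewrite mulr_sumr; apply: eq_bigr => i _.
rewrite /jet_tensor/= (jderiv (opU_is_derive T j (phi i))) (actXM _ _ (gp j)) polX_polG//.
by field.
Qed.

(** One constant above all coefficients that occur: 15 and 15 m / 6 for h, 16 (3 / m)^2 = 144 / m^2
    for the norms of g and its time derivatives, and 4 * 3 / (2 m) = 6 / m for the energies of g and
    d_t g. *)
Let D := b * (15 + 3 * m + 144 / m ^+ 2 + 6 / m).

Let m2 : 0 <= 144 / m ^+ 2. Proof. by rewrite divr_ge0 ?sqr_ge0. Qed.
Let m1 : 0 <= 6 / m. Proof. by rewrite divr_ge0 ?ltW. Qed.

Let DD : [/\ 15 <= 15 + 3 * m + 144 / m ^+ 2 + 6 / m, 1 <= 15 + 3 * m + 144 / m ^+ 2 + 6 / m,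
  m / 6 * 15 <= 15 + 3 * m + 144 / m ^+ 2 + 6 / m,
  144 / m ^+ 2 / 4 <= 15 + 3 * m + 144 / m ^+ 2 + 6 / m /\
  144 / m ^+ 2 <= 15 + 3 * m + 144 / m ^+ 2 + 6 / m
  & 6 / m / 4 * 4 <= 15 + 3 * m + 144 / m ^+ 2 + 6 / m].
Proof.
have := m1; have := m2; have := ltW m0; move: (144 / _) (6 / m) => A B hm hA hB.
by split; [| | |split|]; lra.
Qed.

Let to_D (c : R) : c <= 15 + 3 * m + 144 / m ^+ 2 + 6 / m ->
  b * (c * nrmT source ^+ 2) <= D * nrmT source ^+ 2.
Proof. by move=> h; rewrite mulrA ler_wpM2r ?sqr_ge0// ler_wpM2l. Qed.

Let tU j : time_op T b (opU T j). Proof. by have [] := tops j. Qed.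
Let tU1 j : time_op T b (opU1 T j). Proof. by have [] := tops j. Qed.
Let tU2 j : time_op T b (opU2 T j). Proof. by have [] := tops j. Qed.
Let tV j : time_op T b (opV T j). Proof. by have [] := tops j. Qed.
Let tW j : time_op T b (sW j). Proof. by have [] := tops j. Qed.
Let tsU j : time_op T b (sU j).
Proof.
have [h1 h2 h3] := tU j; split.
- by move=> f cf; apply: contZ; exact: h1.
- by move=> c f g cf cg; rewrite /sU h2//; apply/funext => t; ring.
- move=> f cf; rewrite tipZ; last exact: h1.
  have := h3 _ cf; apply: le_trans; rewrite ler_piMl ?tip_ge0//; first exact: h1.
  by rewrite exprn_ile1// ?invr_ge0 ?exprn_ge0// invf_le1 ?exprn_gt0// exprn_ege1// ler1n.
Qed.

Let cexp (c : R) p j : 0 <= c -> cone p -> cone ((c ^+ j)%:P * p).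
Proof. by move=> c0 cp; apply: coneM => //; apply: coneC; rewrite exprn_ge0. Qed.

Let size_scale (c : R) (p : {poly R}) : (size p <= N)%N -> (size (c%:P * p)%R <= N)%N.
Proof. by rewrite mul_polyC; apply: leq_trans; exact: size_scale_leq. Qed.

Let cVb j : (j < J)%N -> cone (eVb j).
Proof. by move=> jJ; rewrite /eVb -exprVn; apply: cexp; [rewrite invr_ge0|exact: cone_polB]. Qed.
Let cg2 j : (j < J)%N -> cone (eg2 j).
Proof. by move=> jJ; apply: cexp => //; exact: cone_polG. Qed.
Let cg4 j : (j < J)%N -> cone (eg4 j).
Proof. by move=> jJ; apply: cexp => //; exact: cone_polG. Qed.
Let sVb j : (j < J)%N -> (size (eVb j) <= N)%N.
Proof. by move=> jJ; apply: size_scale; exact: size_polB. Qed.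
Let sg2 j : (j < J)%N -> (size (eg2 j) <= N)%N.
Proof. by move=> jJ; apply: size_scale; exact: size_polG. Qed.
Let sg4 j : (j < J)%N -> (size (eg4 j) <= N)%N.
Proof. by move=> jJ; apply: size_scale; exact: size_polG. Qed.

Let EV := est_form tV cVb sVb (sum_polB2_sqr_le R J).
Let EsU := est_form tsU cg2 sg2 (sum_polG2_sqr_le R J).
Let EU1 := est_form tU1 cg2 sg2 (sum_polG2_sqr_le R J).

Let Lds A kap : (forall j, time_op T b (A j)) -> L2T mu T (ds A kap).
Proof.
move=> hA; have cA (j : 'I_J) i : continuous (A j (phi i)) := top_cont (hA j) (@cphi i).
exact: (L2_dsum hT cA (fun j i => L2V_L2 (act i (kap j)))).
Qed.

Let nrm_scale (c : R) A kap : (forall j, time_op T b (A j)) ->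
  nrmT (fun z => c * ds A kap z) ^+ 2 = c ^+ 2 * nrmT (ds A kap) ^+ 2.
Proof. by move=> hA; rewrite (nrmZ c (Lds kap hA)) exprMn real_normK ?num_real. Qed.

Let form_scale (c c' : R) A kap kap' : (forall j, time_op T b (A j)) ->
  ipT (fun z => c * ds A kap z) (fun z => c' * ds A kap' z) = c * c' * ipT (ds A kap) (ds A kap').
Proof.
move=> hA; have L1 := Lds kap hA; have L2 := Lds kap' hA.
by rewrite (ipZl c L1 (L2Z c' L2)) (ipZr c' L2 L1) mulrA.
Qed.

Lemma corr_h_bounds :
  [/\ nrmT (corr_h 0%N) ^+ 2 <= D * nrmT source ^+ 2,
      nrmT (corr_h 1%N) ^+ 2 <= D * nrmT source ^+ 2
    & - ipT (corr_h 0%N) (corr_h 3%N) <= D * nrmT source ^+ 2].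
Proof.
have [e1 e2] := EV; have [d1 d2 d3 _ _] := DD; split.
- by rewrite corr_h0; apply: le_trans e1 _; exact: to_D.
- rewrite corr_h1; have h : cone (1%:R * Qp ^+ 2 - (\sum_(j < J) bp j) ^+ 2).
    by rewrite mul1r; exact: sum_polB_sqr_le.
  apply: le_trans (est_norm tW (@cone_polB R J) (@size_polB R J) h) _.
  exact: to_D.
- have -> : ipT (corr_h 0%N) (corr_h 3%N) =
      - (m / 6) * ipT (ds (opV T) eVb) (ds (opV T) (fun j => Xp * eVb j)).
    rewrite corr_h0 corr_h3.
    exact: (ipZr (- (m / 6)) (Lds (fun j => Xp * eVb j) tV) (Lds eVb tV)).
  rewrite mulNr opprK.
  apply: le_trans (ler_wpM2l _ e2) _; first by rewrite divr_ge0 ?ltW.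
  by rewrite mulrCA [X in b * X]mulrA; exact: to_D.
Qed.

Lemma corr_g_bounds :
  [/\ [/\ nrmT (corr_g 0%N) ^+ 2 <= D * nrmT source ^+ 2,
      nrmT (corr_g 1%N) ^+ 2 <= D * nrmT source ^+ 2,
      nrmT (corr_g 2%N) ^+ 2 <= D * nrmT source ^+ 2
    & nrmT (corr_g 3%N) ^+ 2 <= D * nrmT source ^+ 2],
      - ipT (corr_g 0%N) (corr_g 3%N) <= D * nrmT source ^+ 2
    & - ipT (corr_g 1%N) (corr_g 4%N) <= D * nrmT source ^+ 2].
Proof.
have [u1 u2] := EsU; have [v1 v2] := EU1.
have [_ d2 _ [d4 d5] d6] := DD.
have m9 : (3 / m) ^+ 2 * 16 = 144 / m ^+ 2 by field; rewrite gt_eqF.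
have m94 : (3 / m) ^+ 2 * 4 = 144 / m ^+ 2 / 4 by field; rewrite gt_eqF.
have m36 : 0 <= (3 / m) ^+ 2 by exact: sqr_ge0.
have m6 : - (3 / m * - 2^-1) = 6 / m / 4 by field; rewrite gt_eqF.
have m60 : 0 <= 6 / m / 4 by rewrite divr_ge0.
split; first split.
- rewrite corr_g0 nrm_scale//; apply: le_trans (ler_wpM2l m36 u1) _.
  by rewrite mulrCA [X in b * X]mulrA m94; exact: to_D.
- rewrite corr_g1 nrm_scale//; apply: le_trans (ler_wpM2l m36 v1) _.
  by rewrite mulrCA [X in b * X]mulrA m94; exact: to_D.
- rewrite corr_g2 nrm_scale//.
  have h : cone (16%:R * Qp ^+ 2 - (\sum_(j < J) eg4 j) ^+ 2).
    have := sum_polG4_sqr_le R J; congr cone; congr (_ - _); ring.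
  apply: le_trans (ler_wpM2l m36 (est_norm tU2 cg4 sg4 h)) _.
  by rewrite mulrCA [X in b * X]mulrA m9; exact: to_D.
- rewrite corr_g3 nrm_scale//.
  have h : cone (1%:R * Qp ^+ 2 - (\sum_(j < J) bp j) ^+ 2).
    by rewrite mul1r; exact: sum_polB_sqr_le.
  have q0 : 0 <= (- 2^-1) ^+ 2 :> R by exact: sqr_ge0.
  apply: le_trans (ler_wpM2l q0 (est_norm tU (@cone_polB R J) (@size_polB R J) h)) _.
  rewrite mulrCA [X in b * X]mulrA; apply: to_D; apply: le_trans d2; rewrite sqrrN mulr1 exprVn.
  by rewrite invf_le1 ?exprn_gt0// exprn_ege1// ler1n.
- have -> : ipT (corr_g 0%N) (corr_g 3%N) =
      3 / m * - 2^-1 * ipT (ds sU eg2) (ds sU (fun j => Xp * eg2 j)).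
    by rewrite corr_g0 corr_g3'; exact: (form_scale _ _ eg2 (fun j => Xp * eg2 j) tsU).
  rewrite -mulNr m6.
  apply: le_trans (ler_wpM2l m60 u2) _.
  by rewrite mulrCA [X in b * X]mulrA; exact: to_D.
- have -> : ipT (corr_g 1%N) (corr_g 4%N) =
      3 / m * - 2^-1 * ipT (ds (opU1 T) eg2) (ds (opU1 T) (fun j => Xp * eg2 j)).
    by rewrite corr_g1 corr_g4; exact: (form_scale _ _ eg2 (fun j => Xp * eg2 j) tU1).
  rewrite -mulNr m6.
  apply: le_trans (ler_wpM2l m60 v2) _.
  by rewrite mulrCA [X in b * X]mulrA; exact: to_D.
Qed.

Let LA (q : {poly R}) : L2T mu T (tsum phi (act^~ q)).
Proof. exact: (L2_tsum hT cphi (fun i => L2V_L2 (act i q))). Qed.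

Let tsumD (p q : {poly R}) z : tsum phi (act^~ (p + q)) z = tsum phi (act^~ p) z + tsum phi (act^~ q) z.
Proof. by rewrite -big_split/=; apply: eq_bigr => i _; rewrite actD -mulrDr. Qed.

Let V_sum (I : Type) (s : seq I) (F : I -> V) x : (\sum_(i <- s) F i) x = \sum_(i <- s) F i x.
Proof. by elim: s => [|i s IH]; rewrite ?big_nil// !big_cons -IH. Qed.

Let tsum_Pp z : ds sW (fun j => bp j) z + ds (opU T) (fun j => bp j) z =
  tsum phi (act^~ (polP R J J - polP R J 0)) z.
Proof.
rewrite -sum_polB -[X in ds sW X]/(fun j => bp j).
have -> : ds sW (fun j => bp j) z + ds (opU T) (fun j => bp j) z =
    \sum_(j < J) \sum_i phi i z.1 * act i (bp j) z.2.
  rewrite -big_split; apply: eq_bigr => j _; rewrite -big_split; apply: eq_bigr => i _.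
  by rewrite /sW/=; ring.
rewrite exchange_big; apply: eq_bigr => i _.
by rewrite act_sum V_sum mulr_sumr.
Qed.

(** The sum of the beta_j telescopes. [polP0_sqr_le] bounds the part left below level 0, and
    [polQ_polP_sqr_le] the part above level J. *)
Lemma corr_residual : nrmT (fun z => source z - (corr_h 1%N z - 2 * corr_g 3%N z)) <=
  nrmT source / 8 + 3 / 4 ^+ J * nrmT (tsum phi (act^~ (Xp * Qp))).
Proof.
have E : (fun z => source z - (corr_h 1%N z - 2 * corr_g 3%N z)) =
    (fun z => tsum phi (act^~ (polP R J 0)) z + tsum phi (act^~ (Qp - polP R J J)) z).
  apply/funext => z; rewrite corr_h1 corr_g3 mulrA mulrN divff// mulN1r opprK tsum_Pp.
  have : source z = tsum phi (act^~ (polP R J 0 + (Qp - polP R J J) + (polP R J J - polP R J 0))) z.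
    by congr tsum; apply/funext => i; congr (act i _ : state x0 -> R); ring.
  by rewrite !tsumD => ->; rewrite addrK.
have szP : (size (polP R J 0) <= N.+2)%N by apply: sizeN; exact: size_polP.
have szQ : (size Qp <= N.+2)%N by apply: leq_trans (size_polQ R J) _.
have szPJ : (size (Qp - polP R J J)%R <= N.+2)%N.
  by apply: leq_trans (size_polyD _ _) _; rewrite geq_max size_polyN szQ sizeN// size_polP.
have szX : (size (Xp * Qp)%R <= N.+2)%N.
  apply: leq_trans (size_polyMleq _ _) _.
  have -> : size Xp = 2%N by rewrite /polX -[6]opprK -polyC_natr -polyCN size_XsubC.
  by rewrite add2n /= ltnS; exact: size_polQ.
have sqr (q : {poly R}) : (size q <= N.+2)%N -> nrmT (tsum phi (act^~ q)) ^+ 2 = Lm K0 (q ^+ 2).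
  by move=> sq; rewrite nrm_sqr; exact: (Lm_sqr hL m0 hT cphi ZW).
have LmM (c : R) (q : {poly R}) : Lm K0 (c%:P * q) = c * Lm K0 q.
  by rewrite mul_polyC; exact: LamZ.
have j0 : 0 <= 3 / 4 ^+ J :> R by rewrite divr_ge0// exprn_ge0.
rewrite E; apply: le_trans (nrmD (LA _) (LA _)) _; apply: lerD.
  rewrite ler_pdivlMr// -(@ler_pXn2r _ 2)// ?nnegrE ?mulr_ge0 ?nrm_ge0//.
  rewrite exprMn (sqr _ szP) source_sqr mulrC -LmM; apply: (Lm_le hL m0 hp hT cphi ZW).
  have := polP0_sqr_le R J; congr cone; congr (_ - _ * _).
  by rewrite -polyC_natr; congr _%:P; ring.
rewrite -(@ler_pXn2r _ 2)// ?nnegrE ?mulr_ge0 ?nrm_ge0//.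
rewrite exprMn (sqr _ szPJ) (sqr _ szX) -LmM; apply: (Lm_le hL m0 hp hT cphi ZW).
have := polQ_polP_sqr_le R J; congr cone; congr (_ - _).
by rewrite polyC_exp -exprMn polyCM -polyC_natr !mulrA.
Qed.

End fixed_level.
End core.

(** * Density *)

Section pi_induction.
Context d (T : measurableType d) (R : realType) (m : {measure set T -> \bar R}).
Hypothesis mfin : (m setT < +oo)%E.
Local Notation L2 f := (f \in Lfun m 2%:E).
Local Notation nrm := (nrm m).

Lemma nrm_indic (A : set T) : measurable A -> nrm (\1_A : T -> R) ^+ 2 = fine (m A).
Proof.
move=> mA; rewrite nrm_sqr /ip /Rintegral -[in RHS](setIT A) -integral_indic//.
by congr fine; apply: eq_integral => x _; rewrite indicE; case: (x \in A); rewrite ?mulr1 ?mulr0.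
Qed.

Lemma nrm_le_indic f (A : set T) : L2 f -> measurable A -> (forall x, f x ^+ 2 <= \1_A x) ->
  nrm f ^+ 2 <= fine (m A).
Proof.
move=> Lf mA fA; rewrite -nrm_indic// !nrm_sqr -lee_fin !ipE//; [|exact: L2_indic..].
apply: ge0_le_integral => //.
- by move=> x _; rewrite lee_fin -expr2 sqr_ge0.
- by have /integrableP[] := ip_integrable Lf Lf.
- have LA := L2_indic mfin mA; by have /integrableP[] := ip_integrable LA LA.
- move=> x _; rewrite lee_fin -expr2; apply: le_trans (fA x) _.
  by rewrite indicE; case: (x \in A); rewrite ?mulr1 ?mulr0.
Qed.

(** Dynkin's theorem passes from the pi-system to all measurable sets, where [L2_ind] takes over.
    Disjoint unions are L^2 limits of finite ones since the measure is finite. *)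
Lemma L2_pi_ind (G : set (set T)) (Q : (T -> R) -> Prop) :
  @measurable _ T = <<s G >> -> setI_closed G ->
  Q (fun=> 1) -> (forall A, G A -> Q \1_A) ->
  (forall a f g, L2 f -> L2 g -> Q f -> Q g -> Q (fun x => a * f x + g x)) ->
  (forall f, L2 f -> (forall e, 0 < e -> exists g,
      [/\ L2 g, Q g & nrm (fun x => f x - g x) <= e]) -> Q f) ->
  forall f, L2 f -> Q f.
Proof.
move=> mG GI Q1 QG Qlin Qcl; apply: L2_ind => // A mA.
have L1 := L2_cst mfin 1.
have Q0 : Q (fun=> 0).
  have := Qlin (-1) _ _ L1 L1 Q1 Q1; congr Q; apply/funext => x; ring.
apply: (@dynkin_induction _ T G (fun A => Q \1_A)) => //; last by rewrite -mG.
- by rewrite indicT.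
- move=> B mB QB; have := Qlin (-1) _ _ (L2_indic mfin mB) L1 QB Q1; congr Q.
  apply/funext => x; rewrite indicC indicE; case: (x \in B) => /=; ring.
- move=> F mF tF QF.
  pose B n := \big[setU/set0]_(i < n) F i.
  have mB n : measurable (B n) by apply: bigsetU_measurable => i _.
  have Bsub n : B n `<=` \bigcup_k F k by apply: bigsetU_bigcup.
  have QB n : Q \1_(B n).
    elim: n => [|n IH]; first by rewrite /B big_ord0 indic0.
    have := Qlin 1 _ _ (L2_indic mfin (mB n)) (L2_indic mfin (mF n)) IH (QF n); congr Q.
    apply/funext => x; rewrite mul1r /B big_ord_recr/= -/(B n) !indicE in_setU.
    have : ~~ ((x \in B n) && (x \in F n)).
      apply/negP => /andP[/set_mem + /set_mem Fx].
      rewrite /B -bigcup_mkord => -[k /= kn Fkx].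
      have := tF k n I I; move=> /(_ (ex_intro _ x (conj Fkx Fx))) kn'.
      by rewrite kn' ltnn in kn.
    by case: (x \in B n); case: (x \in F n) => //=; rewrite ?addr0 ?add0r.
  have mU : measurable (\bigcup_k F k) by exact: bigcup_measurable.
  apply: Qcl; first exact: L2_indic.
  move=> e e0; pose D n := (\bigcup_k F k) `\` B n.
  have mD n : measurable (D n) by exact: measurableD.
  have : m \o D @ \oo --> m (\bigcap_n D n).
    apply: nonincreasing_cvg_mu => //.
    - by apply: le_lt_trans mfin; apply: le_measure; rewrite ?inE.
    - exact: bigcap_measurable.
    - apply/nonincreasing_seqP => n; apply/subsetPset => x [Ux nB]; split => //.
      by move=> Bx; apply: nB; rewrite /B big_ord_recr/=; left.
  have -> : \bigcap_n D n = set0.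
    rewrite -subset0 => x Dx; have [[k _ Fk] _] := Dx 0%N I.
    have [_] := Dx k.+1 I; apply; rewrite /B -bigcup_mkord.
    by exists k => //=.
  rewrite measure0 => /fine_cvgP[_ /cvgrPdist_lt /(_ (e ^+ 2))].
  rewrite exprn_gt0// => /(_ isT) [n _ /(_ n (leqnn _))] /=.
  rewrite sub0r normrN ger0_norm ?fine_ge0// => lt.
  exists \1_(B n); split; [exact: L2_indic|exact: QB|].
  have -> : (fun x => \1_(\bigcup_k F k) x - \1_(B n) x) = \1_(D n) :> (T -> R).
    apply/funext => x; rewrite !indicE in_setD.
    have := @Bsub n x; case: (boolP (x \in B n)) => [/set_mem Bx /(_ Bx) /mem_set ->|_ _] /=.
      by rewrite subrr.
    by rewrite subr0 andbT.
  rewrite -(@ler_pXn2r _ 2)// ?nnegrE ?nrm_ge0 1?ltW// nrm_indic//.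
Qed.

End pi_induction.

Section smooth_density.
Context (R : realType) (T : R) (hT : 0 < T).
Local Notation nrm := (nrm (leb T)).

Lemma step_ndecr (s t : R) : s <= t -> step s <= step t.
Proof.
move=> st; apply: (is_derive_ndecr (@step_is_derive R)) => // r _.
by rewrite mulr_ge0 ?bump_ge0// invr_ge0 ltW// bump_mass_gt0.
Qed.

Lemma step_ge0 (t : R) : 0 <= step t.
Proof. by have [/step_le0 ->//|/ltW/step_ndecr] := leP t 0; rewrite step_le0. Qed.

Lemma step_le1 (t : R) : step t <= 1.
Proof. by have [/step_ge1 ->//|/ltW/step_ndecr] := leP 1 t; rewrite (step_ge1 (lexx 1)). Qed.

(** The half-lines ]a, +oo[ generate the Borel sets, and their indicators are approximated by
    rescaled copies of [step]. *)
Lemma smooth_dense f : f \in Lfun (leb T) 2%:E -> forall e, 0 < e ->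
  exists2 phi, smooth phi & nrm (fun t => f t - phi t) <= e.
Proof.
have lt := @leb_lty R T.
have Ls phi : smooth phi -> phi \in Lfun (leb T) 2%:E.
  by move=> /smooth_continuous; exact: L2_continuous.
move: f; apply: (@L2_pi_ind _ _ _ (leb T) lt _ _ (@RGenOInfty.measurableE R)).
- move=> _ _ [x ->] [y ->]; exists (Order.max x y).
  apply/seteqP; split=> t /=; rewrite !in_itv/= !andbT gt_max.
    by move=> [-> ->].
  by move=> /andP.
- move=> e e0; exists (fun=> 1); first exact: smooth_cst.
  by under eq_fun do rewrite subrr; rewrite nrm0 ltW.
(* The approximant differs from the indicator only on an interval of length e^2, and by at most 1,
   which gives norm at most e. *)
- move=> _ [a ->] e e0; pose dl := e ^+ 2; have dl0 : 0 < dl by rewrite exprn_gt0.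
  pose phi t := step (dl^-1 * t + - (dl^-1 * a)).
  have sphi : smooth phi by apply: smooth_affine; exact: smooth_step.
  exists phi => //.
  have mI : measurable (`]a, +oo[%classic : set (measurableTypeR R)) by exact: measurable_itv.
  have L := L2B (L2_indic lt mI) (Ls _ sphi).
  rewrite -(@ler_pXn2r _ 2)// ?nnegrE ?nrm_ge0 ?(ltW e0)//.
  have mJ : measurable (`]a, a + dl]%classic : set (measurableTypeR R)) by exact: measurable_itv.
  apply: le_trans (nrm_le_indic lt L mJ _) _.
    move=> t; have arg : dl^-1 * t + - (dl^-1 * a) = (t - a) / dl by ring.
    rewrite /phi arg !indicE !mem_setE/= !in_itv/= andbT.
    have [ta|at_] := leP t a.
      rewrite step_le0 ?subrr ?expr0n//.
      by rewrite ler_pdivrMr// mul0r subr_le0.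
    have [tb|bt] := leP t (a + dl).
      rewrite exprn_ile1// ?subr_ge0 ?step_le1//.
      by rewrite lerBlDr lerDl step_ge0.
    rewrite step_ge1 ?subrr ?expr0n//.
    by rewrite ler_pdivlMr// mul1r; lra.
  pose J : set (measurableTypeR R) := `]a, a + dl]%classic.
  have : (leb T J <= dl%:E)%E.
    rewrite /leb /= /mrestr; apply: (@le_trans _ _ (lebesgue_measure J)).
      apply: le_measure; rewrite ?inE//; apply: measurableI => //; exact: measurable_itv.
    rewrite /J lebesgue_measure_itv/= lte_fin ltrDl dl0 -EFinB lee_fin; lra.
  move=> h; rewrite -lee_fin fineK// ge0_fin_numE//; apply: le_lt_trans h _; exact: ltry.
- move=> a f g Lf Lg Qf Qg e e0.
  have a0 : 0 < `|a| + 1 by rewrite ltr_wpDl.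
  have [p sp hp] := Qf _ (divr_gt0 e0 a0); have [q sq hq] := Qg _ (divr_gt0 e0 a0).
  exists (fun t => a * p t + q t); first by apply: smoothD => //; exact: smoothZ.
  have -> : (fun x => a * f x + g x - (a * p x + q x)) = (fun x => a * (f x - p x) + (g x - q x)).
    by apply/funext => x; ring.
  have L1 := L2B Lf (Ls _ sp); have L2 := L2B Lg (Ls _ sq).
  apply: le_trans (nrmD (L2Z a L1) L2) _; rewrite nrmZ//.
  apply: le_trans (lerD (ler_wpM2l (normr_ge0 a) hp) hq) _.
  by rewrite le_eqVlt; apply/orP; left; apply/eqP; field; rewrite gt_eqF.
- move=> f Lf h e e0; have e2 : 0 < e / 2 by rewrite divr_gt0.
  have [g [Lg Qg hg]] := h _ e2; have [p sp hp] := Qg _ e2; exists p => //.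
  apply: le_trans (nrm_triangle Lf Lg (Ls _ sp)) _; lra.
Qed.

End smooth_density.

Section spacetime_density.
Context (R : realType) (dS : measure_display) (S : measurableType dS)
  (mu : probability S R) (L : (S -> R) -> (S -> R) -> Prop).
Hypothesis hL : dissipative_symmetric mu L.
Hypothesis hspec : purely_discrete_spectrum mu L.
Variables (T : R) (hT : 0 < T).
Local Notation P := (leb T \x mu)%E.
Local Notation nrmT := (nrm P).
Local Notation ST := (measurableTypeR R * S)%type.

Let mu_fin : (mu setT < +oo)%E.
Proof. by apply: le_lt_trans (probability_le1 mu measurableT) _; rewrite ltry. Qed.

Lemma nrm_tensor (phi : R -> R) (v : S -> R) : phi \in Lfun (leb T) 2%:E -> v \in Lfun mu 2%:E ->
  nrmT (fun z => phi z.1 * v z.2) = nrm (leb T) phi * nrm mu v.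
Proof.
move=> Lp Lv; rewrite /nrm -sqrtrM ?ip_ge0//; congr Num.sqrt.
exact: (@ip_tensor R _ _ _ _ (lebf T) mu).
Qed.

Definition tensor_approx (f : ST -> R) : Prop := forall e, 0 < e ->
  exists n (phi : 'I_n -> R -> R) (u v : 'I_n -> S -> R),
    [/\ forall i, smooth (phi i), forall i, L (u i) (v i)
      & nrmT (fun z => f z - tsum phi u z) <= e].

Lemma L2_tsum_op n (phi : 'I_n -> R -> R) (u v : 'I_n -> S -> R) :
  (forall i, smooth (phi i)) -> (forall i, L (u i) (v i)) -> tsum phi u \in Lfun P 2%:E.
Proof.
move=> sp h; apply: (L2_tsum hT (fun i => smooth_continuous (sp i))).
by move=> i; exact: op_L2l (h i).
Qed.

Lemma tensor_approx1 : tensor_approx (fun=> 1).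
Proof.
move=> e e0; exists 1%N, (fun _ _ => 1), (fun _ _ => 1), (fun _ _ => 0); split.
- by move=> _; exact: smooth_cst.
- by move=> _; exact: (op_cst hL 1).
- under eq_fun do rewrite /tsum big_ord1 mulr1 subrr.
  by rewrite nrm0 ltW.
Qed.

Lemma tensor_approx_rect (A : set (measurableTypeR R)) (B : set S) : measurable A -> measurable B ->
  tensor_approx \1_(A `*` B).
Proof.
move=> mA mB e e0.
have LA : (\1_A : R -> R) \in Lfun (leb T) 2%:E := L2_indic (leb_lty T) mA.
have LB : (\1_B : S -> R) \in Lfun mu 2%:E := L2_indic mu_fin mB.
have k1 : 0 < 2 * (nrm mu \1_B + 1) by rewrite mulr_gt0// ltr_wpDl ?nrm_ge0.
have [phi sp hphi] := smooth_dense hT LA (divr_gt0 e0 k1).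
have Lp : phi \in Lfun (leb T) 2%:E by exact: L2_continuous (smooth_continuous sp).
have k2 : 0 < 2 * (nrm (leb T) phi + 1) by rewrite mulr_gt0// ltr_wpDl ?nrm_ge0.
have [u [v [h hu]]] := op_dense hL hspec LB (divr_gt0 e0 k2).
have Lu := op_L2l hL h.
exists 1%N, (fun=> phi), (fun=> u), (fun=> v); split => //.
have -> : (fun z => \1_(A `*` B) z - tsum (fun _ : 'I_1 => phi) (fun=> u) z) =
   (fun z => (fun t => \1_A t - phi t) z.1 * \1_B z.2 + phi z.1 * (fun x => \1_B x - u x) z.2).
  apply/funext => z; rewrite /tsum big_ord1.
  have -> : \1_(A `*` B) z = \1_A z.1 * \1_B z.2 :> R.
    by rewrite !indicE in_setX -mulnb natrM.
  by ring.
have LAp := L2B LA Lp; have LBu := L2B LB Lu.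
have T1 : (fun z : ST => (fun t => \1_A t - phi t) z.1 * \1_B z.2) \in Lfun P 2%:E.
  exact: (@L2_tensor R _ _ _ _ (lebf T) mu _ _ LAp LB).
have T2 : (fun z : ST => phi z.1 * (fun x => \1_B x - u x) z.2) \in Lfun P 2%:E.
  exact: (@L2_tensor R _ _ _ _ (lebf T) mu _ _ Lp LBu).
apply: le_trans (nrmD T1 T2) _; rewrite (nrm_tensor LAp LB) (nrm_tensor Lp LBu).
have b1 : nrm (leb T) (fun t => \1_A t - phi t) * nrm mu \1_B <= e / 2.
  apply: le_trans (ler_wpM2r (nrm_ge0 _ _) hphi) _.
  rewrite mulrAC ler_pdivrMr// mulrA divfK// ler_wpM2l ?(ltW e0)//.
  by rewrite lerDl.
have b2 : nrm (leb T) phi * nrm mu (fun x => \1_B x - u x) <= e / 2.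
  apply: le_trans (ler_wpM2l (nrm_ge0 _ _) hu) _.
  rewrite mulrA ler_pdivrMr// mulrA divfK// mulrC ler_wpM2l ?(ltW e0)//.
  by rewrite lerDl.
by rewrite [leRHS]splitr; exact: lerD.
Qed.

(** Measurable rectangles form a generating pi-system. The space factors are taken in the domain of
    L, which is dense by [op_dense]. *)
Lemma tensor_dense f : f \in Lfun P 2%:E -> tensor_approx f.
Proof.
move: f; apply: (@L2_pi_ind _ _ _ P (spacetime_lty T mu) _ _ (@measurable_prod_measurableType _ _ _ _)).
- move=> _ _ [A mA [B mB <-]] [A' mA' [B' mB' <-]]; rewrite -setXI.
  by exists (A `&` A'); [exact: measurableI|exists (B `&` B') => //; exact: measurableI].
- exact: tensor_approx1.
- by move=> _ [A mA [B mB <-]]; exact: tensor_approx_rect.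
- move=> a f g Lf Lg Qf Qg e e0.
  have a0 : 0 < `|a| + 1 by rewrite ltr_wpDl.
  have [n [p [u [v [sp h hp]]]]] := Qf _ (divr_gt0 e0 a0).
  have [n' [p' [u' [v' [sp' h' hp']]]]] := Qg _ (divr_gt0 e0 a0).
  pose c (k : 'I_(addn n n')) : R -> R := match fintype.split k with inl i => fun t => a * p i t | inr i => p' i end.
  pose w (k : 'I_(addn n n')) : S -> R := match fintype.split k with inl i => u i | inr i => u' i end.
  pose w' (k : 'I_(addn n n')) : S -> R := match fintype.split k with inl i => v i | inr i => v' i end.
  exists (n + n')%N, c, w, w'; split.
  + by move=> k; rewrite /c; case: (fintype.split k) => i //; exact: smoothZ.
  + by move=> k; rewrite /w /w'; case: (fintype.split k).
  have -> : (fun z => a * f z + g z - tsum c w z) =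
      (fun z => a * (f z - tsum p u z) + (g z - tsum p' u' z)).
    apply/funext => z; have -> : tsum c w z = a * tsum p u z + tsum p' u' z.
      rewrite /tsum big_split_ord/=; congr (_ + _).
        rewrite mulr_sumr; apply: eq_bigr => i _.
        by rewrite /c /w -[lshift _ _]/(unsplit (inl i)) unsplitK mulrA.
      by apply: eq_bigr => i _; rewrite /c /w -[rshift _ _]/(unsplit (inr i)) unsplitK.
    by ring.
  have L1 := L2B Lf (L2_tsum_op sp h); have L2 := L2B Lg (L2_tsum_op sp' h').
  apply: le_trans (nrmD (L2Z a L1) L2) _; rewrite (nrmZ a L1).
  apply: le_trans (lerD (ler_wpM2l (normr_ge0 a) hp) hp') _.
  by rewrite le_eqVlt; apply/orP; left; apply/eqP; field; rewrite gt_eqF.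
- move=> f Lf h e e0; have e2 : 0 < e / 2 by rewrite divr_gt0.
  have [g [Lg Qg hg]] := h _ e2; have [n [p [u [v [sp hL' hp]]]]] := Qg _ e2.
  exists n, p, u, v; split => //.
  have L1 := L2_tsum_op sp hL'.
  apply: le_trans (nrm_triangle Lf Lg L1) _; lra.
Qed.

End spacetime_density.

(** * One correction step *)

Section perturbation.
Context d (T : measurableType d) (R : realType) (m : {measure set T -> \bar R}).
Local Notation L2 f := (f \in Lfun m 2%:E).
Local Notation ip := (ip m).
Local Notation nrm := (nrm m).

(** The energy is not continuous in L^2, but as a pairing of u with L u it is, once both entries are
    close. This carries energy bounds from approximable functions to their approximants. *)
Lemma form_perturb (a b a' b' : T -> R) e : L2 a -> L2 b -> L2 a' -> L2 b' ->
  nrm (fun x => a x - a' x) <= e -> nrm (fun x => b x - b' x) <= e ->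
  - ip a' b' <= - ip a b + e * (nrm a + nrm b + e).
Proof.
move=> La Lb La' Lb' ha hb; have e0 : 0 <= e := le_trans (nrm_ge0 _ _) ha.
have E : ip a b = ip a' b' + (ip (fun x => a x - a' x) b + ip a' (fun x => b x - b' x)).
  by rewrite (ipBl La La' Lb) (ipBr Lb Lb' La'); ring.
have h1 := cauchy_schwarz (L2B La La') Lb; have h2 := cauchy_schwarz La' (L2B Lb Lb').
have a'e : nrm a' <= nrm a + e.
  have -> : a' = (fun x => a x - (a x - a' x)) by apply/funext => x; ring.
  by apply: le_trans (nrmB La (L2B La La')) _; rewrite lerD2l.
have k1 : ip (fun x => a x - a' x) b <= e * nrm b.
  by apply: le_trans (ler_norm _) (le_trans h1 _); apply: ler_wpM2r; rewrite ?nrm_ge0.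
have k2 : ip a' (fun x => b x - b' x) <= (nrm a + e) * e.
  by apply: le_trans (ler_norm _) (le_trans h2 _); apply: ler_pM; rewrite ?nrm_ge0.
by rewrite E; lra.
Qed.

Lemma nrm_perturb (a a' : T -> R) e : L2 a -> L2 a' -> nrm (fun x => a x - a' x) <= e ->
  nrm a' <= nrm a + e.
Proof.
move=> La La' ha; have -> : a' = (fun x => a x - (a x - a' x)) by apply/funext => x; ring.
by apply: le_trans (nrmB La (L2B La La')) _; rewrite lerD2l.
Qed.

End perturbation.

Section step.
Context (R : realType) (d : nat) (S : set 'rV[R]_d) (x0 : S)
  (mu : probability (state x0) R)
  (L : (state x0 -> R) -> (state x0 -> R) -> Prop) (T : R).
Hypothesis hL : dissipative_symmetric mu L.
Hypothesis hspec : purely_discrete_spectrum mu L.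
Hypothesis hT : 0 < T.
Hypothesis hcore : operator_core mu L
       [set v : state x0 -> R | smooth_space v /\ v \in Lfun mu 2%:E].
Variable (m : R).
Hypothesis m0 : 0 < m.
Hypothesis hp : poincare mu L m.
Local Notation ST := (measurableTypeR R * state x0)%type.
Local Notation nrmT := (nrm (lebmu mu T)).
Local Notation ipT := (ip (lebmu mu T)).
Local Notation V := (L2V mu).
Implicit Types (U W : nat -> ST -> R).

Let L1 : (fun=> 1) \in Lfun mu 2%:E.
Proof. exact: (op_L2l hL (op_cst hL 1)). Qed.

Let L2T1 : L2T mu T (fun=> 1).
Proof. by apply: L2_cst; exact: spacetime_lty. Qed.

(** Each time slice of w is in the range of L, hence of mean zero, and so orthogonal to constants in
    x. *)
Lemma op_orthogonal (psi : R -> R) (u w : ST -> R) : continuous psi -> L2T mu T w ->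
  (forall t, L (fun x => u (t, x)) (fun x => w (t, x))) ->
  ipT (fun z => psi z.1 * 1) w = 0.
Proof.
move=> cp Lw h; have Lp := L2T_tensor hT cp L1.
have [_ E] := fubini_ipT Lp Lw.
apply: EFin_inj; rewrite -E /=; apply: integral0_eq => t _; congr EFin.
by rewrite (ipZl (psi t) L1 (op_L2r hL (h t))) ipC -meanE (op_mean hL (h t)) mulr0.
Qed.

Let D (b : R) := b * (15 + 3 * m + 144 / m ^+ 2 + 6 / m).

Lemma correct_source n (phi : 'I_n -> R -> R) (c c' : 'I_n -> V) (e b : R) :
  (forall i, smooth (phi i)) -> (forall i, Zop L m (c i) (c' i)) -> 0 < e -> 1 <= b ->
  (forall j, [/\ time_op T b (opU T j), time_op T b (opU1 T j), time_op T b (opU2 T j),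
      time_op T b (opV T j) & time_op T b (fun phi t => phi t - opU T j phi t)]) ->
  let F : ST -> R := tsum phi c in
  exists H G, [/\ app mu L T H /\ app mu L T G,
    [/\ nrmT (H 0%N) ^+ 2 <= D b * nrmT F ^+ 2, nrmT (H 1%N) ^+ 2 <= D b * nrmT F ^+ 2
      & - ipT (H 0%N) (H 3%N) <= D b * nrmT F ^+ 2],
    [/\ [/\ nrmT (G 0%N) ^+ 2 <= D b * nrmT F ^+ 2, nrmT (G 1%N) ^+ 2 <= D b * nrmT F ^+ 2,
            nrmT (G 2%N) ^+ 2 <= D b * nrmT F ^+ 2 & nrmT (G 3%N) ^+ 2 <= D b * nrmT F ^+ 2],
        - ipT (G 0%N) (G 3%N) <= D b * nrmT F ^+ 2
      & - ipT (G 1%N) (G 4%N) <= D b * nrmT F ^+ 2]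
    & nrmT (fun z => F z - (H 1%N z - 2 * G 3%N z)) <= nrmT F / 8 + e].
Proof.
move=> sp hZ e0 b1 tops F; have cp i : continuous (phi i) := smooth_continuous (sp i).
pose XF : ST -> R := tsum phi (fun i x => c' i x + 6 * c i x).
(* This J makes the high-frequency part of the residual at most e. *)
have [J hJ] : exists J, 3 / 4 ^+ J * nrmT XF <= e.
  have K0 : 0 < 3 * nrmT XF + 1 by rewrite ltr_wpDl ?mulr_ge0 ?nrm_ge0.
  have c4 : (4^-1) ^+ k @[k --> \oo] --> (0 : R) by apply: cvg_expr; rewrite ger0_norm; lra.
  have /cvgrPdist_lt /(_ _ (divr_gt0 e0 K0)) [k _ /(_ k (leqnn _))] := c4.
  rewrite /= sub0r normrN exprVn ger0_norm ?invr_ge0 ?exprn_ge0// => /ltW h.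
  exists k; apply: (@le_trans _ _ ((4 ^+ k)^-1 * (3 * nrmT XF + 1))).
    have : 0 <= (4 ^+ k)^-1 :> R by rewrite invr_ge0 exprn_ge0.
    by rewrite [_ / _]mulrC -mulrA mulrDr mulr1 lerDl.
  by rewrite -ler_pdivlMr.
have [W hW] := choice (fun i => (chainable_polQ hL hspec m0 J).2 _ _ (hZ i)).
have ZW i k : (k <= 3 * J.+1)%N -> Zop L m (W i k) (W i k.+1) by apply: (hW i).1.
have cE i : c i = poly_act (3 * J.+1) W i (polQ R J) by apply: (hW i).2.
have FE : F = source J phi W.
  by rewrite /F /source; congr tsum; apply/funext => i; rewrite cE.
exists (corr_h T m J phi W), (corr_g T m J phi W); split.
- split; [exact: (app_corr_h hL hT hcore sp ZW)|exact: (app_corr_g hL hT hcore m0 phi ZW)].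
- by rewrite FE; exact: (corr_h_bounds hL hT m0 hp sp ZW b1 tops).
- by rewrite FE; exact: (corr_g_bounds hL hT m0 hp sp ZW b1 tops).
- rewrite FE; apply: le_trans (corr_residual hL hT m0 hp sp ZW) _.
  rewrite lerD2l; apply: le_trans hJ; rewrite ler_wpM2l ?divr_ge0 ?exprn_ge0//.
  (* J was fixed in terms of X F before the chain W, which depends on J. So X F was expressed by the
     given c' = Z c; uniqueness of L almost everywhere identifies it with the expression through
     W. *)
  pose a i : state x0 -> R := poly_act (3 * J.+1) W i (polX R * polQ R J).
  pose a' i : state x0 -> R := fun x => c' i x + 6 * c i x.
  have La i : a i \in Lfun mu 2%:E := L2V_L2 _.
  have La' i : a' i \in Lfun mu 2%:E := L2D (L2V_L2 (c' i)) (L2Z 6 (L2V_L2 (c i))).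
  have ae i : a i = a' i %[ae mu].
    have h1 := act_op hL ZW i (size_polQ R J); have [_ h2] := hZ i.
    rewrite -cE in h1; apply: filterS (op_uniq hL h1 h2) => x /= /(_ I) h _.
    apply: (mulfI _ h); by rewrite oppr_eq0 gt_eqF// divr_gt0.
  have E v : (forall i, v i \in Lfun mu 2%:E) -> ipT (tsum phi v) (tsum phi v) =
      \sum_i \sum_l tip T (phi i) (phi l) * ip mu (v i) (v l).
    move=> Lv; have Lt i := L2T_tensor hT (@cp i) (Lv i).
    rewrite (ip_suml Lt (L2_sum Lt)); apply: eq_bigr => i _.
    rewrite ipC (ip_suml Lt (Lt i)); apply: eq_bigr => l _.
    by rewrite ipC; exact: ipT_tensor.
  rewrite /nrm (E a La) (E a' La') ler_sqrt; last first.
    by rewrite -(E a' La'); exact: ip_ge0.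
  rewrite le_eqVlt; apply/orP; left; apply/eqP.
  apply: eq_bigr => i _; apply: eq_bigr => l _; congr (_ * _).
  by rewrite (ip_ae (ae i))// ipC (ip_ae (ae l))// ipC.
Qed.

Let tip_cst (phi : R -> R) (k : R) : continuous phi -> tip T phi (fun=> k) = k * intg phi 0 T.
Proof.
by move=> cphi; rewrite /tip -intgZ//; congr intg; apply/funext => t; rewrite mulrC.
Qed.

(** At level 0 there is a single cell, and zero total mass makes [opU] vanish; [opV] is then the
    primitive of phi, and the constant function of x is annihilated by L. *)
Lemma correct_mean (phi : R -> R) b : smooth phi -> intg phi 0 T = 0 ->
  time_op T b (opV T 0) ->
  exists H, [/\ app mu L T H, nrmT (H 0%N) ^+ 2 <= b * tip T phi phi,
    H 1%N = (fun z => phi z.1 * 1), exists2 psi : R -> R, continuous psi & H 0%N = (fun z => psi z.1 * 1)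
    & H 3%N = (fun=> 0)].
Proof.
move=> sp i0 tV; have cp := smooth_continuous sp.
have U0 t : opU T 0 phi t = 0.
  rewrite /opU /comb expn0 big_ord1 /cellmass mul0r mul1r expr0 divr1 i0.
  by rewrite mul0r mulr0.
have sV : smooth (fun t => 2 ^- 0 * opV T 0 phi t) by apply: smoothZ; exact: smooth_opV.
exists (jet_tensor (fun t => 2 ^- 0 * opV T 0 phi t) (fun=> 1) (fun=> 0)); split.
- apply: (app_tensor hL hT hcore) => //.
  + by rewrite opV_0 ?mulr0.
  + by rewrite opV_T ?mulr0.
  + exact: (op_cst hL 1).
- rewrite nrm_sqr.
  have -> : jet_tensor (fun t => 2 ^- 0 * opV T 0 phi t) (fun=> 1) (fun=> 0) 0%N =
      (fun z : ST => opV T 0 phi z.1 * 1).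
    by apply/funext => z; rewrite /jet_tensor/= expr0 invr1 mul1r.
  have cV := top_cont tV cp.
  rewrite (ipT_tensor hT cV cV L1 L1).
  have -> : ip mu (fun=> 1) (fun=> 1) = 1.
    rewrite /ip mulr1 Rintegral_cst// mul1r.
    exact: (congr1 fine (probability_setT mu)).
  by rewrite mulr1; exact: top_le.
- apply/funext => z; rewrite /jet_tensor/=; congr (_ * _).
  by rewrite (derive1_is_derive (fun t => opV_is_derive T 0 t cp)) U0 subr0.
- by exists (fun t => 2 ^- 0 * opV T 0 phi t) => //; exact: smooth_continuous.
- by apply/funext => z; rewrite /jet_tensor/= mulr0.
Qed.

Let ip11 : ip mu (fun=> 1) (fun=> 1) = 1.
Proof. by rewrite /ip mulr1 Rintegral_cst// mul1r; exact: (congr1 fine (probability_setT mu)). Qed.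

Let one_tensor : (fun=> 1) = (fun z : ST => (fun _ : R => 1) z.1 * (fun _ : state x0 => 1 : R) z.2).
Proof. by apply/funext => z; rewrite mulr1. Qed.

Let c1 (k : R) : continuous (fun _ : R => k). Proof. by move=> t; exact: cvg_cst. Qed.

(** Subtracting the mean in x from every space factor gives orthogonal parts; the two norm bounds
    come from Pythagoras. *)
Lemma mean_split n (phi : 'I_n -> R -> R) (u v : 'I_n -> state x0 -> R) :
  (forall i, smooth (phi i)) -> (forall i, L (u i) (v i)) ->
  exists c c' Phi, [/\ (forall i, Zop L m (c i) (c' i)) /\ smooth Phi,
    tsum phi u = (fun z => tsum phi (c : 'I_n -> V) z + Phi z.1 * 1),
    nrmT (tsum phi c) <= nrmT (tsum phi u), tip T Phi Phi <= nrmT (tsum phi u) ^+ 2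
    & ipT (tsum phi u) (fun=> 1) = intg Phi 0 T].
Proof.
move=> sp h; have cp i : continuous (phi i) := smooth_continuous (sp i).
pose a i := mean mu (u i).
have Lc i : L (fun x => u i x - a i) (v i).
  have := op_sub hL (h i) (op_cst hL (a i)); congr L.
  by apply/funext => x; rewrite subr0.
have Lu i := op_L2l hL (h i); have Lv i := op_L2r hL (h i); have Lci i := op_L2l hL (Lc i).
have Lc' i : (fun x => - (6 / m) * v i x - 6 * (u i x - a i)) \in Lfun mu 2%:E.
  exact: L2B (L2Z _ (Lv i)) (L2Z _ (Lci i)).
pose c i : V := vec (Lci i); pose c' i : V := vec (Lc' i).
have mc i : ip mu (c i) (fun=> 1) = 0.
  have := ipBl (Lu i) (L2Z (a i) L1) L1; rewrite (ipZl (a i) L1 L1) ip11 mulr1.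
  rewrite -[X in _ = X - _]meanE subrr.
  by [].
pose Phi t := \sum_i a i * phi i t.
have sPhi : smooth Phi by apply: smooth_sum => i; exact: smoothZ.
have cPhi := smooth_continuous sPhi.
have FE : tsum phi u = (fun z => tsum phi c z + Phi z.1 * 1).
  apply/funext => z; rewrite mulr1 /tsum /Phi -big_split/=; apply: eq_bigr => i _.
  by apply: (@etrans _ _ (phi i z.1 * (u i z.2 - a i) + a i * phi i z.1)) => //; ring.
have LF : L2T mu T (tsum phi c) := L2_tsum hT cp (fun i => L2V_L2 (c i)).
have LM : L2T mu T (fun z => Phi z.1 * 1) := L2T_tensor hT cPhi L1.
have orth (psi : R -> R) : continuous psi -> ipT (tsum phi c) (fun z => psi z.1 * 1) = 0.
  move=> cpsi; rewrite (ip_suml (fun i => L2T_tensor hT (@cp i) (L2V_L2 (c i))) (L2T_tensor hT cpsi L1)).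
  by apply: big1 => i _; rewrite (ipT_tensor hT (@cp i) cpsi (L2V_L2 (c i)) L1) mc mulr0.
have pyth : nrmT (tsum phi u) ^+ 2 = nrmT (tsum phi c) ^+ 2 + tip T Phi Phi.
  rewrite FE !nrm_sqr (ipDl LF LM (L2D LF LM)) (ipDr LF LM LF) (ipDr LF LM LM).
  have orthC : ipT (fun z => Phi z.1 * 1) (tsum phi c) = 0 by rewrite ipC; exact: orth.
  by rewrite (orth _ cPhi) orthC (ipT_tensor hT cPhi cPhi L1 L1) ip11; ring.
exists c, c', Phi; split => //.
- split=> // i; split; first by rewrite meanE mc.
  have := Lc i; congr L; apply/funext => x.
  apply: (@etrans _ _ (- (m / 6) * (- (6 / m) * v i x - 6 * (u i x - a i) + 6 * (u i x - a i)))) => //.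
  by field; rewrite gt_eqF.
- rewrite -(@ler_pXn2r _ 2)// ?nnegrE ?nrm_ge0// pyth lerDl; exact: tip_ge0.
- by rewrite pyth lerDr sqr_ge0.
- rewrite FE one_tensor (ipDl LF LM (L2T_tensor hT (@c1 1) L1)).
  rewrite (orth (fun=> 1) (@c1 1)) (ipT_tensor hT cPhi (@c1 1) L1 L1) ip11 tip_cst//.
  by ring.
Qed.

(** The outcome of one step for the right-hand side f: bounded corrections with bounded energies,
    and a residual smaller by the factor 1/4. *)
Record correction (C : R) (f : ST -> R) H G : Prop := {
  cor_h : nice mu L T H;
  cor_g : nice mu L T G;
  cor_hn : forall i, (i < 2)%N -> nrmT (H i) <= C * nrmT f;
  cor_gn : forall i, (i < 4)%N -> nrmT (G i) <= C * nrmT f;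
  cor_he : - ipT (H 0%N) (H 3%N) <= (C * nrmT f) ^+ 2;
  cor_ge : - ipT (G 0%N) (G 3%N) <= (C * nrmT f) ^+ 2;
  cor_gte : - ipT (G 1%N) (G 4%N) <= (C * nrmT f) ^+ 2;
  cor_res : nrmT (fun z => f z - (H 1%N z - 2 * G 3%N z)) <= nrmT f / 4 }.

(** Replacing approximable corrections by test functions costs 1/100 of |f| for d_t h and 2/100 for
    2 L g in the residual, which brings 22/100 up to 1/4. The constant K + 1 absorbs the errors in
    norms and energies. *)
Lemma perturb_correction (K : R) f Ht Gc : app mu L T Ht -> app mu L T Gc ->
  L2T mu T f -> 0 < nrmT f -> 0 <= K ->
  (forall i, (i < 2)%N -> nrmT (Ht i) <= K * nrmT f) ->
  (forall i, (i < 4)%N -> nrmT (Gc i) <= K * nrmT f) ->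
  - ipT (Ht 0%N) (Ht 3%N) <= K * nrmT f ^+ 2 ->
  - ipT (Gc 0%N) (Gc 3%N) <= K * nrmT f ^+ 2 ->
  - ipT (Gc 1%N) (Gc 4%N) <= K * nrmT f ^+ 2 ->
  nrmT (fun z => f z - (Ht 1%N z - 2 * Gc 3%N z)) <= nrmT f * 22 / 100 ->
  exists H G, correction (K + 1) f H G.
Proof.
move=> aHt aGc Lf nf0 K0 bHt bGc e1 e2 e3 res; set nf := nrmT f in nf0 bHt bGc e1 e2 e3 res.
have LHt i := app_L2 aHt i; have LGc i := app_L2 aGc i.
pose s := nrmT (Ht 0%N) + nrmT (Ht 3%N) + (nrmT (Gc 0%N) + nrmT (Gc 3%N)) +
  (nrmT (Gc 1%N) + nrmT (Gc 4%N)).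
have s0 : 0 <= s by rewrite /s !addr_ge0 ?nrm_ge0.
have s1 : 0 < s + nf by rewrite ltr_wpDl.
have nfs : 0 < nf ^+ 2 / (s + nf) by rewrite divr_gt0// exprn_gt0.
have dl0 : 0 < nf / 100 by rewrite divr_gt0.
have dln : nf / 100 <= nf by rewrite ler_pdivrMr// ler_peMr ?(ltW nf0)// ler1n.
(* The first bound serves the norms and the residual; the second makes the error of [form_perturb]
   at most |f|^2. *)
pose e := Num.min (nf / 100) (nf ^+ 2 / (s + nf)).
have e0 : 0 < e by rewrite lt_min dl0.
have edl : e <= nf / 100 by rewrite ge_min lexx.
have enf := le_trans edl dln.
have es a a' : 0 <= a -> 0 <= a' -> a + a' <= s -> e * (a + a' + e) <= nf ^+ 2.
  move=> a0 a'0 h1; have h2 : e <= nf ^+ 2 / (s + nf) by rewrite ge_min lexx orbT.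
  apply: (@le_trans _ _ (nf ^+ 2 / (s + nf) * (s + nf))); last by rewrite divfK// gt_eqF.
  apply: ler_pM => //; first exact: ltW.
    by rewrite !addr_ge0// ltW.
  exact: lerD.
have [H [nH hH]] := app_nice aHt e0; have [G [nG hG]] := app_nice aGc e0.
have LH i := nice_L2 nH i; have LG i := nice_L2 nG i.
have C2 x : x <= K * nf ^+ 2 -> x + nf ^+ 2 <= ((K + 1) * nf) ^+ 2.
  move=> hx; apply: (@le_trans _ _ (K * nf ^+ 2 + nf ^+ 2)); first by rewrite lerD2r.
  rewrite -[X in _ + X]mul1r -mulrDl exprMn ler_wpM2r ?sqr_ge0//.
  by rewrite expr2 ler_peMl ?addr_ge0// lerDr.
have C1 x y : x <= K * nf -> y <= x + e -> y <= (K + 1) * nf.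
  move=> h1 h2; apply: le_trans h2 _; rewrite mulrDl mul1r; exact: lerD.
clearbody e; exists H, G; split => //.
- by move=> i i2; exact: C1 (bHt i i2) (nrm_perturb (LHt i) (LH i) (hH i)).
- by move=> i i4; exact: C1 (bGc i i4) (nrm_perturb (LGc i) (LG i) (hG i)).
- apply: le_trans (form_perturb (LHt 0%N) (LHt 3%N) (LH 0%N) (LH 3%N) (hH 0%N) (hH 3%N)) _.
  apply: le_trans (C2 _ e1); rewrite lerD2l; apply: es; rewrite ?nrm_ge0//.
  by rewrite /s -addrA lerDl !addr_ge0 ?nrm_ge0.
- apply: le_trans (form_perturb (LGc 0%N) (LGc 3%N) (LG 0%N) (LG 3%N) (hG 0%N) (hG 3%N)) _.
  apply: le_trans (C2 _ e2); rewrite lerD2l; apply: es; rewrite ?nrm_ge0//.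
  by rewrite /s addrAC lerDr !addr_ge0 ?nrm_ge0.
- apply: le_trans (form_perturb (LGc 1%N) (LGc 4%N) (LG 1%N) (LG 4%N) (hG 1%N) (hG 4%N)) _.
  apply: le_trans (C2 _ e3); rewrite lerD2l; apply: es; rewrite ?nrm_ge0//.
  by rewrite /s lerDr !addr_ge0 ?nrm_ge0.
- pose r1 z := f z - (Ht 1%N z - 2 * Gc 3%N z).
  pose r4 z := Ht 1%N z - H 1%N z; pose r5 z := Gc 3%N z - G 3%N z.
  have -> : (fun z => f z - (H 1%N z - 2 * G 3%N z)) =
      (fun z => r1 z + (r4 z + (- 2) * r5 z)).
    by apply/funext => z; rewrite /r1 /r4 /r5; ring.
  have q1 : L2T mu T r1 := L2B Lf (L2B (LHt 1%N) (L2Z 2 (LGc 3%N))).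
  have q4 : L2T mu T r4 := L2B (LHt 1%N) (LH 1%N).
  have q5 : L2T mu T r5 := L2B (LGc 3%N) (LG 3%N).
  have q5' := L2Z (-2) q5; have q45 := L2D q4 q5'.
  have n5 : nrmT (fun z => (-2) * r5 z) <= 2 * (nf / 100).
    by rewrite (nrmZ _ q5) normrN ger0_norm// ler_wpM2l//; exact: le_trans (hG 3%N) edl.
  apply: le_trans (nrmD q1 q45) _.
  have := lerD res (le_trans (nrmD q4 q5') (lerD (le_trans (hH 1%N) edl) n5)).
  move=> h; apply: le_trans h _; rewrite le_eqVlt; apply/orP; left; apply/eqP.
  by rewrite -/nf; field.
Qed.

Lemma sqr_le (D' x y : R) : 0 <= D' -> 0 <= x -> 0 <= y -> x ^+ 2 <= D' * y ^+ 2 -> x <= (D' + 1) * y.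
Proof.
move=> D0 x0' y0 h; rewrite -(@ler_pXn2r _ 2)// ?nnegrE ?mulr_ge0 ?addr_ge0//.
apply: le_trans h _; rewrite exprMn ler_wpM2r ?sqr_ge0//.
by have := sqr_ge0 D'; rewrite sqrrD expr1n mulr1; lra.
Qed.

(** The approximant F of f need not have total integral zero, so the average kap is removed from its
    x-independent part. As f has integral zero, kap T = <F - f, 1>, and Cauchy-Schwarz bounds the
    discarded constant by |f - F|. *)
Lemma correct_mean_residual f F (Phi : R -> R) : L2T mu T f -> L2T mu T F -> smooth Phi ->
  ipT f (fun=> 1) = 0 -> ipT F (fun=> 1) = intg Phi 0 T ->
  let kap := intg Phi 0 T / T in
  [/\ smooth (fun t => Phi t + - kap), intg (fun t => Phi t + - kap) 0 T = 0,
    tip T (fun t => Phi t + - kap) (fun t => Phi t + - kap) <= tip T Phi Phi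
    & nrmT (fun=> kap * 1) <= nrmT (fun z => f z - F z)].
Proof.
move=> Lf LF sPhi f1 iPhi kap.
have cPhi := smooth_continuous sPhi.
have sphi0 : smooth (fun t => Phi t + - kap) by apply: smoothD => //; exact: smooth_cst.
have kT : kap * T = intg Phi 0 T by rewrite /kap divfK// gt_eqF.
split => //.
- by rewrite intgD// intg_cst subr0 mulNr kT subrr.
- have E : (fun t => (Phi t + - kap) * (Phi t + - kap)) =
      (fun t => Phi t * Phi t + ((- 2 * kap) * Phi t + kap ^+ 2)).
    by apply/funext => t; ring.
  rewrite /tip E intgD//; last 2 first.
  - exact: contM.
  - by apply: contD => //; exact: contZ.
  rewrite intgD//; last exact: contZ.
  rewrite intgZ// intg_cst -kT subr0 gerDl.
  have -> : - 2 * kap * (kap * T) + kap ^+ 2 * T = - (kap ^+ 2 * T) by ring.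
  by rewrite oppr_le0 mulr_ge0 ?sqr_ge0// ltW.
- have nn1 : nrmT (fun=> 1) ^+ 2 = T.
    rewrite nrm_sqr one_tensor (ipT_tensor hT (@c1 1) (@c1 1) L1 L1) ip11 mulr1 tip_cst//.
    by rewrite intg_cst; ring.
  have nn0 : 0 < nrmT (fun=> 1).
    rewrite lt_neqAle nrm_ge0 andbT eq_sym; apply/eqP => z1.
    by move: nn1; rewrite z1 expr0n /= => T0; have := hT; rewrite -T0 ltxx.
  have h1 : `|intg Phi 0 T| <= nrmT (fun z => f z - F z) * nrmT (fun=> 1).
    have -> : intg Phi 0 T = ipT (fun z => F z - f z) (fun=> 1).
      by rewrite (ipBl LF Lf L2T1) f1 subr0 -iPhi.
    apply: le_trans (cauchy_schwarz (L2B LF Lf) L2T1) _.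
    by rewrite ler_wpM2r ?nrm_ge0// nrmBC.
  rewrite (nrmZ kap L2T1) /kap normrM normfV (gtr0_norm hT).
  rewrite mulrAC ler_pdivrMr// -[X in _ <= _ * X]nn1.
  by rewrite expr2 mulrA ler_wpM2r ?nrm_ge0.
Qed.

Let arith1 (n : R) : 0 <= n -> n + n / 100 <= 2 * n. Proof. lra. Qed.
Let arith2 (n : R) : 0 <= n -> n / 100 + ((n + n / 100) / 8 + n / 100 + n / 100) <= n * 22 / 100.
Proof. lra. Qed.

(** Origin of the constant: |F| <= 2 |f| gives 2 (D' + 1) and 2 (b + 1) for the norms of the
    mean-zero and the x-independent corrections, and 4 D' for the energies; the last 1 comes from
    [perturb_correction]. *)
Lemma correct_source_total (D' b kap : R) (f F Fc : ST -> R) (Phi phi0 psi : R -> R) Hc Gc Hm :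
  0 <= D' -> 1 <= b -> L2T mu T f -> 0 < nrmT f -> L2T mu T F -> L2T mu T Fc ->
  nrmT (fun z => f z - F z) <= nrmT f / 100 ->
  F = (fun z => Fc z + Phi z.1 * 1) -> phi0 = (fun t => Phi t + - kap) ->
  nrmT Fc <= nrmT F -> nrmT (fun=> kap * 1) <= nrmT (fun z => f z - F z) ->
  app mu L T Hc -> app mu L T Gc -> app mu L T Hm ->
  nrmT (Hm 0%N) ^+ 2 <= b * nrmT F ^+ 2 -> nrmT (Hm 1%N) ^+ 2 <= b * nrmT F ^+ 2 ->
  Hm 1%N = (fun z => phi0 z.1 * 1) -> Hm 3%N = (fun=> 0) ->
  continuous psi -> Hm 0%N = (fun z => psi z.1 * 1) ->
  (forall i, (i < 2)%N -> nrmT (Hc i) ^+ 2 <= D' * nrmT Fc ^+ 2) ->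
  (forall i, (i < 4)%N -> nrmT (Gc i) ^+ 2 <= D' * nrmT Fc ^+ 2) ->
  - ipT (Hc 0%N) (Hc 3%N) <= D' * nrmT Fc ^+ 2 ->
  - ipT (Gc 0%N) (Gc 3%N) <= D' * nrmT Fc ^+ 2 ->
  - ipT (Gc 1%N) (Gc 4%N) <= D' * nrmT Fc ^+ 2 ->
  nrmT (fun z => Fc z - (Hc 1%N z - 2 * Gc 3%N z)) <= nrmT Fc / 8 + nrmT f / 100 ->
  exists H G, correction (2 * (D' + 1) + 2 * (b + 1) + 4 * D' + 1) f H G.
Proof.
move=> D0 b1 Lf nf0 LF LFc hF FE phi0E nc nk aHc aGc aHm m0' m1' Hm1 Hm3 cpsi Hm0 hc gc hce gce gcte res.
have nf0' := ltW nf0; set nf := nrmT f in nf0 nf0' hF res.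
have nF : nrmT F <= nf + nf / 100 := nrm_perturb Lf LF hF.
have nF2 : nrmT F <= 2 * nf := le_trans nF (arith1 nf0').
have nFc2 : nrmT Fc <= 2 * nf := le_trans nc nF2.
have b2 : 0 <= b := le_trans ler01 b1.
have D1 : 0 <= D' + 1 by rewrite addr_ge0.
have B1 : 0 <= b + 1 by rewrite addr_ge0.
have big x : 0 <= x -> x ^+ 2 <= D' * nrmT Fc ^+ 2 -> x <= 2 * (D' + 1) * nf.
  move=> x0' hx; apply: le_trans (sqr_le D0 x0' (nrm_ge0 _ _) hx) _.
  by rewrite mulrAC [leRHS]mulrC; exact: ler_wpM2l.
have bigm x : 0 <= x -> x ^+ 2 <= b * nrmT F ^+ 2 -> x <= 2 * (b + 1) * nf.
  move=> x0' hx; apply: le_trans (sqr_le b2 x0' (nrm_ge0 _ _) hx) _.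
  by rewrite mulrAC [leRHS]mulrC; exact: ler_wpM2l.
have K1 : 0 <= 2 * (D' + 1) * nf by rewrite !mulr_ge0.
have K2 : 0 <= 2 * (b + 1) * nf by rewrite !mulr_ge0.
have K3 : 0 <= 4 * D' * nf by rewrite !mulr_ge0.
pose K := 2 * (D' + 1) + 2 * (b + 1) + 4 * D'.
have KE : K * nf = 2 * (D' + 1) * nf + 2 * (b + 1) * nf + 4 * D' * nf by rewrite /K; ring.
have K0 : 0 <= K by rewrite /K !addr_ge0 ?mulr_ge0.
have bigE x : x <= D' * nrmT Fc ^+ 2 -> x <= K * nf ^+ 2.
  move=> hx; apply: le_trans hx _; apply: (@le_trans _ _ (4 * D' * nf ^+ 2)).
    have -> : 4 * D' * nf ^+ 2 = D' * (2 * nf) ^+ 2 by ring.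
    by rewrite ler_wpM2l// lerXn2r// nnegrE ?nrm_ge0 ?mulr_ge0.
  by rewrite ler_wpM2r ?sqr_ge0// /K lerDr addr_ge0// mulr_ge0.
pose Ht i z := Hc i z + Hm i z.
have aHt : app mu L T Ht := app_add hL aHc aHm.
have LHc i := app_L2 aHc i; have LHm i := app_L2 aHm i; have LGc i := app_L2 aGc i.
apply: (@perturb_correction K f Ht Gc) => //.
- move=> i i2; apply: le_trans (nrmD (LHc i) (LHm i)) _.
  have h1 : nrmT (Hc i) <= 2 * (D' + 1) * nf by apply: big; [exact: nrm_ge0|exact: hc].
  have h2 : nrmT (Hm i) <= 2 * (b + 1) * nf.
    by apply: bigm; first exact: nrm_ge0; case: i i2 {h1} => [|[|]].
  by apply: le_trans (lerD h1 h2) _; rewrite KE lerDl.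
- move=> i i4; have h1 : nrmT (Gc i) <= 2 * (D' + 1) * nf.
    by apply: big; [exact: nrm_ge0|exact: gc].
  by apply: le_trans h1 _; rewrite KE -addrA lerDl addr_ge0.
(* The x-independent part adds no energy: L annihilates it, and it is orthogonal to the range of
   L. *)
- apply: bigE; have -> : Ht 3%N = Hc 3%N by apply/funext => z; rewrite /Ht Hm3 addr0.
  rewrite (ipDl (LHc 0%N) (LHm 0%N) (LHc 3%N)) Hm0.
  by rewrite (op_orthogonal cpsi (LHc 3%N) (app_op aHc)) addr0.
- exact: bigE.
- exact: bigE.
- pose r1 z := f z - F z; pose r2 z := Fc z - (Hc 1%N z - 2 * Gc 3%N z).
  pose r3 (z : ST) := kap * 1.
  have -> : (fun z => f z - (Ht 1%N z - 2 * Gc 3%N z)) = (fun z => r1 z + (r2 z + r3 z)).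
    by apply/funext => z; rewrite /r1 /r2 /r3 /Ht FE Hm1 phi0E; ring.
  have q1 : L2T mu T r1 := L2B Lf LF.
  have q2 : L2T mu T r2 := L2B LFc (L2B (LHc 1%N) (L2Z 2 (LGc 3%N))).
  have q3 : L2T mu T r3 := L2Z kap L2T1.
  apply: le_trans (nrmD q1 (L2D q2 q3)) _.
  have h3 := le_trans nk hF.
  have h2 : nrmT r2 <= (nf + nf / 100) / 8 + nf / 100.
    by apply: le_trans res _; rewrite lerD2r ler_wpM2r//; exact: le_trans nc nF.
  apply: le_trans (lerD hF (le_trans (nrmD q2 q3) (lerD h2 h3))) _.
  exact: arith2.
Qed.

Lemma step_correction : exists2 C : R, 0 < C & forall f, L2T mu T f -> ipT f (fun=> 1) = 0 ->
  exists H G, correction C f H G.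
Proof.
have [b0 b00 tops0] := time_ops hT; pose b := b0 + 1.
have b1 : 1 <= b by rewrite /b lerDr.
have b2 : 0 <= b := le_trans ler01 b1.
have tops j : [/\ time_op T b (opU T j), time_op T b (opU1 T j), time_op T b (opU2 T j),
    time_op T b (opV T j) & time_op T b (fun phi t => phi t - opU T j phi t)].
  have b01 : b0 <= b by rewrite lerDl.
  by have [h1 h2 h3 h4 h5] := tops0 j; split; exact: (time_op_le hT b01).
have D0 : 0 <= D b.
  by rewrite /D mulr_ge0// !addr_ge0 ?mulr_ge0 ?invr_ge0 ?sqr_ge0 ?(ltW m0).
pose C := 2 * (D b + 1) + 2 * (b + 1) + 4 * D b + 1.
have C0 : 0 < C.
  by rewrite /C; move: (D b) D0 => x x0'; rewrite ltr_wpDl// !addr_ge0 ?mulr_ge0 ?addr_ge0.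
exists C => // f Lf f1.
(* The tolerances below are fractions of |f|, so |f| = 0 is treated apart. *)
have := nrm_ge0 (lebmu mu T) f; rewrite le_eqVlt => /predU1P[nf0|nf0].
  have n0 : nice mu L T (fun _ _ => 0) := nice0 T hL.
  exists (fun _ _ => 0), (fun _ _ => 0); split => //.
  - by move=> i _; rewrite nrm0 -nf0 mulr0.
  - by move=> i _; rewrite nrm0 -nf0 mulr0.
  - by rewrite ip0l oppr0 sqr_ge0.
  - by rewrite ip0l oppr0 sqr_ge0.
  - by rewrite ip0l oppr0 sqr_ge0.
  - by under eq_fun do rewrite mulr0 !subr0; rewrite -nf0 mul0r.
have dl0 : 0 < nrmT f / 100 by rewrite divr_gt0.
have [n [phi [u [v [sp h hF]]]]] := tensor_dense hL hspec hT Lf dl0.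
have LF := L2_tsum_op hL hT sp h.
have [c [c' [Phi [[hZ sPhi] FE nc nPhi iPhi]]]] := mean_split sp h.
have LFc : L2T mu T (tsum phi (fun i => c i)).
  exact: (L2_tsum hT (fun i => smooth_continuous (sp i)) (fun i => L2V_L2 (c i))).
have [sphi0 i0 t0 nk] := correct_mean_residual Lf LF sPhi f1 iPhi.
have [_ _ _ tV _] := tops 0%N.
have [Hm [aHm nHm Hm1 [psi cpsi Hm0] Hm3]] := correct_mean sphi0 i0 tV.
have [Hc [Gc [[aHc aGc] [hc0 hc1 hc2] [[gc0 gc1 gc2 gc3] gc4 gc5] res]]] :=
  correct_source sp hZ dl0 b1 tops.
have t1 := le_trans t0 nPhi.
have nHm0 : nrmT (Hm 0%N) ^+ 2 <= b * nrmT (tsum phi u) ^+ 2.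
  by apply: le_trans nHm _; exact: ler_wpM2l.
have nHm1 : nrmT (Hm 1%N) ^+ 2 <= b * nrmT (tsum phi u) ^+ 2.
  have cphi0 := smooth_continuous sphi0.
  rewrite Hm1 nrm_sqr (ipT_tensor hT cphi0 cphi0 L1 L1) ip11 mulr1.
  by apply: le_trans t1 _; rewrite ler_peMl ?sqr_ge0.
apply: (@correct_source_total (D b) b _ f (tsum phi u) (tsum phi (fun i => c i)) Phi _ psi Hc Gc Hm
  D0 b1 Lf nf0 LF LFc hF FE erefl nc nk aHc aGc aHm nHm0 nHm1 Hm1 Hm3 cpsi Hm0 _ _ hc2 gc4 gc5 res).
- by case=> [|[|]].
- by case=> [|[|[|[|]]]].
Qed.

End step.

(** * Energy of limits *)

Section nonneg_form.
Context d (T : measurableType d) (R : realType) (m : {measure set T -> \bar R}).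
Variable Q : (T -> R) -> (T -> R) -> Prop.
Hypothesis Ql : forall a b, Q a b -> a \in Lfun m 2%:E.
Hypothesis Qr : forall a b, Q a b -> b \in Lfun m 2%:E.
Hypothesis Q0 : Q (fun=> 0) (fun=> 0).
Hypothesis Qlin : forall c a b a' b', Q a b -> Q a' b' ->
  Q (fun x => c * a x + a' x) (fun x => c * b x + b' x).
Hypothesis Qneg : forall a b, Q a b -> ip m a b <= 0.
Local Notation ip := (ip m).

Lemma form_add a b a' b' : Q a b -> Q a' b' ->
  Q (fun x => a x + a' x) (fun x => b x + b' x).
Proof.
move=> h h'; have := Qlin 1 h h'.
by under eq_fun do rewrite mul1r; under [X in Q _ X -> _]eq_fun do rewrite mul1r.
Qed.

Lemma form_sum n (w v : nat -> T -> R) : (forall i, Q (w i) (v i)) ->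
  Q (fun x => \sum_(i < n) w i x) (fun x => \sum_(i < n) v i x).
Proof.
move=> h; elim: n => [|n IH].
  by under eq_fun do rewrite big_ord0; under [X in Q _ X]eq_fun do rewrite big_ord0.
under eq_fun do rewrite big_ord_recr; under [X in Q _ X]eq_fun do rewrite big_ord_recr.
exact: form_add.
Qed.

(** Nonnegativity of the form at - s a + a' bounds the cross terms by s E(a) + E(a') / s. *)
Lemma form_young (s : R) a b a' b' : 0 < s -> Q a b -> Q a' b' ->
  - ip (fun x => a x + a' x) (fun x => b x + b' x) <=
    (1 + s) * - ip a b + (1 + s^-1) * - ip a' b'.
Proof.
move=> s0 h h'; have La := Ql h; have Lb := Qr h; have La' := Ql h'; have Lb' := Qr h'.
have := Qneg (Qlin (- s) h h'); have Lsa := L2Z (- s) La; have Lsb := L2Z (- s) Lb.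
rewrite (ipDl Lsa La' (L2D Lsb Lb')) (ipDr Lsb Lb' Lsa) (ipDr Lsb Lb' La').
rewrite (ipZl (- s) La Lsb) (ipZr (- s) Lb La) (ipZl (- s) La Lb') (ipZr (- s) Lb La').
rewrite (ipDl La La' (L2D Lb Lb')) (ipDr Lb Lb' La) (ipDr Lb Lb' La').
move: (ip a b) (ip a b') (ip a' b) (ip a' b') => p q r t h1.
rewrite -subr_ge0.
have -> : (1 + s) * - p + (1 + s^-1) * - t - - (p + q + (r + t)) =
  s^-1 * - (- s * (- s * p) + - s * q + (- s * r + t)) by field; rewrite gt_eqF.
by rewrite mulr_ge0 ?invr_ge0 ?oppr_ge0// ltW.
Qed.

(* Iterating E(a + b) <= 2 E(a) + 2 E(b) costs a factor 2^i on the i-th term. *)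
Lemma form_sum_le (C : R) n (w v : nat -> T -> R) : (forall i, Q (w i) (v i)) ->
  (forall i, - ip (w i) (v i) <= C / 4 ^+ i) ->
  - ip (fun x => \sum_(i < n) w i x) (fun x => \sum_(i < n) v i x) <= 4 * C.
Proof.
elim: n C w v => [|n IH] C w v h hC.
  under [X in ip X _]eq_fun do rewrite big_ord0; rewrite ip0l oppr0.
  have := hC 0%N; rewrite expr0 divr1; have := Qneg (h 0%N); lra.
under [X in ip X _]eq_fun do rewrite big_ord_recl.
under [X in ip _ X]eq_fun do rewrite big_ord_recl.
have h1 : forall i, Q (w i.+1) (v i.+1) by move=> i; exact: h.
apply: le_trans (form_young ltr01 (h 0%N) (form_sum n h1)) _.
have := IH (C / 4) _ _ h1 => /(_ _)/wrap[i|].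
  have := hC i.+1; rewrite exprS invfM mulrA.
  by rewrite [C / 4]mulrC -mulrA mulrC -!mulrA [_ * 4^-1]mulrC.
have := hC 0%N; rewrite expr0 divr1 invr1.
move: (- ip (w 0%N) (v 0%N)) (- ip _ _) => x y; lra.
Qed.

End nonneg_form.

Section fiber_limit.
Context (R : realType) (dS : measure_display) (S : measurableType dS)
  (mu : probability S R) (L : (S -> R) -> (S -> R) -> Prop).
Hypothesis hL : dissipative_symmetric mu L.
Implicit Types f g u v : S -> R.

Lemma preformE f g : preform mu f g = - ip mu f g. Proof. by []. Qed.

Lemma dirichlet_form_ge0 f : (0 <= dirichlet_form mu L f)%E.
Proof.
apply: le_ereal_inf_tmp => _ [e [_ [fn [Lfn [h _ _ ce]]]] <-]; rewrite lee_fin.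
have <- := cvg_lim _ ce => //; apply: limr_ge; first by apply/cvg_ex; exists e.
by apply: nearW => n; rewrite preformE oppr_ge0; exact: op_neg hL _ _ (h n).
Qed.

Lemma cvg_le_geometric (a : nat -> R) (l M : R) :
  (forall k, `|a k - l| <= M / 2 ^+ k) -> a k @[k --> \oo] --> l.
Proof.
move=> h; have M0 : 0 <= M by have := h 0%N; rewrite expr0 divr1; apply: le_trans.
have c2 : (M / 2 ^+ k : R) @[k --> \oo] --> (0 : R).
  rewrite -(mulr0 M); apply: cvgM; first exact: cvg_cst.
  under eq_cvg do rewrite -exprVn.
  by apply: cvg_expr; rewrite ger0_norm; lra.
apply/cvgrPdist_lt => e e0; have /cvgrPdist_lt /(_ _ e0) := c2.
apply: filterS => k; rewrite sub0r normrN ger0_norm ?divr_ge0 ?exprn_ge0//.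
by apply: le_lt_trans; rewrite distrC; exact: h.
Qed.

(** Here p and q are the energies of consecutive partial sums, e is that of the new term and z =
    2^k. Young's inequality with parameter 1 / z, used in both directions, bounds their difference
    by multiples of M / z. *)
Let incr_bound (M p q e z : R) : 0 <= M -> 1 <= z -> p <= 4 * M -> q <= 4 * M ->
  e <= M / z ^+ 2 -> q <= (1 + z^-1) * p + (1 + z^-1^-1) * e ->
  p <= (1 + z^-1) * q + (1 + z^-1^-1) * e -> `|q - p| <= 6 * M / z.
Proof.
move=> M0 z1 pM qM eM h1 h2; have z0 : 0 < z by exact: lt_le_trans z1.
have zp r : r <= 4 * M -> z^-1 * r <= 4 * (M / z).
  by move=> rM; rewrite mulrC mulrA; apply: ler_wpM2r => //; rewrite invr_ge0 ltW.
have ze : (1 + z) * e <= 2 * (M / z).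
  apply: (@le_trans _ _ ((1 + z) * (M / z ^+ 2))); first by apply: ler_wpM2l => //; lra.
  apply: (@le_trans _ _ ((z + z) * (M / z ^+ 2))).
    by apply: ler_wpM2r; [rewrite divr_ge0// exprn_ge0// ltW|lra].
  by rewrite le_eqVlt; apply/orP; left; apply/eqP; field; rewrite gt_eqF.
move: h1 h2 (zp _ pM) (zp _ qM) ze; rewrite invrK -!mulrA.
rewrite !(mulrDl 1 z^-1) !mul1r ler_norml.
move: (z^-1 * p) (z^-1 * q) (M / z) ((1 + z) * e) => a b c f; clear.
by move=> *; apply/andP; split; lra.
Qed.

(** The geometric decay of the term energies makes the partial sums Cauchy for the form and their
    energies convergent, so they witness that f is in the form domain. *)
Lemma closed_form_series (w v : nat -> S -> R) f (M M' : R) :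
  (forall i, L (w i) (v i)) -> f \in Lfun mu 2%:E ->
  (forall i, - ip mu (w i) (v i) <= M / 4 ^+ i) ->
  (forall k, nrm mu (fun x => \sum_(i < k) w i x - f x) <= M' / 2 ^+ k) ->
  exists2 e, closed_form mu L f e &
    - ip mu (fun x => \sum_(i < k) w i x) (fun x => \sum_(i < k) v i x)
      @[k --> \oo] --> e.
Proof.
move=> h Lf hM hM'.
have Ll := op_L2l hL; have Lr := op_L2r hL; have Lc := op_lin hL; have Ln := op_neg hL.
have L0 := op_cst hL 0.
have hs k : L (fun x => \sum_(i < k) w i x) (fun x => \sum_(i < k) v i x) := form_sum L0 Lc k h.
have M0 : 0 <= M.
  have := hM 0%N; rewrite expr0 divr1; apply: le_trans; rewrite oppr_ge0; exact: Ln (h 0%N).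
pose q k := - ip mu (fun x => \sum_(i < k) w i x) (fun x => \sum_(i < k) v i x).
have q0 k : 0 <= q k by rewrite oppr_ge0; exact: Ln (hs k).
have qM k : q k <= 4 * M := form_sum_le Ll Lr L0 Lc Ln k h hM.
have w0 k : 0 <= - ip mu (w k) (v k) by rewrite oppr_ge0; exact: Ln (h k).
have incr k : `|q k.+1 - q k| <= 6 * M / 2 ^+ k.
  have s0 : 0 < 2 ^- k :> R by rewrite invr_gt0 exprn_gt0.
  have y1 := form_young Ll Lr Lc Ln s0 (hs k) (h k).
  (* The reverse estimate: the k-th partial sum is the next one minus the new term. *)
  have y2 := form_young Ll Lr Lc Ln s0 (hs k.+1) (op_scale hL (-1) (h k)).
  have recr (a : nat -> S -> R) : (fun x => \sum_(i < k.+1) a i x) =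
      (fun x => \sum_(i < k) a i x + a k x) by apply/funext => x; rewrite big_ord_recr.
  have recB (a : nat -> S -> R) : (fun x => \sum_(i < k.+1) a i x + -1 * a k x) =
      (fun x => \sum_(i < k) a i x) by apply/funext => x; rewrite big_ord_recr/=; ring.
  have Lwk := Ll _ _ (h k); have Lvk := Lr _ _ (h k).
  rewrite !recB (ipZl (-1) Lwk (L2Z (-1) Lvk)) (ipZr (-1) Lvk Lwk) !mulN1r opprK in y2.
  rewrite -!recr in y1.
  apply: (@incr_bound M _ _ (- ip mu (w k) (v k))) => //.
  - by rewrite exprn_ege1// ler1n.
  - have -> : (2 ^+ k) ^+ 2 = 4 ^+ k :> R; last exact: hM.
    by rewrite -exprM mulnC exprM; congr (_ ^+ _); rewrite -natrX.
have cq : cvgn q := cvg_geometric_increments incr.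
exists (limn q) => //; split => //.
exists (fun k x => \sum_(i < k) w i x), (fun k x => \sum_(i < k) v i x); split => //.
- have Ls k : (fun x => \sum_(i < k) w i x) \in Lfun mu 2%:E := Ll _ _ (hs k).
  have -> : (fun k : nat => L2norm mu (fun x => \sum_(i < k) w i x - f x)) =
      (fun k => (nrm mu (fun x => \sum_(i < k) w i x - f x))%:E).
    by apply/funext => k; rewrite L2norm_nrm//; exact: L2B.
  apply: cvg_EFin; first by near=> k.
  apply: (@cvg_le_geometric _ _ M') => k; rewrite subr0 ger0_norm ?nrm_ge0//; exact: hM'.
move=> e e0.
have [N hN] : exists N, 4 * M / 2 ^+ N < e.
  have M4 : 0 <= 4 * M by rewrite mulr_ge0.
  have /cvgrPdist_lt /(_ _ e0) [N _ /(_ N (leqnn _))] :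
      (4 * M / 2 ^+ k : R) @[k --> \oo] --> (0 : R).
    apply: (@cvg_le_geometric _ _ (4 * M)) => k.
    by rewrite subr0 ger0_norm// divr_ge0// exprn_ge0.
  rewrite /= sub0r normrN ger0_norm ?divr_ge0 ?exprn_ge0// => lt; by exists N.
exists N => n k Nn Nk; rewrite preformE.
suff key n' j : (N <= n')%N -> - ip mu (fun x => \sum_(i < n' + j) w i x - \sum_(i < n') w i x)
    (fun x => \sum_(i < n' + j) v i x - \sum_(i < n') v i x) < e.
  have [nk|/ltnW kn] := leqP n k; last by have := key k (n - k)%N Nk; rewrite subnKC.
  have := key n (k - n)%N Nn; rewrite subnKC//; apply: le_lt_trans.
  rewrite le_eqVlt; apply/orP; left; apply/eqP; congr (- _).
  by apply: eq_Rintegral => x _; ring.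
move=> Nn'.
have tailE (a : nat -> S -> R) : (fun x => \sum_(i < n' + j) a i x - \sum_(i < n') a i x) =
    (fun x => \sum_(i < j) a (n' + i)%N x).
  by apply/funext => x; rewrite big_split_ord/= addrAC subrr add0r.
rewrite !tailE.
have hC i : - ip mu (w (n' + i)%N) (v (n' + i)%N) <= M / 4 ^+ n' / 4 ^+ i.
  by have := hM (n' + i)%N; rewrite exprD invfM mulrA.
have := form_sum_le Ll Lr L0 Lc Ln j (fun i => h (n' + i)%N) hC.
move/le_lt_trans; apply; apply: le_lt_trans hN.
rewrite mulrA; apply: ler_wpM2l; first by rewrite mulr_ge0.
rewrite lef_pV2 ?posrE ?exprn_gt0//; apply: (@le_trans _ _ (2 ^+ n')).
  by apply: ler_weXn2l => //; rewrite ler1n.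
by rewrite lerXn2r ?nnegrE ?ler0n// ler_nat.
Unshelve. all: by end_near. Qed.

End fiber_limit.

Section energy_limit.
Context (R : realType) (d : nat) (S : set 'rV[R]_d) (x0 : S)
  (mu : probability (state x0) R)
  (L : (state x0 -> R) -> (state x0 -> R) -> Prop) (T : R).
Hypothesis hL : dissipative_symmetric mu L.
Hypothesis hT : 0 < T.
Local Notation ST := (measurableTypeR R * state x0)%type.
Local Notation nrmT := (nrm (lebmu mu T)).
Local Notation ipT := (ip (lebmu mu T)).
Implicit Types (u v : ST -> R).

Definition fiber_op u v : Prop := [/\ L2T mu T u, L2T mu T v &
  forall t, L (fun x => u (t, x)) (fun x => v (t, x))].

Lemma fiber_op0 : fiber_op (fun=> 0) (fun=> 0).
Proof. by split; [exact: L2_0|exact: L2_0|move=> t; exact: op_cst hL 0]. Qed.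

Lemma fiber_op_lin c u v u' v' : fiber_op u v -> fiber_op u' v' ->
  fiber_op (fun z => c * u z + u' z) (fun z => c * v z + v' z).
Proof.
move=> [Lu Lv h] [Lu' Lv' h']; split; [exact: L2D (L2Z c Lu) Lu'|exact: L2D (L2Z c Lv) Lv'|].
by move=> t; exact: (op_lin hL c (h t) (h' t)).
Qed.

Lemma fiber_op_form u v : fiber_op u v ->
  let e t := - ip mu (fun x => u (t, x)) (fun x => v (t, x)) in
  [/\ measurable_fun setT e, forall t, 0 <= e t &
    (\int[leb T]_t (e t)%:E = (- ipT u v)%:E)%E].
Proof.
move=> [Lu Lv h] e; have [mb E] := fubini_ipT Lu (L2N Lv).
have eE : (fun t => ip mu (fun x => u (t, x)) (fun x => - v (t, x))) = e.
  apply/funext => t; have h1 := op_L2l hL (h t); have h2 := op_L2r hL (h t).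
  by rewrite ipC (ipNl h2 h1) ipC.
rewrite eE in mb; split => //.
- by move=> t; rewrite oppr_ge0; exact: op_neg hL _ _ (h t).
- by rewrite ipC -(ipNl Lv Lu) ipC -E; apply: eq_integral => t _; rewrite -eE.
Qed.

Lemma fiber_op_neg u v : fiber_op u v -> ipT u v <= 0.
Proof.
move=> /fiber_op_form [_ e0 E]; rewrite -oppr_ge0 -lee_fin -E.
by apply: integral_ge0 => t _; rewrite lee_fin.
Qed.

Lemma energy_le u v : fiber_op u v -> (energyT mu L T u <= (- ipT u v)%:E)%E.
Proof.
move=> h; have [me e0 <-] := fiber_op_form h; apply: ge0_ae_le_integral => //.
- by move=> t; exact: dirichlet_form_ge0.
- by apply: aeW => t; case: h => _ _ h; exact: (dirichlet_form_le hL (h t)).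
Qed.

(** Bounds integrated in t are turned into bounds on almost every slice by [ae_geometric_bound], so
    almost every slice of f is in the form domain with its energy a limit of partial-sum energies.
    Fatou's lemma integrates this back. *)
Lemma energy_series (u v : nat -> ST -> R) f (C K : R) : 0 <= K ->
  (forall k, fiber_op (u k) (v k)) -> L2T mu T f ->
  (forall k, - ipT (u k) (v k) <= C / 16 ^+ k) ->
  (forall k, nrmT (fun z => \sum_(i < k) u i z - f z) <= K / 4 ^+ k) ->
  (energyT mu L T f <= (4 * C)%:E)%E.
Proof.
move=> K0 h Lf hC hK.
have C0 : 0 <= C.
  by have := hC 0%N; rewrite expr0 divr1; apply: le_trans; rewrite oppr_ge0; exact: fiber_op_neg.
have Ql u' v' : fiber_op u' v' -> L2T mu T u' by case.
have Qr u' v' : fiber_op u' v' -> L2T mu T v' by case.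
have hs k : fiber_op (fun z => \sum_(i < k) u i z) (fun z => \sum_(i < k) v i z).
  exact: (@form_sum _ _ _ fiber_op fiber_op0 fiber_op_lin).
pose e k t := - ip mu (fun x => u k (t, x)) (fun x => v k (t, x)).
pose r k t := ip mu (fun x => \sum_(i < k) u i (t, x) - f (t, x))
  (fun x => \sum_(i < k) u i (t, x) - f (t, x)).
pose q k t := - ip mu (fun x => \sum_(i < k) u i (t, x)) (fun x => \sum_(i < k) v i (t, x)).
have LB k : L2T mu T (fun z => \sum_(i < k) u i z - f z) by apply: L2B => //; exact: Ql (hs k).
have ae_e : {ae leb T, forall t, exists M : R, forall k, e k t <= M / 4 ^+ k}.
  apply: (@ae_geometric_bound _ _ _ _ _ C) => k.
  - by have [] := fiber_op_form (h k).
  - by move=> t; have [_ e0 _] := fiber_op_form (h k); exact: e0.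
  - by have [_ _ E] := fiber_op_form (h k); rewrite /e E lee_fin.
have ae_r : {ae leb T, forall t, exists M : R, forall k, r k t <= M / 4 ^+ k}.
  apply: (@ae_geometric_bound _ _ _ _ _ (K ^+ 2)) => k.
  - by have [] := fubini_ipT (LB k) (LB k).
  - by move=> t; exact: ip_ge0.
  - have [_ E] := fubini_ipT (LB k) (LB k); rewrite /r E lee_fin -nrm_sqr.
    have -> : 16 = 4 ^+ 2 :> R by rewrite -natrX.
    rewrite -exprM mulnC exprM -expr_div_n ler_pXn2r ?nnegrE ?nrm_ge0 ?divr_ge0 ?exprn_ge0//.
have ae_f := fiber_L2T Lf.
have key : {ae leb T, forall t, exists2 l, closed_form mu L (fun x => f (t, x)) l &
    q k t @[k --> \oo] --> l}.
  apply: filterS3 ae_e ae_r ae_f => t [M hM] [M' hM'] Lft.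
  apply: (@closed_form_series _ _ _ _ _ hL (fun i x => u i (t, x)) (fun i x => v i (t, x))
    (fun x => f (t, x)) M (Num.sqrt M')) => //.
  - by move=> i; case: (h i).
  - move=> k; have M'0 : 0 <= M'.
      by have := hM' 0%N; rewrite expr0 divr1; apply: le_trans; exact: ip_ge0.
    rewrite -(@ler_pXn2r _ 2)// ?nnegrE ?nrm_ge0 ?divr_ge0 ?sqrtr_ge0 ?exprn_ge0//.
    rewrite nrm_sqr expr_div_n sqr_sqrtr//.
    have -> : (2 ^+ k) ^+ 2 = 4 ^+ k :> R; last exact: hM'.
    by rewrite -exprM mulnC exprM; congr (_ ^+ _); rewrite -natrX.
have mq k : measurable_fun setT (q k) by have [] := fiber_op_form (hs k).
have q0 k t : 0 <= q k t by have [_ q0 _] := fiber_op_form (hs k); exact: q0.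
(* A measurable function that equals the limit of the slice energies almost everywhere; it majorizes
   the energies of the slices of f there. *)
pose b t := fine (limn_esup (fun k => (q k t)%:E)).
have mb : measurable_fun setT b.
  apply: (measurableT_comp (fine_measurable measurableT)).
  by apply: measurable_fun_limn_esup => k; exact/measurable_EFinP.
have bE t l : q k t @[k --> \oo] --> l -> b t = l.
  move=> ql; have : (q k t)%:E @[k --> \oo] --> l%:E by apply: cvg_EFin => //; near=> k.
  by move=> /cvg_limn_einf_sup [_ E]; rewrite /b E.
have b0 t : 0 <= b t.
  apply: fine_ge0; apply: limf_esup_ge0; last by move=> k; rewrite lee_fin.
  exact: filter_not_empty.
apply: (@le_trans _ _ (\int[leb T]_t (b t)%:E)%E).
  apply: ge0_ae_le_integral => //; first by move=> t; exact: dirichlet_form_ge0.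
  apply: filterS key => t [l cl /bE ->]; apply: ereal_inf_lbound; by exists l.
apply: (@fatou_bound _ _ _ _ q) => //.
  by apply: filterS key => t [l _ ql]; rewrite (bE _ _ ql).
apply: nearW => k; have [_ _ E] := fiber_op_form (hs k).
rewrite /q E lee_fin; apply: (form_sum_le Ql Qr fiber_op0 fiber_op_lin fiber_op_neg) => // i.
apply: le_trans (hC i) _; apply: ler_wpM2l => //.
rewrite lef_pV2 ?posrE ?exprn_gt0//.
by rewrite lerXn2r ?nnegrE ?ler0n// ler_nat.
Unshelve. all: by end_near. Qed.

End energy_limit.

(** * Iteration *)

Lemma L2_series d (T : measurableType d) (R : realType) (m : {measure set T -> \bar R})
    (u : nat -> T -> R) (K : R) :
  (forall k, u k \in Lfun m 2%:E) -> (forall k, nrm m (u k) <= K / 4 ^+ k) ->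
  exists2 f, f \in Lfun m 2%:E &
    forall n, nrm m (fun x => \sum_(i < n) u i x - f x) <= 2 * K / 4 ^+ n.
Proof.
move=> Lu uK; apply: L2_complete; first by move=> n; exact: L2_sum.
move=> n; apply: le_trans (uK n); rewrite le_eqVlt; apply/orP; left; apply/eqP.
by congr nrm; apply/funext => x; rewrite big_ord_recr/= addrAC subrr add0r.
Qed.

Lemma poweR12_le (R : realType) (x : \bar R) (a : R) : (0 <= x)%E -> 0 <= a ->
  (x <= (a ^+ 2)%:E)%E -> (x `^ (2^-1) <= a%:E)%E.
Proof.
move=> x0 a0 xa; have -> : a%:E = ((a ^+ 2)%:E `^ 2^-1)%E.
  by rewrite poweR_EFin powR12_sqrt ?sqr_ge0// sqrtr_sqr ger0_norm.
by apply: gt0_ler_poweR => //; rewrite in_itv/= ?leey ?andbT// lee_fin sqr_ge0.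
Qed.

Section iteration.
Context (R : realType) (d : nat) (S : set 'rV[R]_d) (x0 : S)
  (mu : probability (state x0) R)
  (L : (state x0 -> R) -> (state x0 -> R) -> Prop) (T : R).
Hypothesis hL : dissipative_symmetric mu L.
Hypothesis hspec : purely_discrete_spectrum mu L.
Hypothesis hT : 0 < T.
Hypothesis hcore : operator_core mu L
       [set v : state x0 -> R | smooth_space v /\ v \in Lfun mu 2%:E].
Variable (m : R).
Hypothesis m0 : 0 < m.
Hypothesis hp : poincare mu L m.
Local Notation ST := (measurableTypeR R * state x0)%type.
Local Notation nrmT := (nrm (lebmu mu T)).
Local Notation ipT := (ip (lebmu mu T)).
Implicit Types (U W : nat -> ST -> R) (u v f g h : ST -> R).

Let L2T1 : L2T mu T (fun=> 1).
Proof. by apply: L2_cst; exact: spacetime_lty. Qed.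

Lemma op_orthogonal_cst u v : fiber_op mu L T u v -> ipT v (fun=> 1) = 0.
Proof.
move=> [_ Lv h]; rewrite ipC.
have c1 : continuous (fun _ : R => 1 : R) by move=> t; exact: cvg_cst.
rewrite -[RHS](op_orthogonal hL hT c1 Lv h); congr ip.
by apply/funext => z; rewrite mul1r.
Qed.

Lemma nice_fiber U : nice mu L T U -> fiber_op mu L T (U 0%N) (U 3%N).
Proof. by move=> nU; split; [exact: nice_L2 nU _|exact: nice_L2 nU _|exact: nice_op nU]. Qed.

Lemma nice_fibert U : nice mu L T U -> fiber_op mu L T (U 1%N) (U 4%N).
Proof. by move=> nU; split; [exact: nice_L2 nU _|exact: nice_L2 nU _|exact: nice_opt nU]. Qed.

Lemma nice_sum n (F : nat -> nat -> ST -> R) : (forall k, nice mu L T (F k)) ->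
  nice mu L T (fun i z => \sum_(k < n) F k i z).
Proof.
move=> nF; elim: n => [|n IH].
  by under eq_fun do under eq_fun do rewrite big_ord0; exact: nice0.
have := nice_lin hL 1 IH (nF n); congr nice.
by apply/funext => i; apply/funext => z; rewrite big_ord_recr/= mul1r.
Qed.

Lemma energyT_ge0 u : (0 <= energyT mu L T u)%E.
Proof. by apply: integral_ge0 => t _; exact: dirichlet_form_ge0. Qed.

(** [energy_series] applied to the terms from n on, whose energies are at most (K / 4^n)^2 / 16^k;
    its factor 4 becomes the 2 inside the square. *)
Lemma energy_tail (u v : nat -> ST -> R) f (K : R) : 0 <= K ->
  (forall k, fiber_op mu L T (u k) (v k)) -> L2T mu T f ->
  (forall k, - ipT (u k) (v k) <= (K / 4 ^+ k) ^+ 2) ->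
  (forall k, nrmT (fun z => \sum_(i < k) u i z - f z) <= 2 * K / 4 ^+ k) ->
  forall n, (energyT mu L T (fun z => f z - \sum_(i < n) u i z)%R <=
    ((2 * K / 4 ^+ n) ^+ 2)%:E)%E.
Proof.
move=> K0 h Lf hE hN n; have Lu k : L2T mu T (u k) by case: (h k).
have LS k : L2T mu T (fun z => \sum_(i < k) u i z) by apply: L2_sum => i; exact: Lu.
have -> : (2 * K / 4 ^+ n) ^+ 2 = 4 * ((K / 4 ^+ n) ^+ 2) by ring.
apply: (@energy_series _ _ _ _ _ _ _ hL (fun k => u (n + k)%N) (fun k => v (n + k)%N) _ _
  (2 * K / 4 ^+ n)).
- by rewrite divr_ge0 ?exprn_ge0// mulr_ge0.
- by move=> k; exact: h.
- by apply: L2B => //; exact: LS.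
- move=> k; apply: le_trans (hE (n + k)%N) _; rewrite le_eqVlt; apply/orP; left; apply/eqP.
  have -> : 16 = 4 ^+ 2 :> R by rewrite -natrX.
  rewrite -[in RHS]exprM [(2 * k)%N]mulnC exprM exprD; field.
  by rewrite !expf_neq0.
- move=> k; have := hN (n + k)%N; rewrite exprD invfM mulrA; apply: le_trans.
  rewrite le_eqVlt; apply/orP; left; apply/eqP; congr nrm; apply/funext => z.
  by rewrite big_split_ord/=; ring.
Qed.

Lemma geometric_small (M e : R) : 0 <= M -> 0 < e -> exists n, M / 4 ^+ n < e.
Proof.
move=> M0 e0; have /cvgrPdist_lt /(_ _ e0) [n _ /(_ n (leqnn _))] :
    (M / 2 ^+ k : R) @[k --> \oo] --> (0 : R).
  apply: (@cvg_le_geometric _ _ _ M) => k.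
  by rewrite subr0 ger0_norm// divr_ge0// exprn_ge0.
rewrite /= sub0r normrN ger0_norm ?divr_ge0 ?exprn_ge0// => lt; exists n.
apply: le_lt_trans lt; apply: ler_wpM2l => //.
by rewrite lef_pV2 ?posrE ?exprn_gt0// lerXn2r ?nnegrE ?ler0n// ler_nat.
Qed.

Lemma normT_lty u : L2T mu T u -> (normT mu T u < +oo)%E.
Proof. by move=> Lu; rewrite /normT L2norm_nrm// ltry. Qed.

Lemma energy_lty u v : fiber_op mu L T u v -> (energyT mu L T u `^ 2^-1 < +oo)%E.
Proof.
move=> h; rewrite poweR_lty//; apply: le_lt_trans (energy_le hL h) _.
by rewrite ltry.
Qed.

Lemma H12D_series (H : nat -> nat -> ST -> R) h ht (K : R) : 0 <= K ->
  (forall k, nice mu L T (H k)) -> L2T mu T h -> L2T mu T ht ->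
  (forall k, - ipT (H k 0%N) (H k 3%N) <= (K / 4 ^+ k) ^+ 2) ->
  (forall n, nrmT (fun z => \sum_(k < n) H k 0%N z - h z) <= 2 * K / 4 ^+ n) ->
  (forall n, nrmT (fun z => \sum_(k < n) H k 1%N z - ht z) <= 2 * K / 4 ^+ n) ->
  H12D mu L T h ht.
Proof.
move=> K0 nH Lh Lht hE h0 h1; split => // e e0.
have K2 : 0 <= 2 * K by rewrite mulr_ge0.
(* The partial sums are the test functions; the norm has 3 terms, each at most 2 K / 4^n. *)
have [n ltn] := geometric_small (mulr_ge0 (ler0n R 3) K2) e0.
have nS := nice_sum n nH; have LS := nice_L2 nS; have fS := nice_fiber nS.
exists (fun z => \sum_(k < n) H k 0%N z), (fun z => \sum_(k < n) H k 1%N z); split.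
- exact: nice_test nS.
- by split; [exact: LS 1%N|exact: nice_dt nS].
- rewrite /norm12 !lte_add_pinfty//; [exact: normT_lty (LS 0%N)|exact: energy_lty fS|exact: normT_lty (LS 1%N)].
have Ln u f : L2T mu T u -> L2T mu T f -> nrmT (fun z => u z - f z) <= 2 * K / 4 ^+ n ->
    (normT mu T (fun z => f z - u z)%R <= (2 * K / 4 ^+ n)%:E)%E.
  by move=> Lu Lf le; rewrite /normT L2norm_nrm ?lee_fin 1?nrmBC//; exact: L2B.
have En := energy_tail K0 (fun k => nice_fiber (nH k)) Lh hE h0 n.
have E2 := poweR12_le (energyT_ge0 _) (divr_ge0 K2 (exprn_ge0 n (ler0n R 4))) En.
apply: le_lt_trans (leeD (leeD (Ln _ _ (LS 0%N) Lh (h0 n)) E2) (Ln _ _ (LS 1%N) Lht (h1 n))) _.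
rewrite -!EFinD lte_fin; apply: le_lt_trans ltn.
by rewrite le_eqVlt; apply/orP; left; apply/eqP; ring.
Qed.

Lemma H22D_series (G : nat -> nat -> ST -> R) g gt Lg gtt (K : R) : 0 <= K ->
  (forall k, nice mu L T (G k)) -> L2T mu T g -> L2T mu T gt -> L2T mu T Lg -> L2T mu T gtt ->
  (forall k, - ipT (G k 0%N) (G k 3%N) <= (K / 4 ^+ k) ^+ 2) ->
  (forall k, - ipT (G k 1%N) (G k 4%N) <= (K / 4 ^+ k) ^+ 2) ->
  (forall n, nrmT (fun z => \sum_(k < n) G k 0%N z - g z) <= 2 * K / 4 ^+ n) ->
  (forall n, nrmT (fun z => \sum_(k < n) G k 1%N z - gt z) <= 2 * K / 4 ^+ n) ->
  (forall n, nrmT (fun z => \sum_(k < n) G k 3%N z - Lg z) <= 2 * K / 4 ^+ n) ->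
  (forall n, nrmT (fun z => \sum_(k < n) G k 2%N z - gtt z) <= 2 * K / 4 ^+ n) ->
  H22D mu L T g gt Lg gtt.
Proof.
move=> K0 nG Lg0 Lg1 Lg3 Lg2 hE hEt h0 h1 h3 h2; split => // e e0.
have K2 : 0 <= 2 * K by rewrite mulr_ge0.
(* As before, now with the 6 terms of the second norm. *)
have [n ltn] := geometric_small (mulr_ge0 (ler0n R 6) K2) e0.
have nS := nice_sum n nG; have LS := nice_L2 nS.
have fS := nice_fiber nS; have fSt := nice_fibert nS.
exists (fun z => \sum_(k < n) G k 0%N z), (fun z => \sum_(k < n) G k 1%N z),
  (fun z => \sum_(k < n) G k 3%N z), (fun z => \sum_(k < n) G k 2%N z); split.
- exact: nice_test nS.
- by split; [exact: LS 1%N|exact: LS 3%N|exact: LS 2%N].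
- split; [exact: nice_dt nS| |exact: nice_dtt nS].
  by apply: aeW; exact: nice_op nS.
- rewrite /norm22 !lte_add_pinfty//; [exact: normT_lty (LS 0%N)|exact: energy_lty fS|
    exact: normT_lty (LS 1%N)|exact: normT_lty (LS 3%N)|exact: normT_lty (LS 2%N)|
    exact: energy_lty fSt].
have Ln u f : L2T mu T u -> L2T mu T f -> nrmT (fun z => u z - f z) <= 2 * K / 4 ^+ n ->
    (normT mu T (fun z => f z - u z)%R <= (2 * K / 4 ^+ n)%:E)%E.
  by move=> Lu Lf le; rewrite /normT L2norm_nrm ?lee_fin 1?nrmBC//; exact: L2B.
have a0 := divr_ge0 K2 (exprn_ge0 n (ler0n R 4)).
have En := poweR12_le (energyT_ge0 _) a0 (energy_tail K0 (fun k => nice_fiber (nG k)) Lg0 hE h0 n).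
have Et := poweR12_le (energyT_ge0 _) a0 (energy_tail K0 (fun k => nice_fibert (nG k)) Lg1 hEt h1 n).
apply: le_lt_trans (leeD (leeD (leeD (leeD (leeD (Ln _ _ (LS 0%N) Lg0 (h0 n)) En)
  (Ln _ _ (LS 1%N) Lg1 (h1 n))) (Ln _ _ (LS 3%N) Lg3 (h3 n))) (Ln _ _ (LS 2%N) Lg2 (h2 n))) Et) _.
rewrite -!EFinD lte_fin; apply: le_lt_trans ltn.
by rewrite le_eqVlt; apply/orP; left; apply/eqP; ring.
Qed.

Lemma correction_series : exists2 C : R, 0 < C & forall f, L2T mu T f -> ipT f (fun=> 1) = 0 ->
  exists H G : nat -> nat -> ST -> R, let K := C * nrmT f in
  [/\ forall k, nice mu L T (H k) /\ nice mu L T (G k),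
      forall k i, (i < 2)%N -> nrmT (H k i) <= K / 4 ^+ k,
      forall k i, (i < 4)%N -> nrmT (G k i) <= K / 4 ^+ k,
      forall k, [/\ - ipT (H k 0%N) (H k 3%N) <= (K / 4 ^+ k) ^+ 2,
        - ipT (G k 0%N) (G k 3%N) <= (K / 4 ^+ k) ^+ 2 &
        - ipT (G k 1%N) (G k 4%N) <= (K / 4 ^+ k) ^+ 2]
    & forall n, nrmT (fun z => f z - (\sum_(k < n) H k 1%N z - 2 * \sum_(k < n) G k 3%N z))
        <= nrmT f / 4 ^+ n].
Proof.
have [C C0 hC] := step_correction hL hspec hT hcore m0 hp; exists C => // f Lf f0.
(* The correction is chosen as a total function, with value 0 outside the mean-zero
   square-integrable functions. *)
have /choice [next nextP] : forall r : ST -> R, exists HG : (nat -> ST -> R) * (nat -> ST -> R),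
    L2T mu T r -> ipT r (fun=> 1) = 0 -> correction mu L T C r HG.1 HG.2.
  move=> r; have [[Lr r0]|nr] := pselect (L2T mu T r /\ ipT r (fun=> 1) = 0).
    by have [H [G hHG]] := hC r Lr r0; exists (H, G).
  by exists (fun _ _ => 0, fun _ _ => 0) => Lr r0; case: nr.
(* The residual after k corrections, which is the right-hand side of the next one. *)
pose r k := iter k (fun s z => s z - ((next s).1 1%N z - 2 * (next s).2 3%N z)) f.
have rP k : [/\ L2T mu T (r k), ipT (r k) (fun=> 1) = 0 & nrmT (r k) <= nrmT f / 4 ^+ k].
  elim: k => [|k [Lr r0 rk]]; first by split; rewrite // expr0 divr1.
  have c := nextP _ Lr r0; have nH := cor_h c; have nG := cor_g c.
  have LH := nice_L2 nH 1%N; have LG := nice_L2 nG 3%N; have LG2 := L2Z 2 LG.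
  have LB := L2B LH LG2.
  split; first exact: L2B Lr LB.
    (* The residual keeps total mean zero: d_t h integrates to 0 by the boundary values, and L g is
       orthogonal to constants. *)
    rewrite (ipBl Lr LB L2T1) (ipBl LH LG2 L2T1) (ipZl 2 LG L2T1) r0 (nice_mean nH).
    by rewrite (op_orthogonal_cst (nice_fiber nG)) mulr0 !subr0.
  apply: le_trans (cor_res c) _; rewrite exprSr invfM mulrA; exact: ler_wpM2r.
have cP k := let: And3 Lr r0 _ := rP k in nextP _ Lr r0.
have rK k : C * nrmT (r k) <= C * nrmT f / 4 ^+ k.
  by rewrite -mulrA; apply: ler_wpM2l; [exact: ltW|case: (rP k)].
have sq k x : x <= (C * nrmT (r k)) ^+ 2 -> x <= (C * nrmT f / 4 ^+ k) ^+ 2.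
  move/le_trans; apply; rewrite ler_pXn2r// nnegrE.
    by rewrite mulr_ge0 ?nrm_ge0 ?ltW.
  by rewrite divr_ge0 ?exprn_ge0// mulr_ge0 ?nrm_ge0 ?ltW.
exists (fun k => (next (r k)).1), (fun k => (next (r k)).2) => K; split.
- by move=> k; split; [exact: cor_h (cP k)|exact: cor_g (cP k)].
- by move=> k i i2; apply: le_trans (rK k); exact: cor_hn (cP k) _ i2.
- by move=> k i i4; apply: le_trans (rK k); exact: cor_gn (cP k) _ i4.
- by move=> k; split; apply: sq; [exact: cor_he (cP k)|exact: cor_ge (cP k)|exact: cor_gte (cP k)].
- move=> n; have [_ _] := rP n; apply: le_trans.
  rewrite le_eqVlt; apply/orP; left; apply/eqP; congr nrm; apply/funext => z.
  elim: n => [|n IH]; first by rewrite !big_ord0 mulr0 !subr0.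
  by rewrite !big_ord_recr/= -IH; ring.
Qed.

Let residual_bound (a K p x y : R) : 0 < p -> y <= 2 * K / p -> x <= 2 * K / p ->
  a / p + (x + 2 * y) <= (a + 6 * K) / p.
Proof.
move=> p0 yK xK; have -> : (a + 6 * K) / p = a / p + (2 * K / p + 2 * (2 * K / p)).
  by field; rewrite gt_eqF.
by rewrite lerD2l; apply: lerD => //; apply: ler_wpM2l.
Qed.

Let double_sqr (K : R) : 2 * (2 * K) ^+ 2 <= (4 * K) ^+ 2.
Proof. by have := sqr_ge0 K; rewrite !exprMn -!natrX; lra. Qed.

Lemma divergence_decomposition : exists2 C : R, 0 < C & forall f, L2T mu T f ->
  ipT f (fun=> 1) = 0 -> exists h ht g gt Lg gtt,
  [/\ H12D mu L T h ht, H22D mu L T g gt Lg gtt,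
    (fun z => ht z - 2 * Lg z) = f %[ae lebmu mu T]
  & [/\ (normT mu T (fun z => 2 * Lg z)%R <= (C * nrmT f)%:E)%E,
      ((2%:E * energyT mu L T h) `^ (2^-1) <= (C * nrmT f)%:E)%E
    & ((2%:E * energyT mu L T gt) `^ (2^-1) <= (C * nrmT f)%:E)%E]].
Proof.
have [C C0 hC] := correction_series; exists (4 * C); first by rewrite mulr_gt0.
move=> f Lf f0; have [H [G [hn hH hG hE hf]]] := hC f Lf f0.
set K := C * nrmT f in hH hG hE.
have K0 : 0 <= K by rewrite mulr_ge0 ?nrm_ge0 ?ltW.
have nH k : nice mu L T (H k) by case: (hn k).
have nG k : nice mu L T (G k) by case: (hn k).
have LH i k := nice_L2 (nH k) i; have LG i k := nice_L2 (nG k) i.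
have [h Lh hh] := L2_series (LH 0%N) (fun k => hH k 0%N isT).
have [ht Lht hht] := L2_series (LH 1%N) (fun k => hH k 1%N isT).
have [g Lg hg] := L2_series (LG 0%N) (fun k => hG k 0%N isT).
have [gt Lgt hgt] := L2_series (LG 1%N) (fun k => hG k 1%N isT).
have [gtt Lgtt hgtt] := L2_series (LG 2%N) (fun k => hG k 2%N isT).
have [Lu LLu hLu] := L2_series (LG 3%N) (fun k => hG k 3%N isT).
have hE1 k : - ipT (H k 0%N) (H k 3%N) <= (K / 4 ^+ k) ^+ 2 by case: (hE k).
have hE2 k : - ipT (G k 0%N) (G k 3%N) <= (K / 4 ^+ k) ^+ 2 by case: (hE k).
have hE3 k : - ipT (G k 1%N) (G k 4%N) <= (K / 4 ^+ k) ^+ 2 by case: (hE k).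
have energy0 (u v : nat -> ST -> R) r : (forall k, fiber_op mu L T (u k) (v k)) -> L2T mu T r ->
    (forall k, - ipT (u k) (v k) <= (K / 4 ^+ k) ^+ 2) ->
    (forall k, nrmT (fun z => \sum_(i < k) u i z - r z) <= 2 * K / 4 ^+ k) ->
    ((2%:E * energyT mu L T r) `^ (2^-1) <= (4 * C * nrmT f)%:E)%E.
  (* The tail from 0 is the whole function: its energy is at most (2 K)^2, and 2 (2 K)^2 <= (4 K)^2
     accounts for the constant 4 C. *)
  move=> fu Lr rE rN; have := energy_tail K0 fu Lr rE rN 0.
  under eq_fun do rewrite big_ord0 subr0.
  rewrite expr0 divr1 => le.
  have K4 : 0 <= 4 * K by rewrite mulr_ge0.
  rewrite -mulrA -/K; apply: poweR12_le => //.
    by apply: mule_ge0; [rewrite lee_fin|exact: energyT_ge0].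
  have le2 : (2%:E * energyT mu L T r <= 2%:E * ((2 * K) ^+ 2)%:E)%E.
    by apply: lee_wpmul2l => //; rewrite lee_fin.
  apply: le_trans le2 _; rewrite -EFinM lee_fin.
  exact: double_sqr.
exists h, ht, g, gt, Lu, gtt; split.
- exact: (@H12D_series H h ht K).
- exact: (@H22D_series G g gt Lu gtt K).
- have L2Lu := L2Z 2 LLu; have LB := L2B Lht L2Lu.
  apply/ae_eq_nrm => //; apply/eqP; rewrite eq_le nrm_ge0 andbT.
  apply/ler_addgt0Pl => e e0; rewrite addr0.
  have M0 : 0 <= nrmT f + 6 * K by rewrite addr_ge0 ?nrm_ge0// mulr_ge0.
  have [n /ltW ltn] := geometric_small M0 e0; apply: le_trans ltn.
  have LS1 : L2T mu T (fun z => \sum_(k < n) H k 1%N z) := L2_sum (fun k => LH 1%N k).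
  have LS3 : L2T mu T (fun z => \sum_(k < n) G k 3%N z) := L2_sum (fun k => LG 3%N k).
  have LB1 := L2B LS1 Lht; have LB3 := L2Z 2 (L2B LS3 LLu).
  have LR := L2B Lf (L2B LS1 (L2Z 2 LS3)).
  rewrite nrmBC.
  have -> : (fun z => f z - (ht z - 2 * Lu z)) =
      (fun z => (f z - (\sum_(k < n) H k 1%N z - 2 * \sum_(k < n) G k 3%N z)) +
        ((\sum_(k < n) H k 1%N z - ht z) - 2 * (\sum_(k < n) G k 3%N z - Lu z))).
    by apply/funext => z; ring.
  apply: le_trans (nrmD LR (L2B LB1 LB3)) _.
  apply: le_trans (lerD (hf n) (nrmB LB1 LB3)) _.
  rewrite (nrmZ 2 (L2B LS3 LLu)) ger0_norm//.
  by apply: residual_bound (hLu n) (hht n); rewrite exprn_gt0.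
- split.
  + have : nrmT Lu <= 2 * K.
      have := hLu 0%N; rewrite expr0 divr1 -(nrmN _ Lu); apply: le_trans.
      rewrite le_eqVlt; apply/orP; left; apply/eqP; congr nrm.
      by apply/funext => z; rewrite big_ord0 sub0r.
    move=> le; rewrite /normT L2norm_nrm; last exact: L2Z.
    rewrite lee_fin (nrmZ 2 LLu) ger0_norm// -mulrA -/K (natrM R 2 2) -mulrA.
    exact: ler_wpM2l.
  + by apply: (energy0 (fun k => H k 0%N) (fun k => H k 3%N)) => // k; exact: nice_fiber.
  + by apply: (energy0 (fun k => G k 1%N) (fun k => G k 4%N)) => // k; exact: nice_fibert.
Qed.

End iteration.

Lemma generator_dissipative (R : realType) (dS : measure_display) (S : measurableType dS)
    (dO : measure_display) (Omega : measurableType dO) (P : R.-pker S ~> Omega)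
    (X : R -> Omega -> S) (mu : probability S R) :
  (forall t : R, 0 <= t -> measurable_fun setT (X t)) -> reversible P X mu ->
  dissipative_symmetric mu (generator P X mu).
Proof.
move=> mX hrev; split.
- by move=> u v; exact: generatorL.
- by move=> u v; exact: generatorR.
- by move=> *; exact: (generator_linear mX hrev).
- by move=> u v u' v' h Lu Lv e1 e2; exact: (generator_ae mX hrev h Lu Lv e1 e2).
- by move=> u v v' h h'; exact: (generator_uniq mX hrev h h').
- by move=> *; exact: (generator_cst mX hrev).
- by move=> *; exact: (generator_sym mX hrev).
- by move=> *; exact: (generator_neg mX hrev).
Qed.

Theorem lemma16 (R : realType) (d : nat) (S : set 'rV[R]_d) (x0 : S)
    (dO : measure_display) (Omega : measurableType dO)
    (P : R.-pker (state x0) ~> Omega) (X : R -> Omega -> state x0)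
    (mu : probability (state x0) R)
    (hX : diffusion_process P X) (hrev : reversible P X mu)
    (hdom : [set v : state x0 -> R | smooth_space v /\ v \in Lfun mu 2%:E]
              `<=` opdom (generator P X mu))
    (hcore : operator_core mu (generator P X mu)
       [set v : state x0 -> R | smooth_space v /\ v \in Lfun mu 2%:E])
    (hspec : purely_discrete_spectrum mu (generator P X mu))
    (m : R) (hm : 0 < m) (hpoincare : poincare mu (generator P X mu) m)
    (T : R) (hT : 0 < T) :
  exists C : R, 0 < C /\
  forall f : measurableTypeR R * state x0 -> R,
    L2T mu T f -> (\int[lebmu mu T]_z (f z)%:E = 0)%E ->
  exists h ht g gt Lg gtt : measurableTypeR R * state x0 -> R,
    [/\ H12D mu (generator P X mu) T h ht,
        H22D mu (generator P X mu) T g gt Lg gtt,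
        (fun z => ht z - 2 * Lg z) = f %[ae lebmu mu T]
      & [/\ (normT mu T (fun z => 2 * Lg z)%R <= C%:E * normT mu T f)%E,
            ((2%:E * energyT mu (generator P X mu) T h) `^ (2^-1)
               <= C%:E * normT mu T f)%E
          & ((2%:E * energyT mu (generator P X mu) T gt) `^ (2^-1)
               <= (C * (1 + T^-1 * (Num.sqrt m)^-1))%:E * normT mu T f)%E]].
Proof.
have hL : dissipative_symmetric mu (generator P X mu).
  by apply: generator_dissipative => //; case: hX => -[].
have [C C0 hC] := divergence_decomposition hL hspec hT hcore hm hpoincare.
exists C; split => // f Lf f0.
have L1 : L2T mu T (fun=> 1) by apply: L2_cst; exact: spacetime_lty.
have f1 : ip (lebmu mu T) f (fun=> 1) = 0.
  by rewrite /ip /Rintegral; under eq_integral do rewrite mulr1; rewrite f0.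
have [h [ht [g [gt [Lg [gtt [H1 H2 E [B1 B2 B3]]]]]]]] := hC f Lf f1.
have nE : normT mu T f = (nrm (lebmu mu T) f)%:E by exact: L2norm_nrm.
exists h, ht, g, gt, Lg, gtt; rewrite nE -!EFinM; split; [exact: H1|exact: H2|exact: E|].
split; [exact: B1|exact: B2|]; apply: le_trans B3 _; rewrite lee_fin; apply: ler_wpM2r; first exact: nrm_ge0.
(* C may depend on T and m, and the factor 1 + T^-1 m^(-1/2) is at least 1. *)
rewrite ler_peMr ?(ltW C0)// lerDl mulr_ge0 ?invr_ge0 ?sqrtr_ge0//; exact: ltW.
Qed.
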